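(* Let $\Omega\subset\mathbb{R}^{2}$ be a domain, $\vec F\in C^{1}(\Omega)$ a planar vector field, $H\in C^{0}(\Omega)$, and let $u:\Omega\to\mathbb{R}$ be a $C^{1}$ smooth function with $\nabla u+\vec F\neq0$ everywhere in $\Omega$ (i.e. $\Omega$ is nonsingular) which is a weak solution to $\operatorname{div}N=H$, $N\equiv\frac{\nabla u+\vec F}{|\nabla u+\vec F|}$, in $\Omega$, i.e. $$\int_{\Omega}N\cdot\nabla\varphi+\int_{\Omega}H\varphi=0\qquad\text{for all }\varphi\in C_{0}^{\infty}(\Omega).$$ Suppose that $N(H)$ exists and is continuous. Let $\theta$ denote the (locally defined) continuous function with $N=(\cos\theta,\sin\theta)$, and let $D\equiv|\nabla u+\vec F|$. Then $\theta\in C^{1}$, and the characteristic and seed curves are $C^{2}$ smooth. Moreover, $N^{\perp}D$ exists and is continuous in $\Omega$. In characteristic coordinates $(s,t)$ near a given point, with associated functions $f,g$ (as described in the context), we have $$\theta_{t}\equiv\frac{\partial\theta}{\partial t}=\frac{\operatorname{rot}\vec F}{gD^{2}}-\frac{N^{\perp}(\log D)}{gD}=\frac{1}{gD^{2}}\big(\operatorname{rot}\vec F-N^{\perp}D\big).$$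
   Context: $N^{\perp}$ is the rotation of $N$ by $-\pi/2$, i.e. $N^{\perp}=(\sin\theta,-\cos\theta)$. Seed curves are integral curves of $N$; characteristic curves are integral curves of $N^{\perp}$. For a continuous function $h$, $(Nh)(x,y)$ (also written $N(h)$) denotes the derivative, if it exists, of $h$ with respect to arc length $\tau$ at $(x,y)$ along the seed curve $\Lambda$ through $(x,y)$ with $d\Lambda/d\tau=N$; $(N^{\perp}h)(x,y)$ is the analogous derivative along the characteristic curve through $(x,y)$ in the direction $N^{\perp}$. For $\vec F=(F_{1},F_{2})$, $\operatorname{rot}\vec F:=(F_{2})_{x}-(F_{1})_{y}$. Characteristic coordinates near a point $p_{0}\in\Omega$: in the setting of the claim there exist, on a neighborhood of $p_{0}$, real $C^{1}$ functions $s,t$ and positive continuous functions $f,g$ such that $\{t=\text{constant}\}$ are characteristic curves, $\{s=\text{constant}\}$ are seed curves, $\nabla s=fN^{\perp}$, $\nabla t=gDN$, $Nf$ and $N^{\perp}g$ exist and are continuous with $Nf+fH=0$ and $N^{\perp}g+\frac{(\operatorname{rot}\vec F)g}{D}=0$, and $\Psi:(x,y)\mapsto(s,t)$ is a $C^{1}$ diffeomorphism onto its image with $\Psi^{*}\big(\frac{ds^{2}}{f^{2}}+\frac{dt^{2}}{g^{2}D^{2}}\big)=dx^{2}+dy^{2}$. *)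

(* Defs.v *)
(* The plane is [R * R] for [R : realType].  Functions are
   total and only their values on the relevant open set matter. *)
From HB Require Import structures.
From mathcomp Require Import all_boot all_order all_algebra.
From mathcomp Require Import all_classical all_reals all_analysis.
Set Implicit Arguments.
Unset Strict Implicit.
Unset Printing Implicit Defensive.
Import Order.TTheory GRing.Theory Num.Theory.
Import numFieldNormedType.Exports.
Local Open Scope classical_set_scope.
Local Open Scope ring_scope.

Section Plane.
Context {R : realType}.
Implicit Types (U Omega : set (R * R)) (f g h k s t u theta H : R * R -> R).
Implicit Types (F V N Phi : R * R -> R * R) (p q v w : R * R) (I : set R).
Implicit Types (c : R -> R * R).

Definition domain Omega := [/\ open Omega, connected Omega & Omega !=set0].

Definition e_x : R * R := (1, 0).
Definition e_y : R * R := (0, 1).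

Definition continuous_in U h := forall p, U p -> {for p, continuous h}.

(* [U] is meant to be open; [C^k] is expressed through partial derivatives. *)
Fixpoint Ck (n : nat) U h : Prop :=
  continuous_in U h /\
  if n is n'.+1 then
    [/\ forall p, U p -> derivable h p e_x /\ derivable h p e_y,
        Ck n' U (fun p => 'D_e_x h p) & Ck n' U (fun p => 'D_e_y h p)]
  else True.

Definition Ck_field (n : nat) U V : Prop :=
  Ck n U (fun p => (V p).1) /\ Ck n U (fun p => (V p).2).

Definition grad h p : R * R := ('D_e_x h p, 'D_e_y h p).

Definition curl F p : R :=
  'D_e_x (fun q => (F q).2) p - 'D_e_y (fun q => (F q).1) p.

Definition dot v w : R := v.1 * w.1 + v.2 * w.2.

(* The library norm on [R * R] is the max norm, hence this definition. *)
Definition euclid v : R := Num.sqrt (dot v v).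

(* Rotation by [- pi / 2]. *)
Definition perp v : R * R := (v.2, - v.1).

Definition Dlen u F p : R := euclid (grad u p + F p).

Definition normal u F p : R * R := (Dlen u F p)^-1 *: (grad u p + F p).

Definition normal_perp u F p : R * R := perp (normal u F p).

Definition test_function Omega (phi : R * R -> R) : Prop :=
  (forall n, Ck n setT phi) /\
  exists K, [/\ compact K, K `<=` Omega & forall p, ~ K p -> phi p = 0].

(* [div N = H] in the sense of distributions. *)
Definition weak_div_eq Omega N H : Prop :=
  forall phi, test_function Omega phi ->
    (\int[(lebesgue_measure \x lebesgue_measure)%E]_(p in Omega)
        (dot (N p) (grad phi p))%:E
     + \int[(lebesgue_measure \x lebesgue_measure)%E]_(p in Omega)
        (H p * phi p)%:E = 0)%E.

Definition integral_curve V U I c : Prop :=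
  [/\ open I, is_interval I &
      forall tau, I tau -> U (c tau) /\ is_derive tau 1 c (V (c tau))].

Definition C2_curve I c : Prop :=
  forall tau, I tau ->
    [/\ derivable c tau 1, derivable (derive1 c) tau 1 &
        {for tau, continuous (derive1 (derive1 c))}].

(* [l] is the derivative of [h] at [p] along the integral curve of [V] through
   [p].  [V] may be merely continuous, so an integral curve through [p] is
   required to exist, and all of them have to give the same derivative.  For
   the unit fields [normal] and [normal_perp] the parameter is arc length. *)
Definition derivative_along V U h p (l : R) : Prop :=
  (exists I c, [/\ integral_curve V U I c, I 0 & c 0 = p]) /\
  (forall I c, integral_curve V U I c -> I 0 -> c 0 = p ->
     is_derive (0 : R) 1 (h \o c) l).

Definition continuous_derivative_along V U h k : Prop :=
  continuous_in U k /\ forall p, U p -> derivative_along V U h p (k p).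

(* Locally, each level set of [h] is the trace of an integral curve of [V]. *)
Definition level_sets_are_curves V U h : Prop :=
  forall p, U p -> exists W I c,
    [/\ open_nbhs p W /\ W `<=` U, integral_curve V W I c, I 0, c 0 = p &
        W `&` [set q | h q = h p] = c @` I].

(* A continuous angle function of the unit field [N]. *)
Definition angle_of N U theta : Prop :=
  continuous_in U theta /\
  forall p, U p -> N p = (cos (theta p), sin (theta p)).

(* Characteristic coordinates on [U]; [Phi] is the inverse of
   [Psi = (s, t) : U -> Psi(U)]. *)
Record char_coords u F H U s t f g Phi : Prop := CharCoords {
  cc_s_C1 : Ck 1 U s;
  cc_t_C1 : Ck 1 U t;
  cc_f_cont : continuous_in U f;
  cc_g_cont : continuous_in U g;
  cc_f_pos : forall p, U p -> 0 < f p;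
  cc_g_pos : forall p, U p -> 0 < g p;
  cc_t_levels : level_sets_are_curves (normal_perp u F) U t;
  cc_s_levels : level_sets_are_curves (normal u F) U s;
  cc_grad_s : forall p, U p -> grad s p = f p *: normal_perp u F p;
  cc_grad_t : forall p, U p -> grad t p = (g p * Dlen u F p) *: normal u F p;
  cc_Nf : exists2 Nf, continuous_derivative_along (normal u F) U f Nf &
    forall p, U p -> Nf p + f p * H p = 0;
  cc_Npg : exists2 Npg, continuous_derivative_along (normal_perp u F) U g Npg &
    forall p, U p -> Npg p + curl F p * g p / Dlen u F p = 0;
  cc_img_open : open ((fun p => (s p, t p)) @` U);
  cc_inv : forall p, U p -> Phi (s p, t p) = p;
  cc_inv_C1 : Ck_field 1 ((fun p => (s p, t p)) @` U) Phi;
  (* [ds^2 / f^2 + dt^2 / (g^2 D^2) = dx^2 + dy^2] on tangent vectors *)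
  cc_metric : forall p v, U p ->
    dot (grad s p) v ^+ 2 / f p ^+ 2
    + dot (grad t p) v ^+ 2 / (g p ^+ 2 * Dlen u F p ^+ 2)
    = v.1 ^+ 2 + v.2 ^+ 2
}.

End Plane.

(* Main.v *)
Require Import Defs.
From HB Require Import structures.
From mathcomp Require Import all_boot all_order all_algebra.
From mathcomp Require Import all_classical all_reals all_analysis.
From mathcomp Require Import measurable_realfun ring lra.
Set Implicit Arguments.
Unset Strict Implicit.
Unset Printing Implicit Defensive.
Import Order.TTheory GRing.Theory Num.Theory.
Import numFieldNormedType.Exports.
Local Open Scope classical_set_scope.
Local Open Scope ring_scope.

(* The difficulty is that N is only continuous.  On a small box div N = H yields
   a potential V of the rotated field, up to a primitive of H, and u, corrected
   by a primitive of F2, is a potential for the characteristics.  Using such a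
   potential as a coordinate turns the integral curves of the continuous field
   into solutions of an equation that is C^1 in the unknown, so the curves
   depend in a C^1 way on their label.
   Assume N2 > 0 on the box and write characteristics as x |-> C(x, t).  Since
   |N| = 1, a characteristic maximizes the flux of N among its vertical
   translates, whence (N1)' = H along it, that is, theta' = - H / N2.
   Transporting H along the seed curves, which is where N(H) is used, produces
   Y for which theta + Y has along characteristics a derivative that is C^1 in
   the transversal variable; hence theta = o(t) - G(x, t) with G of class C^1.
   As C' = - cot theta with C of class C^1 in t, this forces o, and so theta,
   to be C^1.
   For the speed, differentiating u(c + e v) - u(c) along a characteristic c and
   letting e tend to 0 gives N^perp D = rot F - D N(theta).  Finally
   the partial derivative of Phi in t is N / (g D), so theta_t = N(theta) / (g D). *)

(** * Calculus with continuous partial derivatives on boxes *)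

Section Calculus1.
Context {R : realType}.
Implicit Types (f g : R -> R) (a b x y r s t e d : R).

(** As u is only C^1 and H is differentiable only along N, nothing can at first be differentiated
    across the characteristics: every transversal derivative has to be read off a potential. A
    continuous H is absorbed by a primitive in one coordinate: div N = H makes (N2 - int H dy, - N1)
    a gradient, and also (N2, int H dx - N1). The two gauges serve different curves. The first
    measures the flux of N through vertical translates of a characteristic; the second potential has
    derivative int H dx along a seed curve, which is C^1 in x and makes the equation of these curves
    Lipschitz. Applied to H N, whose divergence is N(H) + H^2 by the product rule, the same device
    gives Y: along a characteristic its x-derivative is H / N2 minus a y-primitive of N(H) + H^2,
    and the first term is - theta'. The speed formula is formally rot (D N) = rot F, from rot grad u
    = 0; since u is only C^1, this is accessible only through difference quotients of u. *)

Lemma cont1P f x : {for x, continuous f} <->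
  forall e, 0 < e -> exists2 d, 0 < d & forall y, `|y - x| < d -> `|f y - f x| < e.
Proof.
split=> [fx e e0|fx].
  have /cvgrPdist_lt/(_ _ e0) := fx; rewrite /prop_near1 /= => /nbhs_ballP[d /= d0 H].
  by exists d => // y yx; rewrite distrC; apply: H; rewrite /ball/= distrC.
apply/cvgrPdist_lt => e /fx[d d0 H].
apply/nbhs_ballP; exists d => //= y; rewrite /ball/= distrC => yx.
by rewrite distrC; exact: H.
Qed.

Lemma is_deriveP f x (l : R) : is_derive x 1 f l <->
  forall e, 0 < e -> exists2 d, 0 < d &
    forall y, `|y - x| < d -> `|f y - f x - l * (y - x)| <= e * `|y - x|.
Proof.
split=> [[dfx <-] e e0|H].
  have : (fun h => h^-1 *: ((f \o shift x) (h *: 1) - f x)) @ 0^' --> 'D_1 f x by exact: dfx.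
  move/cvgrPdist_le => /(_ _ e0); rewrite /prop_near1 => /nbhs_ballP[d /= d0 H].
  exists d => // y yx; have [->|yNx] := eqVneq y x.
    by rewrite !subrr mulr0 subrr normr0 mulr0.
  have nz : y - x != 0 by rewrite subr_eq0.
  have := H (y - x); rewrite /ball /= sub0r normrN => /(_ yx nz) /=.
  rewrite /shift/= [_ *: 1]mulr1 subrK => {}H.
  rewrite -ler_pdivrMr ?normr_gt0// -normfV -normrM.
  rewrite distrC in H; congr (_ <= _): H; congr Num.norm.
  by rewrite mulrBl mulfK// mulrC.
have C : (fun h => h^-1 *: ((f \o shift x) (h *: 1) - f x)) @ 0^' --> l.
  apply/cvgrPdist_le => e /H[d d0 {}H]; apply/nbhs_ballP; exists d => //= h.
  rewrite /ball/= sub0r normrN => hd h0; rewrite /shift/= [_ *: 1]mulr1.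
  have := H (h + x); rewrite addrK => /(_ hd).
  rewrite -ler_pdivrMr ?normr_gt0// -normfV -normrM => {}H.
  rewrite distrC; congr (_ <= _): H; congr Num.norm.
  by rewrite mulrBl mulfK// mulrC.
by split; [exact: cvgP C|exact: cvg_lim C].
Qed.

Lemma is_derive_cont f x (l : R) : is_derive x 1 f l -> {for x, continuous f}.
Proof. by move=> [/derivable1_diffP/differentiable_continuous]. Qed.

Lemma is_derive_locally f g x (l r : R) : 0 < r ->
  (forall y, `|y - x| < r -> f y = g y) -> is_derive x 1 f l -> is_derive x 1 g l.
Proof.
move=> r0 fg; apply: near_eq_is_derive; apply/nbhs_ballP; exists r => //= y.
by rewrite /ball/= distrC => /fg.
Qed.

Lemma is_derive_val f x (l l' : R) : is_derive x 1 f l -> l = l' -> is_derive x 1 f l'.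
Proof. by move=> ? <-. Qed.

Lemma is_derive1_uniq f x (l l' : R) : is_derive x 1 f l -> is_derive x 1 f l' -> l = l'.
Proof. by move=> [_ <-] [_ <-]. Qed.

Lemma is_derive_compR f g x (l m : R) :
  is_derive x 1 g m -> is_derive (g x) 1 f l -> is_derive x 1 (fun y => f (g y)) (l * m).
Proof. by move=> dg df; exact: (is_derive1_comp df dg). Qed.

(** The segment between [x] and [y] in either order, so that mean value bounds and primitives apply
    on both sides of the base point. *)
Definition btw (x y s : R) := x <= s <= y \/ y <= s <= x.

Lemma btw_dist x y (s : R) : btw x y s -> `|s - x| <= `|y - x|.
Proof. by case=> /andP[? ?]; [rewrite !ger0_norm|rewrite !ler0_norm]; lra. Qed.

Lemma btw_box a r x y (s : R) : `|x - a| < r -> `|y - a| < r -> btw x y s -> `|s - a| < r.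
Proof. by rewrite !ltr_norml => /andP[? ?] /andP[? ?] [] /andP[? ?]; apply/andP; split; lra. Qed.

Lemma btw_ball a r x y (s : R) : `|x - a| <= r -> `|y - a| <= r -> btw x y s -> `|s - a| <= r.
Proof. by rewrite !ler_norml => /andP[? ?] /andP[? ?] [] /andP[? ?]; apply/andP; split; lra. Qed.

Lemma mean_value f (df : R -> R) x y : (forall s, btw x y s -> is_derive s 1 f (df s)) ->
  exists2 s, btw x y s & f y - f x = df s * (y - x).
Proof.
have main (u v : R) : u <= v -> (forall s : R, u <= s <= v -> is_derive s 1 f (df s)) ->
    exists2 s, u <= s <= v & f v - f u = df s * (v - u).
  move=> uv H; have [s|s|s sI e] := @MVT_segment R f df u v uv.
  - by rewrite in_itv/= => /andP[/ltW us /ltW sv]; apply: H; rewrite us.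
  - apply: continuous_in_subspaceT s => s.
    by rewrite inE/= in_itv/= => /H/is_derive_cont.
  - by exists s => //; move: sI; rewrite in_itv.
move=> H; have [xy|/ltW yx] := leP x y.
  by have [s sI e] := main _ _ xy (fun s sI => H s (or_introl sI)); exists s => //; left.
have [s sI e] := main _ _ yx (fun s sI => H s (or_intror sI)); exists s; first by right.
by rewrite -[LHS]opprB e -mulrN opprB.
Qed.

Lemma mean_value_le f (df : R -> R) (M : R) x y : (forall s, btw x y s -> is_derive s 1 f (df s)) ->
  (forall s, btw x y s -> `|df s| <= M) -> `|f y - f x| <= M * `|y - x|.
Proof.
by move=> H HM; have [s sI ->] := mean_value H; rewrite normrM ler_wpM2r// HM.
Qed.

Lemma derive0_eq f x y : (forall s, btw x y s -> is_derive s 1 f 0) -> f y = f x.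
Proof.
by move=> /(@mean_value f (cst 0))[s _]; rewrite mul0r => /eqP; rewrite subr_eq0 => /eqP.
Qed.

(** The oriented integral from [a] to [x]: for [x] different from [a] one of the two intervals is
    empty. *)
Definition prim a f x : R :=
  \int[@lebesgue_measure R]_(t in `[a, x]) f t
  - \int[@lebesgue_measure R]_(t in `[x, a]) f t.

Lemma primxx a f : prim a f a = 0. Proof. exact: subrr. Qed.

Lemma eq_prim a f g x : (forall s, btw a x s -> f s = g s) -> prim a f x = prim a g x.
Proof.
move=> fg; congr (_ - _); apply: eq_Rintegral => s; rewrite inE/= in_itv/= => sI; apply: fg.
  by left.
by right.
Qed.

Let mu := @lebesgue_measure R.

Lemma cont_integrable f u v : (forall s, u <= s <= v -> {for s, continuous f}) ->
  mu.-integrable `[u, v] (EFin \o f).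
Proof.
move=> H; apply: continuous_compact_integrable; first exact: segment_compact.
by apply: continuous_in_subspaceT => s; rewrite inE/= in_itv/= => /H.
Qed.

Lemma primE u a f x r : u <= a -> u <= x -> a < r -> x < r ->
  (forall s, u <= s < r -> {for s, continuous f}) ->
  prim a f x = \int[mu]_(t in `[u, x]) f t - \int[mu]_(t in `[u, a]) f t.
Proof.
move=> ua ux ar xr H; rewrite /prim -/mu.
have itg v w : u <= v -> w < r -> mu.-integrable `[v, w] (EFin \o f).
  move=> uv wr; apply: cont_integrable => s /andP[vs sw]; apply: H; lra.
have split v w : u <= v -> v <= w -> w < r ->
    \int[mu]_(t in `[v, w]) f t = \int[mu]_(t in `[u, w]) f t - \int[mu]_(t in `[u, v]) f t.
  move=> uv vw wr; rewrite Rintegral_itvB ?bnd_simp//; last exact: itg.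
  rewrite Rintegral_itv_obnd_cbnd//.
  by apply: integrableS (itg _ _ uv wr) => //; exact: subset_itv_oc_cc.
have [xa|ax|->] := ltgtP x a.
- rewrite [X in X - _](_ : _ = 0); last by rewrite set_itv_ge ?Rintegral_set0// bnd_simp -ltNge.
  by rewrite sub0r split ?(ltW xa)// opprB.
- rewrite [X in _ - X](_ : _ = 0); last by rewrite set_itv_ge ?Rintegral_set0// bnd_simp -ltNge.
  by rewrite subr0 split ?(ltW ax).
- by rewrite !subrr.
Qed.

Lemma is_derive_prim f a r x : (forall s, `|s - a| < r -> {for s, continuous f}) ->
  `|x - a| < r -> is_derive x 1 (prim a f) (f x).
Proof.
move=> H xr.
have r0 : 0 < r by exact: le_lt_trans xr.
have [xl xu] : a - r < x /\ x < a + r by move: xr; rewrite ltr_norml => /andP[? ?]; lra.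
(* The fundamental theorem is applied from a base point [u] to the left of both [a] and [x], still
   inside the interval where [f] is continuous. *)
pose u := (a - r + Num.min a x) / 2.
have mnl : a - r < Num.min a x by rewrite lt_min; apply/andP; split; lra.
have mna : Num.min a x <= a by rewrite ge_min lexx.
have mnx : Num.min a x <= x by rewrite ge_min lexx orbT.
have ua : u < a by rewrite /u; lra.
have ux : u < x by rewrite /u; lra.
have ul : a - r < u by rewrite /u; lra.
have Hc s : u <= s < a + r -> {for s, continuous f}.
  by move=> /andP[us sr]; apply: H; rewrite ltr_norml; apply/andP; split; lra.
have [D E] : derivable (fun x => \int[mu]_(t in `[u, x]) f t) x 1 /\
    derive1 (fun x => \int[mu]_(t in `[u, x]) f t) x = f x.
  apply: (@continuous_FTC1_closed R f u x ((x + (a + r)) / 2)); rewrite ?ux//; first lra.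
  - by apply: cont_integrable => s /andP[us sr]; apply: Hc; lra.
  - by apply: Hc; lra.
have dI : is_derive x 1 (fun x => \int[mu]_(t in `[u, x]) f t) (f x).
  by apply: DeriveDef; [exact: D|rewrite -derive1E; exact: E].
pose d := Num.min (x - u) (a + r - x).
have d0 : 0 < d by rewrite /d lt_min; apply/andP; split; lra.
have dl : d <= x - u by rewrite /d ge_min lexx.
have dr : d <= a + r - x by rewrite /d ge_min lexx orbT.
apply: (@is_derive_locally (fun y => \int[mu]_(t in `[u, y]) f t
    - \int[mu]_(t in `[u, a]) f t) _ _ _ d) => //.
  move=> y; rewrite ltr_norml => /andP[h1 h2].
  by rewrite (@primE u a f y (a + r))//; clear -ua ul xl xu dl dr h1 h2 r0; lra.
by rewrite -[f x]subr0; apply: is_deriveB.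
Qed.

Lemma prim_le f (M : R) a r x : (forall s, `|s - a| < r -> {for s, continuous f}) ->
  `|x - a| < r -> (forall s, btw a x s -> `|f s| <= M) ->
  `|prim a f x| <= M * `|x - a|.
Proof.
move=> cf xr fM; rewrite -[prim _ _ _]subr0 -(primxx a f).
apply: mean_value_le fM => s /btw_dist sI.
by apply: (is_derive_prim cf); exact: le_lt_trans xr.
Qed.

Lemma prim_uniq F f a r x : (forall s, `|s - a| < r -> {for s, continuous f}) ->
  (forall s, `|s - a| < r -> is_derive s 1 F (f s)) ->
  `|x - a| < r -> prim a f x = F x - F a.
Proof.
move=> cf dF xr.
have : (prim a f - F) x = (prim a f - F) a.
  apply: derive0_eq => s /btw_dist sI; have sr : `|s - a| < r by exact: le_lt_trans xr.
  rewrite -(subrr (f s)); apply: is_deriveB; first exact: (is_derive_prim cf).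
  exact: dF.
by rewrite /= !fctE /= primxx => /eqP; rewrite sub0r subr_eq addrC => /eqP.
Qed.

Lemma primB f g a r x : (forall s, `|s - a| < r -> {for s, continuous f}) ->
  (forall s, `|s - a| < r -> {for s, continuous g}) -> `|x - a| < r ->
  prim a (fun s => f s - g s) x = prim a f x - prim a g x.
Proof.
move=> cf cg xr; have := @prim_uniq (prim a f - prim a g) (fun s => f s - g s) a r x.
rewrite !fctE /= !primxx subrr subr0; apply => // s sr.
  by apply: continuousB; [exact: cf|exact: cg].
by apply: is_deriveB; [exact: (is_derive_prim cf)|exact: (is_derive_prim cg)].
Qed.

Lemma primD f g a r x : (forall s, `|s - a| < r -> {for s, continuous f}) ->
  (forall s, `|s - a| < r -> {for s, continuous g}) -> `|x - a| < r ->
  prim a (fun s => f s + g s) x = prim a f x + prim a g x.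
Proof.
move=> cf cg xr; have := @prim_uniq (prim a f + prim a g) (fun s => f s + g s) a r x.
rewrite !fctE /= !primxx addr0 subr0; apply => // s sr.
  by apply: continuousD; [exact: cf|exact: cg].
by apply: is_deriveD; [exact: (is_derive_prim cf)|exact: (is_derive_prim cg)].
Qed.

Lemma is_deriveMc f x (l c : R) : is_derive x 1 f l -> is_derive x 1 (fun y => f y * c) (l * c).
Proof.
move=> D; rewrite (_ : (fun y => f y * c) = c \*: f); last by apply/funext => y; rewrite /= mulrC.
by rewrite mulrC; exact: is_deriveZ.
Qed.

Lemma is_derive_lin (c : R) x : is_derive x 1 (fun y => c * y) c.
Proof. by rewrite -[X in is_derive _ _ _ X]mulr1; exact: is_deriveZ. Qed.

Lemma is_derive_mul f g x (l m : R) : is_derive x 1 f l -> is_derive x 1 g m ->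
  is_derive x 1 (fun y => f y * g y) (l * g x + f x * m).
Proof.
move=> df dg; have D : is_derive x (1 : R) (f * g) _ := is_deriveM df dg.
apply: (is_derive_val D).
by rewrite addrC /GRing.scale /= [g x * l]mulrC.
Qed.

Lemma primMc f (c : R) a r x : (forall s, `|s - a| < r -> {for s, continuous f}) ->
  `|x - a| < r -> prim a (fun s => f s * c) x = prim a f x * c.
Proof.
move=> cf xr; have := @prim_uniq (fun s => prim a f s * c) (fun s => f s * c) a r x.
rewrite /= primxx mul0r subr0; apply => // s sr.
  by apply: continuousM; [exact: cf|exact: cvg_cst].
by apply: is_deriveMc; exact: (is_derive_prim cf).
Qed.

End Calculus1.

(** * Functions of two variables on squares *)

Section Box.
Context {R : realType}.
Implicit Types (f g h : R -> R -> R) (a b x y r s t e d : R).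

Definition box a b r x y := `|x - a| < r /\ `|y - b| < r.

Definition cont2 f x y := {for (x, y), continuous (fun p : R * R => f p.1 p.2)}.

End Box.

Notation cont_on a b r f := (forall x y, box a b r x y -> cont2 f x y) (only parsing).

Section Calculus2.
Context {R : realType}.
Implicit Types (f g h : R -> R -> R) (a b x y r s t e d : R).

Lemma cont2P f x y : cont2 f x y <-> forall e, 0 < e -> exists2 d, 0 < d &
  forall x' y', `|x' - x| < d -> `|y' - y| < d -> `|f x' y' - f x y| < e.
Proof.
split=> [fx e e0|fx].
  have /cvgrPdist_lt/(_ _ e0) := fx; rewrite /prop_near1 /= => /nbhs_ballP[d /= d0 H].
  exists d => // x' y' xx' yy'; rewrite distrC; apply: (H (x', y')).
  by split; rewrite /ball/= distrC.
apply/cvgrPdist_lt => e /fx[d d0 H].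
exists (ball x d, ball y d); first by split; exact: nbhsx_ballx.
move=> [x' y'] []; rewrite /ball/= distrC => ?; rewrite distrC => ?.
by rewrite distrC; exact: H.
Qed.

Lemma cont2_comp h f g x y : cont2 h (f x y) (g x y) -> cont2 f x y -> cont2 g x y ->
  cont2 (fun x y => h (f x y) (g x y)) x y.
Proof.
move=> ch cf cg; apply/cont2P => e e0.
have [d d0 Hh] := (cont2P _ _ _).1 ch _ e0.
have [d1 d10 Hf] := (cont2P _ _ _).1 cf _ d0.
have [d2 d20 Hg] := (cont2P _ _ _).1 cg _ d0.
exists (Num.min d1 d2); first by rewrite lt_min d10.
by move=> x' y'; rewrite !lt_min => /andP[? ?] /andP[? ?]; apply: Hh; [exact: Hf|exact: Hg].
Qed.

Lemma cont2_fun1 (k : R -> R) f x y : {for f x y, continuous k} -> cont2 f x y ->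
  cont2 (fun x y => k (f x y)) x y.
Proof. by move=> ck cf; exact: (continuous_comp cf). Qed.

Lemma cont1_comp2 h (u v : R -> R) t : cont2 h (u t) (v t) ->
  {for t, continuous u} -> {for t, continuous v} -> {for t, continuous (fun t => h (u t) (v t))}.
Proof.
move=> ch cf cg; apply/cont1P => e e0.
have [d d0 Hh] := (cont2P _ _ _).1 ch _ e0.
have [d1 d10 Hf] := (cont1P _ _).1 cf _ d0.
have [d2 d20 Hg] := (cont1P _ _).1 cg _ d0.
exists (Num.min d1 d2); first by rewrite lt_min d10.
by move=> t'; rewrite !lt_min => /andP[? ?]; apply: Hh; [exact: Hf|exact: Hg].
Qed.

Lemma cont2_fst x y : cont2 (fun x _ => x) x y. Proof. exact: cvg_fst. Qed.
Lemma cont2_snd x y : cont2 (fun _ y => y) x y. Proof. exact: cvg_snd. Qed.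
Lemma cont2_cst (c : R) x y : cont2 (fun _ _ => c) x y. Proof. exact: cvg_cst. Qed.

Lemma cont2_left f x y : cont2 f x y -> {for x, continuous (f^~ y)}.
Proof. by move=> cf; apply: (cont1_comp2 cf) => //; exact: cvg_cst. Qed.

Lemma cont2_right f x y : cont2 f x y -> {for y, continuous (f x)}.
Proof. by move=> cf; apply: (cont1_comp2 cf) => //; exact: cvg_cst. Qed.

Lemma cont2D f g x y : cont2 f x y -> cont2 g x y -> cont2 (fun x y => f x y + g x y) x y.
Proof. by move=> cf cg; exact: continuousD cf cg. Qed.

Lemma cont2B f g x y : cont2 f x y -> cont2 g x y -> cont2 (fun x y => f x y - g x y) x y.
Proof. by move=> cf cg; exact: continuousB cf cg. Qed.

Lemma cont2N f x y : cont2 f x y -> cont2 (fun x y => - f x y) x y.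
Proof. by move=> cf; exact: continuousN cf. Qed.

Lemma cont2M f g x y : cont2 f x y -> cont2 g x y -> cont2 (fun x y => f x y * g x y) x y.
Proof. by move=> cf cg; exact: continuousM cf cg. Qed.

Lemma cont2V f x y : f x y != 0 -> cont2 f x y -> cont2 (fun x y => (f x y)^-1) x y.
Proof. by move=> f0 cf; exact: (@continuousV _ _ _ (x, y)) f0 cf. Qed.

Lemma cont2_swap f x y : cont2 f x y -> cont2 (fun y x => f x y) y x.
Proof. by move=> cf; apply: (@cont2_comp f) => //; [exact: cont2_snd|exact: cont2_fst]. Qed.

Lemma cont2_locally f g x y r : 0 < r ->
  (forall x' y', box x y r x' y' -> f x' y' = g x' y') -> cont2 f x y -> cont2 g x y.
Proof.
move=> r0 fg /cont2P cf; apply/cont2P => e /cf[d d0 H].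
exists (Num.min d r); first by rewrite lt_min d0.
move=> x' y'; rewrite !lt_min => /andP[? ?] /andP[? ?].
by rewrite -!fg//; [exact: H|split; rewrite subrr normr0].
Qed.

Lemma box_open a b r x y : box a b r x y -> exists2 d, 0 < d &
  forall x' y', box x y d x' y' -> box a b r x' y'.
Proof.
move=> [ax yb]; exists (Num.min (r - `|x - a|) (r - `|y - b|)).
  by rewrite lt_min !subr_gt0 ax.
move=> x' y'; rewrite /box !lt_min => -[/andP[h1 _] /andP[_ h2]].
split; [have := ler_distD x x' a|have := ler_distD y y' b]; lra.
Qed.

Lemma box_center a b r : 0 < r -> box a b r a b.
Proof. by move=> r0; split; rewrite subrr normr0. Qed.

Lemma box_le a b r r' x y : r <= r' -> box a b r x y -> box a b r' x y.
Proof. by move=> rr' [? ?]; split; exact: lt_le_trans rr'. Qed.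

Lemma box_btw a b r x y x' y' s t : box a b r x y -> box a b r x' y' ->
  btw x x' s -> btw y y' t -> box a b r s t.
Proof. by move=> [xa yb] [xa' yb'] sI tI; split; [exact: btw_box xa xa' sI|exact: btw_box yb yb' tI]. Qed.

(** Compactness of the segment of the [s] makes the modulus of continuity in [y'] uniform in [s]. *)
Lemma tube f a y (p : R) : (forall s, `|s - a| <= p -> cont2 f s y) -> forall e, 0 < e ->
  exists2 d, 0 < d & forall y', `|y' - y| < d -> forall s, `|s - a| <= p ->
    `|f s y' - f s y| < e.
Proof.
move=> cf e e0.
have inI s : `[a - p, a + p]%classic s <-> `|s - a| <= p.
  by rewrite /= in_itv/= ler_norml; split=> /andP[? ?]; apply/andP; split; lra.
have cov s : `[a - p, a + p]%classic s ->
    \forall s' \near s & y' \near y, `|f s' y' - f s' y| < e.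
  move=> /inI /cf/cont2P; have e2 : 0 < e / 2 by rewrite divr_gt0.
  move=> /(_ _ e2)[d d0 H]; exists (ball s d, ball y d); first by split; exact: nbhsx_ballx.
  move=> -[s' y'] [/= ss' yy']; rewrite /ball/= distrC in ss'; rewrite /ball/= distrC in yy'.
  have := H s' y' ss' yy'; have := H s' y ss'; rewrite subrr normr0 => /(_ d0).
  by have := ler_distD (f s y) (f s' y') (f s' y); rewrite (distrC (f s y)); lra.
have := (compact_near_coveringP _).1 (@segment_compact R (a - p) (a + p)) R
  (nbhs y) (fun y' s => `|f s y' - f s y| < e) _ cov.
move=> /(_ (nbhs_filter y)); rewrite /prop_near1 => /nbhs_ballP[d /= d0 H]; exists d => // y' yy' s /inI; apply: H.
by rewrite /ball/= distrC.
Qed.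

Lemma cont2_prim f a b r x y : cont_on a b r f ->
  box a b r x y -> cont2 (fun x y => prim a (f^~ y) x) x y.
Proof.
move=> cf bxy; have [xa yb] := bxy.
have r0 : 0 < r by exact: le_lt_trans xa.
have ba : `|a - a| < r by rewrite subrr normr0.
(* A radius strictly between |x - a| and [r], so that the segment given to [tube] contains every
   nearby [x']. *)
pose p := (`|x - a| + r) / 2.
have [xp pr] : `|x - a| < p /\ p < r by rewrite /p; lra.
have cf1 y' : `|y' - b| < r -> forall s, `|s - a| < r -> {for s, continuous (f^~ y')}.
  by move=> y'b s sa; exact/cont2_left/cf.
apply/cont2P => e e0.
have e2 : 0 < e / 2 / (r + 1) by rewrite !divr_gt0// addr_gt0.
have [d1 d10 H1] := @tube f a y p (fun s sp => cf _ _ (conj (le_lt_trans sp pr) yb)) _ e2.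
have /is_derive_cont/cont1P/(_ (e / 2)) : is_derive x 1 (prim a (f^~ y)) (f x y).
  by apply: is_derive_prim (cf1 _ yb) _.
case=> [|d2 d20 H2]; first by rewrite divr_gt0.
have [d3 d30 H3] := box_open bxy.
exists (Num.min (Num.min d1 d2) (Num.min d3 (p - `|x - a|))).
  by rewrite !lt_min d10 d20 d30 subr_gt0.
move=> x' y'; rewrite !lt_min => /andP[/andP[x1 x2] /andP[x3 x4]] /andP[/andP[y1 y2] /andP[y3 y4]].
have [xa' yb'] := H3 _ _ (conj x3 y3).
have x'p : `|x' - a| <= p by have := ler_distD x x' a; lra.
have -> : prim a (f^~ y') x' - prim a (f^~ y) x =
  prim a (fun s => f s y' - f s y) x' + (prim a (f^~ y) x' - prim a (f^~ y) x).
  rewrite (primB (cf1 _ yb') (cf1 _ yb) xa'); ring.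
have h1 : `|prim a (fun s => f s y' - f s y) x'| <= e / 2 / (r + 1) * `|x' - a|.
  apply: (@prim_le _ _ _ _ r) => //.
    by move=> s sr; apply: continuousB; exact: cf1.
  by move=> s /btw_dist sI; apply/ltW/H1 => //; lra.
have h2 : e / 2 / (r + 1) * `|x' - a| < e / 2.
  by rewrite -mulrA -[X in _ < X]mulr1 ltr_pM2l ?divr_gt0// mulrC ltr_pdivrMr; lra.
have h3 := H2 x' x2.
by rewrite (le_lt_trans (ler_normD _ _))//; lra.
Qed.

(** The first-order remainder is the primitive of the remainders of the [f s], which the mean value
    theorem and [tube] bound uniformly in [s]. *)
Lemma is_derive_prim_param f (fy : R -> R -> R) a b r x y :
  cont_on a b r f ->
  (forall x y, box a b r x y -> is_derive y 1 (f x) (fy x y)) ->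
  cont_on a b r fy ->
  box a b r x y -> is_derive y 1 (fun y => prim a (f^~ y) x) (prim a (fy^~ y) x).
Proof.
move=> cf dfy cfy bxy; have [xa yb] := bxy.
have r0 : 0 < r by exact: le_lt_trans xa.
have cf1 y' : `|y' - b| < r -> forall s, `|s - a| < r -> {for s, continuous (f^~ y')}.
  by move=> y'b s sa; exact/cont2_left/cf.
have cfy1 s : `|s - a| < r -> {for s, continuous (fy^~ y)}.
  by move=> sa; exact/cont2_left/cfy.
apply/is_deriveP => e e0.
have e2 : 0 < e / (r + 1) by rewrite !divr_gt0// addr_gt0.
have [d1 d10 H1] := @tube fy a y `|x - a| (fun s sp => cfy _ _ (conj (le_lt_trans sp xa) yb)) _ e2.
exists (Num.min d1 (r - `|y - b|)); first by rewrite lt_min d10 subr_gt0.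
move=> y'; rewrite lt_min => /andP[y1 y2].
have yb' : `|y' - b| < r by have := ler_distD y y' b; lra.
have -> : prim a (f^~ y') x - prim a (f^~ y) x - prim a (fy^~ y) x * (y' - y) =
  prim a (fun s => f s y' - f s y - fy s y * (y' - y)) x.
  rewrite (primB _ _ xa) ?(primB (cf1 _ yb') (cf1 _ yb) xa) ?(primMc _ cfy1 xa)//.
  - by move=> s sa; apply: continuousB; exact: cf1.
  - by move=> s sa; apply: continuousM; [exact: cfy1|exact: cvg_cst].
apply: (le_trans (@prim_le _ _ (e / (r + 1) * `|y' - y|) _ r _ _ xa _)).
- move=> s sr; apply: continuousB; first by apply: continuousB; exact: cf1.
  by apply: continuousM; [exact: cfy1|exact: cvg_cst].
- move=> s /btw_dist sI.
  have sa : `|s - a| < r by exact: le_lt_trans xa.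
  have := @mean_value_le _ (fun t => f s t - fy s y * t) (fun t => fy s t - fy s y) (e / (r + 1)) y y'.
  rewrite [X in `|X|](_ : _ = f s y' - f s y - fy s y * (y' - y)); last by rewrite mulrBr; ring.
  apply=> t tI; have tb := btw_box yb yb' tI.
    apply: is_deriveB; first by apply: dfy.
    by exact: is_derive_lin.
  by apply/ltW/H1 => //; have := btw_dist tI; lra.
- have -> : e * `|y' - y| = e / (r + 1) * `|y' - y| * (r + 1) by field; lra.
  by rewrite ler_wpM2l ?(mulr_ge0 (ltW e2))//; lra.
Qed.

(** Total differentiability at a point, measured in the l1 norm. *)
Definition tdiff f x y (l m : R) := forall e, 0 < e -> exists2 d, 0 < d &
  forall x' y', `|x' - x| < d -> `|y' - y| < d ->
    `|f x' y' - f x y - l * (x' - x) - m * (y' - y)| <= e * (`|x' - x| + `|y' - y|).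

Definition C1box a b r f fx fy := forall x y, box a b r x y ->
  [/\ is_derive x 1 (f^~ y) (fx x y), is_derive y 1 (f x) (fy x y), cont2 fx x y & cont2 fy x y].

(** Strict differentiability: both points may move. One coordinate is changed at a time, and the
    mean value theorem is applied after subtracting the linear part at the center. *)
Lemma C1box_strict a b r f fx fy e : 0 < r -> C1box a b r f fx fy -> 0 < e ->
  exists2 d, 0 < d & forall x y x' y', box a b d x y -> box a b d x' y' ->
    `|f x' y' - f x y - fx a b * (x' - x) - fy a b * (y' - y)| <= e * (`|x' - x| + `|y' - y|).
Proof.
move=> r0 Hf e0; have [_ _ /cont2P/(_ _ e0)[d1 d10 H1] /cont2P/(_ _ e0)[d2 d20 H2]] := Hf _ _ (box_center a b r0).
pose d := Num.min d1 (Num.min d2 r).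
have d0 : 0 < d by rewrite !lt_min d10 d20.
have [dd1 [dd2 dr]] : d <= d1 /\ d <= d2 /\ d <= r by rewrite /d !ge_min !lexx !orbT.
exists d => // x y x' y' b1 b2.
have B s t : btw x x' s -> btw y y' t -> box a b d s t by exact: box_btw b1 b2.
have xx : btw x x' x' by case: (leP x x') => h; [left|right]; rewrite lexx ?h ?ltW.
have yy : btw y y' y by case: (leP y y') => h; [left|right]; rewrite lexx ?h ?ltW.
have Ey : `|f x' y' - f x' y - fy a b * (y' - y)| <= e * `|y' - y|.
  have -> : f x' y' - f x' y - fy a b * (y' - y) = (f x' y' - fy a b * y') - (f x' y - fy a b * y) by ring.
  apply: (@mean_value_le _ (fun s => f x' s - fy a b * s) (fun s => fy x' s - fy a b)) => s sI.
    have [_ D _ _] := Hf _ _ (box_le dr (B _ _ xx sI)).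
    have D2 : is_derive s 1 (fun s => fy a b * s) (fy a b).
      by exact: is_derive_lin.
    exact: is_deriveB.
  by have [h1 h2] := B _ _ xx sI; apply: ltW; apply: H2; exact: lt_le_trans dd2.
have Ex : `|f x' y - f x y - fx a b * (x' - x)| <= e * `|x' - x|.
  have -> : f x' y - f x y - fx a b * (x' - x) = (f x' y - fx a b * x') - (f x y - fx a b * x) by ring.
  apply: (@mean_value_le _ (fun s => f s y - fx a b * s) (fun s => fx s y - fx a b)) => s sI.
    have [D _ _ _] := Hf _ _ (box_le dr (B _ _ sI yy)).
    have D2 : is_derive s 1 (fun s => fx a b * s) (fx a b).
      by exact: is_derive_lin.
    exact: is_deriveB.
  by have [h1 h2] := B _ _ sI yy; apply: ltW; apply: H1; exact: lt_le_trans dd1.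
have -> : f x' y' - f x y - fx a b * (x' - x) - fy a b * (y' - y) =
  (f x' y - f x y - fx a b * (x' - x)) + (f x' y' - f x' y - fy a b * (y' - y)) by ring.
by rewrite [leRHS]mulrDr; apply: (le_trans (ler_normD _ _)); exact: lerD.
Qed.

Lemma C1box_tdiff a b r f fx fy x y : C1box a b r f fx fy -> box a b r x y ->
  tdiff f x y (fx x y) (fy x y).
Proof.
move=> Hf bxy e e0; have [d d0 B] := box_open bxy.
have Hf' : C1box x y d f fx fy by move=> x' y' /B/Hf.
have [d' d'0 H] := C1box_strict d0 Hf' e0.
by exists d' => // x' y' h1 h2; apply: H; [exact: box_center|split].
Qed.

Lemma tdiff_cont2 f x y l m : tdiff f x y l m -> cont2 f x y.
Proof.
move=> D; apply/cont2P => e e0.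
have [d d0 H] := D _ ltr01.
pose K := `|l| + `|m| + 2.
have K0 : 0 < K by rewrite /K -addrA ltr_wpDl// ltr_wpDl.
exists (Num.min d (e / (2 * K))); first by rewrite lt_min d0 divr_gt0// mulr_gt0.
move=> x' y'; rewrite !lt_min => /andP[x1 x2] /andP[y1 y2].
have {}H := H _ _ x1 y1.
have -> : f x' y' - f x y = (f x' y' - f x y - l * (x' - x) - m * (y' - y)) + (l * (x' - x) + m * (y' - y)) by ring.
rewrite (le_lt_trans (ler_normD _ _))//.
have h3 : `|l * (x' - x) + m * (y' - y)| <= `|l| * `|x' - x| + `|m| * `|y' - y|.
  by rewrite (le_trans (ler_normD _ _))// !normrM.
have x3 : `|x' - x| * (2 * K) < e by rewrite -ltr_pdivlMr ?mulr_gt0.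
have y3 : `|y' - y| * (2 * K) < e by rewrite -ltr_pdivlMr ?mulr_gt0.
have := normr_ge0 l; have := normr_ge0 m; have := normr_ge0 (x' - x); have := normr_ge0 (y' - y).
rewrite /K in x3 y3; nra.
Qed.

Lemma tdiff_curve f (u v : R -> R) t (l m u' v' : R) : tdiff f (u t) (v t) l m ->
  is_derive t 1 u u' -> is_derive t 1 v v' ->
  is_derive t 1 (fun t => f (u t) (v t)) (l * u' + m * v').
Proof.
move=> D du dv; apply/is_deriveP => e e0.
(* [K] bounds the increments of [u] and [v] together, relative to |s - t|, because the cap 1 in [e1]
   adds at most 1 to |u'| and to |v'|; [L] absorbs the factors [l] and [m]. *)
pose K := `|u'| + `|v'| + 2; pose L := `|l| + `|m| + 1.
have K0 : 0 < K by rewrite /K -addrA ltr_wpDl// ltr_wpDl.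
have L0 : 0 < L by rewrite /L -addrA ltr_wpDl// ltr_wpDl.
have [d d0 H] := D (e / (2 * K)) ltac:(by rewrite divr_gt0// mulr_gt0).
pose e1 := Num.min 1 (e / (2 * L)).
have e10 : 0 < e1 by rewrite lt_min ltr01 divr_gt0// mulr_gt0.
have [d1 d10 H1] := (is_deriveP _ _ _).1 du _ e10.
have [d2 d20 H2] := (is_deriveP _ _ _).1 dv _ e10.
have [d3 d30 H3] := (cont1P _ _).1 (is_derive_cont du) _ d0.
have [d4 d40 H4] := (cont1P _ _).1 (is_derive_cont dv) _ d0.
exists (Num.min (Num.min d1 d2) (Num.min d3 d4)); first by rewrite !lt_min d10 d20 d30.
move=> s; rewrite !lt_min => /andP[/andP[s1 s2] /andP[s3 s4]].
have {}H := H _ _ (H3 _ s3) (H4 _ s4).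
have {}H1 := H1 _ s1; have {}H2 := H2 _ s2.
have e11 : e1 <= 1 by rewrite /e1 ge_min lexx.
have e1L : e1 * (2 * L) <= e by rewrite -ler_pdivlMr ?mulr_gt0// /e1 ge_min lexx orbT.
set dt := `|s - t| in H1 H2 *; have dt0 : 0 <= dt by exact: normr_ge0.
have hu : `|u s - u t| <= (`|u'| + 1) * dt.
  have -> : u s - u t = (u s - u t - u' * (s - t)) + u' * (s - t) by ring.
  by rewrite (le_trans (ler_normD _ _))// normrM -/dt; nra.
have hv : `|v s - v t| <= (`|v'| + 1) * dt.
  have -> : v s - v t = (v s - v t - v' * (s - t)) + v' * (s - t) by ring.
  by rewrite (le_trans (ler_normD _ _))// normrM -/dt; nra.
have -> : f (u s) (v s) - f (u t) (v t) - (l * u' + m * v') * (s - t) =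
  (f (u s) (v s) - f (u t) (v t) - l * (u s - u t) - m * (v s - v t))
  + l * (u s - u t - u' * (s - t)) + m * (v s - v t - v' * (s - t)) by ring.
have A : e / (2 * K) * (`|u s - u t| + `|v s - v t|) <= e / 2 * dt.
  have -> : e / 2 * dt = e / (2 * K) * (K * dt) by field; rewrite gt_eqF.
  rewrite ler_wpM2l ?divr_ge0 ?mulr_ge0 ?(ltW e0) ?(ltW K0)//.
  by rewrite /K; nra.
have B : `|l| * (e1 * dt) + `|m| * (e1 * dt) <= e / 2 * dt.
  have : e1 * L <= e / 2 by lra.
  rewrite /L => H5; have := normr_ge0 l; have := normr_ge0 m => ? ?.
  have : e1 * (`|l| + `|m| + 1) * dt <= e / 2 * dt by exact: ler_wpM2r.
  have : 0 <= e1 * dt by rewrite mulr_ge0// ltW.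
  by nra.
rewrite (le_trans (ler_normD _ _))//; apply: (@le_trans _ _ (e / 2 * dt + e / 2 * dt)); last by lra.
have C : `|m * (v s - v t - v' * (s - t))| <= `|m| * (e1 * dt) by rewrite normrM ler_wpM2l.
have E : `|l * (u s - u t - u' * (s - t))| <= `|l| * (e1 * dt) by rewrite normrM ler_wpM2l.
have := ler_normD (f (u s) (v s) - f (u t) (v t) - l * (u s - u t) - m * (v s - v t)) (l * (u s - u t - u' * (s - t))).
by lra.
Qed.

End Calculus2.

(** * An implicit function theorem *)

Section ImplicitFunction.
Context {R : realType}.
Implicit Types (f g h : R -> R -> R) (a b x y r s t e d : R).

Lemma C1box_le a b r r' f fx fy : r' <= r -> C1box a b r f fx fy -> C1box a b r' f fx fy.
Proof. by move=> rr H x y /(box_le rr)/H. Qed.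

Lemma C1box_cont2 a b r f fx fy x y : C1box a b r f fx fy -> box a b r x y -> cont2 f x y.
Proof. by move=> H bxy; exact: tdiff_cont2 (C1box_tdiff H bxy). Qed.

Lemma C1box_comp a b r a' b' r' f fx fy g gx gy h hx hy :
  C1box a b r f fx fy -> C1box a b r g gx gy ->
  (forall x y, box a b r x y -> box a' b' r' (f x y) (g x y)) ->
  C1box a' b' r' h hx hy ->
  C1box a b r (fun x y => h (f x y) (g x y))
    (fun x y => hx (f x y) (g x y) * fx x y + hy (f x y) (g x y) * gx x y)
    (fun x y => hx (f x y) (g x y) * fy x y + hy (f x y) (g x y) * gy x y).
Proof.
move=> Hf Hg B Hh x y bxy.
have [dfx dfy cfx cfy] := Hf _ _ bxy; have [dgx dgy cgx cgy] := Hg _ _ bxy.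
have [_ _ chx chy] := Hh _ _ (B _ _ bxy).
have cf := C1box_cont2 Hf bxy; have cg := C1box_cont2 Hg bxy.
have D := C1box_tdiff Hh (B _ _ bxy).
split.
- exact: (tdiff_curve D dfx dgx).
- exact: (tdiff_curve D dfy dgy).
- by apply: cont2D; apply: cont2M => //; exact: cont2_comp.
- by apply: cont2D; apply: cont2M => //; exact: cont2_comp.
Qed.

Lemma C1box_comp1 a b r f fx fy (k k' : R -> R) : C1box a b r f fx fy ->
  (forall x y, box a b r x y -> is_derive (f x y) 1 k (k' (f x y))) ->
  (forall x y, box a b r x y -> {for f x y, continuous k'}) ->
  C1box a b r (fun x y => k (f x y)) (fun x y => k' (f x y) * fx x y)
    (fun x y => k' (f x y) * fy x y).
Proof.
move=> Hf dk ck x y bxy; have [dfx dfy cfx cfy] := Hf _ _ bxy.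
have D := dk _ _ bxy; have C := ck _ _ bxy; have cf := C1box_cont2 Hf bxy.
split; [exact: (is_derive_compR dfx)|exact: (is_derive_compR dfy)|..].
- by apply: cont2M => //; exact: cont2_fun1.
- by apply: cont2M => //; exact: cont2_fun1.
Qed.

Lemma C1boxD a b r f fx fy g gx gy : C1box a b r f fx fy -> C1box a b r g gx gy ->
  C1box a b r (fun x y => f x y + g x y) (fun x y => fx x y + gx x y) (fun x y => fy x y + gy x y).
Proof.
move=> Hf Hg x y bxy; have [? ? ? ?] := Hf _ _ bxy; have [? ? ? ?] := Hg _ _ bxy.
by split; [exact: is_deriveD|exact: is_deriveD|exact: cont2D|exact: cont2D].
Qed.

Lemma C1boxB a b r f fx fy g gx gy : C1box a b r f fx fy -> C1box a b r g gx gy ->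
  C1box a b r (fun x y => f x y - g x y) (fun x y => fx x y - gx x y) (fun x y => fy x y - gy x y).
Proof.
move=> Hf Hg x y bxy; have [? ? ? ?] := Hf _ _ bxy; have [? ? ? ?] := Hg _ _ bxy.
by split; [exact: is_deriveB|exact: is_deriveB|exact: cont2B|exact: cont2B].
Qed.

Lemma C1boxN a b r f fx fy : C1box a b r f fx fy ->
  C1box a b r (fun x y => - f x y) (fun x y => - fx x y) (fun x y => - fy x y).
Proof.
move=> Hf x y bxy; have [? ? ? ?] := Hf _ _ bxy.
by split; [exact: is_deriveN|exact: is_deriveN|exact: cont2N|exact: cont2N].
Qed.

Lemma C1box_swap a b r f fx fy : C1box a b r f fx fy ->
  C1box b a r (fun y x => f x y) (fun y x => fy x y) (fun y x => fx x y).
Proof.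
by move=> Hf y x [? ?]; have [] := Hf x y; split => //; exact: cont2_swap.
Qed.

Lemma C1box_fst a b r : C1box a b r (fun x _ => x) (fun _ _ => 1) (fun _ _ => 0).
Proof. by move=> x y _; split; [exact: is_derive_id|exact: is_derive_cst|exact: cont2_cst|exact: cont2_cst]. Qed.

Lemma eq_C1box a b r f fx fy fx' fy' :
  (forall x y, box a b r x y -> fx x y = fx' x y /\ fy x y = fy' x y) ->
  C1box a b r f fx fy -> C1box a b r f fx' fy'.
Proof.
move=> E H x y bxy; have [? ? ? ?] := H _ _ bxy; have [<- <-] := E _ _ bxy.
have [d d0 B] := box_open bxy.
by split => //; [apply: (@cont2_locally _ fx)|apply: (@cont2_locally _ fy)]; eauto => u v /B/E[].
Qed.

Lemma C1box_eq a b r f g fx fy : (forall x y, box a b r x y -> f x y = g x y) ->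
  C1box a b r f fx fy -> C1box a b r g fx fy.
Proof.
move=> fg H x y bxy; have [d1 d2 c1 c2] := H _ _ bxy; have [d d0 B] := box_open bxy.
have [bx bY] : `|x - x| < d /\ `|y - y| < d by rewrite !subrr normr0.
split => //; [apply: (@is_derive_locally _ (f^~ y) _ _ _ d)|apply: (@is_derive_locally _ (f x) _ _ _ d)] => // s sd;
  by apply/fg/B.
Qed.

(** The error may contain the unknown increment of [k]: once [e] is below |m| / 2 that part is
    absorbed, so [k] is Lipschitz at [t] and the error is small relative to [s - t] alone. *)
Lemma is_derive_implicit (k : R -> R) t (m c : R) : m != 0 ->
  (forall e, 0 < e -> exists2 d, 0 < d & forall s, `|s - t| < d ->
     `|c * (s - t) - m * (k s - k t)| <= e * (`|k s - k t| + `|s - t|)) ->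
  is_derive t 1 k (c / m).
Proof.
move=> m0 H; apply/is_deriveP => e e0.
have M0 : 0 < `|m| by rewrite normr_gt0.
pose K := 2 * (`|c| + `|m|) / `|m| + 1.
have K0 : 0 < K by rewrite /K ltr_wpDl// divr_ge0 ?mulr_ge0 ?addr_ge0.
pose e1 := Num.min (`|m| / 2) (e * `|m| / K).
have e10 : 0 < e1 by rewrite lt_min !divr_gt0// mulr_gt0.
have em : e1 <= `|m| / 2 by rewrite ge_min lexx.
have eK : e1 * K <= e * `|m| by rewrite -ler_pdivlMr// ge_min lexx orbT.
have [d d0 {}H] := H _ e10; exists d => // s /H {}H.
set D := k s - k t in H *; set dt := s - t in H *.
have h1 : `|m| * `|D| <= `|c| * `|dt| + e1 * (`|D| + `|dt|).
  rewrite -!normrM; have -> : m * D = c * dt - (c * dt - m * D) by ring.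
  by rewrite (le_trans (ler_normB _ _))// lerD2l.
have D0 := normr_ge0 D; have dt0 := normr_ge0 dt.
have h2 : `|D| <= (K - 1) * `|dt|.
  rewrite /K addrK mulrAC ler_pdivlMr//.
  have : e1 * `|D| <= `|m| / 2 * `|D| by exact: ler_wpM2r.
  have : e1 * `|dt| <= `|m| / 2 * `|dt| by exact: ler_wpM2r.
  by have := mulr_ge0 (ltW M0) dt0; lra.
have -> : D - c / m * dt = - (c * dt - m * D) / m by field.
rewrite normrM normfV normrN ler_pdivrMr//.
apply: (le_trans H); apply: (@le_trans _ _ (e1 * (K * `|dt|))).
  by rewrite ler_wpM2l ?(ltW e10)//; lra.
by rewrite mulrA [leRHS]mulrAC ler_wpM2r.
Qed.

Lemma strict_mono_box a b r h hx hy x y y' : C1box a b r h hx hy ->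
  (forall x y, box a b r x y -> 0 < hy x y) ->
  box a b r x y -> box a b r x y' -> y < y' -> h x y < h x y'.
Proof.
move=> H hp bxy bxy' yy'; rewrite -subr_gt0.
have B s : btw y y' s -> box a b r x s.
  by move=> sI; apply: (box_btw bxy bxy' _ sI); left; rewrite lexx.
have [s sI|s /B/hp hs ->] := @mean_value _ (h x) (hy x) y y'.
  by have [] := H _ _ (B s sI).
by rewrite mulr_gt0// subr_gt0.
Qed.

(** Monotonicity in [y] and the intermediate value theorem give [k]. Its domain is again a square,
    about [(a, h a b)], so that the result can be composed with functions on boxes. *)
Lemma implicit_function a b r h hx hy : 0 < r -> C1box a b r h hx hy ->
  (forall x y, box a b r x y -> 0 < hy x y) ->
  exists r', exists k : R -> R -> R, [/\ 0 < r' <= r,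
    forall x z, box a (h a b) r' x z -> box a b r x (k x z) /\ h x (k x z) = z,
    forall x y, box a b r x y -> box a (h a b) r' x (h x y) -> k x (h x y) = y &
    C1box a (h a b) r' k (fun x z => - hx x (k x z) / hy x (k x z))
      (fun x z => (hy x (k x z))^-1)].
Proof.
move=> r0 H hp.
have inj x y y' : box a b r x y -> box a b r x y' -> h x y = h x y' -> y = y'.
  move=> B B' E; have [yy|yy|//] := ltgtP y y'.
    by have := strict_mono_box H hp B B' yy; rewrite E ltxx.
  by have := strict_mono_box H hp B' B yy; rewrite E ltxx.
pose p := r / 2.
have p0 : 0 < p by rewrite /p; lra.
have Bp x y : `|x - a| < r -> `|y - b| <= p -> box a b r x y.
  by move=> xa yb; split => //; rewrite /p in p0 yb *; lra.
have aa : `|a - a| < r by rewrite subrr normr0.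
have Bl : box a b r a (b - p) by apply: Bp => //; rewrite addrAC subrr sub0r normrN ger0_norm// ltW.
have Br : box a b r a (b + p) by apply: Bp => //; rewrite addrAC subrr add0r ger0_norm// ltW.
have Bc : box a b r a b by exact: box_center.
have ml := strict_mono_box H hp Bl Bc ltac:(lra).
have mr := strict_mono_box H hp Bc Br ltac:(lra).
(* Half the smaller gap: for [x] near [a] the values [h x (b - p)] and [h x (b + p)] move by less
   than [q], and so does [z], hence they still enclose [z]. *)
pose q := Num.min (h a b - h a (b - p)) (h a (b + p) - h a b) / 2.
have q0 : 0 < q by rewrite divr_gt0// lt_min !subr_gt0 ml.
have ql : 2 * q <= h a b - h a (b - p) by rewrite /q mulrC divfK// ge_min lexx.
have qr : 2 * q <= h a (b + p) - h a b by rewrite /q mulrC divfK// ge_min lexx orbT.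
have [d1 d10 H1] := (cont1P _ _).1 (cont2_left (C1box_cont2 H Bl)) _ q0.
have [d2 d20 H2] := (cont1P _ _).1 (cont2_left (C1box_cont2 H Br)) _ q0.
pose r' := Num.min (Num.min d1 d2) (Num.min q r).
have r'0 : 0 < r' by rewrite !lt_min d10 d20 q0.
have [k1 k2 k3 k4] : [/\ r' <= d1, r' <= d2, r' <= q & r' <= r].
  by split; rewrite !ge_min lexx ?orbT.
have ex x z : box a (h a b) r' x z -> exists y, box a b r x y /\ h x y = z.
  move=> [xa]; rewrite ltr_norml => /andP[zl zr].
  have xr := lt_le_trans xa k4.
  have := H1 x (lt_le_trans xa k1); have := H2 x (lt_le_trans xa k2).
  rewrite !ltr_norml => /andP[g1 _] /andP[_ g2].
  have hl : h x (b - p) <= z by clear -g2 zl ql k3; lra.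
  have hr : z <= h x (b + p) by clear -g1 zr qr k3; lra.
  have Bs y : b - p <= y <= b + p -> box a b r x y.
    by move=> /andP[u1 u2]; apply: Bp => //; rewrite ler_norml; clear -u1 u2; apply/andP; split; lra.
  have [|||y] := @IVT R (h x) (b - p) (b + p) z.
  - by clear -p0; lra.
  - apply: continuous_in_subspaceT => y; rewrite inE/= in_itv/= => /Bs B.
    exact: cont2_right (C1box_cont2 H B).
  - by rewrite ge_min hl/= le_max hr orbT.
  by rewrite in_itv/= => /Bs B E; exists y.
pose k x z := xget b [set y | box a b r x y /\ h x y = z].
have kP x z : box a (h a b) r' x z -> box a b r x (k x z) /\ h x (k x z) = z.
  by move=> /ex; exact: xgetPex.
have kK x y : box a b r x y -> box a (h a b) r' x (h x y) -> k x (h x y) = y.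
  by move=> B /kP[B' E]; exact: inj E.
(* Continuity comes before differentiability: the expansion of [h] at [(x, k x z)] can be used only
   at points [k x' z'] already known to be close. *)
have ck x z : box a (h a b) r' x z -> cont2 k x z.
  move=> B; have [B1 E] := kP _ _ B; apply/cont2P => e e0.
  set y := k x z in B1 E *.
  have [d d0 Hd] := box_open B1; have [d' d'0 Hd'] := box_open B.
  pose e' := Num.min (e / 2) (d / 2).
  have e'0 : 0 < e' by rewrite lt_min !divr_gt0.
  have e'e : e' <= e / 2 by rewrite /e' ge_min lexx.
  have e'd : e' <= d / 2 by rewrite /e' ge_min lexx orbT.
  have xx : `|x - x| < d by rewrite subrr normr0.
  have By : box a b r x y by [].
  have Byl : box a b r x (y - e').
    by apply: Hd; split => //; rewrite addrAC subrr sub0r normrN ger0_norm ?ltW//; clear -e'd d0; lra.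
  have Byr : box a b r x (y + e').
    by apply: Hd; split => //; rewrite addrAC subrr add0r ger0_norm ?ltW//; clear -e'd d0; lra.
  have m1 := strict_mono_box H hp Byl By ltac:(clear -e'0; lra).
  have m2 := strict_mono_box H hp By Byr ltac:(clear -e'0; lra).
  have [c1 c10 G1] := (cont1P _ _).1 (cont2_left (C1box_cont2 H Byl)) ((z - h x (y - e')) / 2) ltac:(clear -E m1; lra).
  have [c2 c20 G2] := (cont1P _ _).1 (cont2_left (C1box_cont2 H Byr)) ((h x (y + e') - z) / 2) ltac:(clear -E m2; lra).
  pose A := (z - h x (y - e')) / 2; pose B' := (h x (y + e') - z) / 2.
  have [A0 B'0] : 0 < A /\ 0 < B' by rewrite /A /B'; clear -E m1 m2; split; lra.
  exists (Num.min (Num.min c1 c2) (Num.min (Num.min A B') (Num.min d d'))).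
    by rewrite !lt_min c10 c20 A0 B'0 d0.
  move=> x' z'; rewrite !lt_min => /andP[/andP[x1 x2] /andP[_ /andP[x3 x3']]].
  move=> /andP[_ /andP[/andP[z1 z2] /andP[_ z3]]].
  rewrite /A in z1; rewrite /B' in z2.
  have [B2 E2] := kP _ _ (Hd' _ _ (conj x3' z3)).
  have Byl' : box a b r x' (y - e').
    by apply: Hd; split => //; rewrite addrAC subrr sub0r normrN ger0_norm ?ltW//; clear -e'd d0; lra.
  have Byr' : box a b r x' (y + e').
    by apply: Hd; split => //; rewrite addrAC subrr add0r ger0_norm ?ltW//; clear -e'd d0; lra.
  have := G1 _ x1; have := G2 _ x2; move: z1 z2; rewrite !ltr_norml => /andP[a1 a2] /andP[a3 a4] /andP[a5 a6] /andP[a7 a8].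
  suff /andP[b1 b2] : y - e' < k x' z' < y + e' by clear -b1 b2 e'e e'0; apply/andP; split; lra.
  rewrite !ltNge; apply/andP; split; apply/negP; rewrite le_eqVlt => /predU1P[E3|L3].
  - by move: E2; rewrite E3; clear -a1 a3 a8 a2 a4 a5 a6 a7 E; lra.
  - by have := strict_mono_box H hp B2 Byl' L3; clear -E2 a1 a2 a3 a4 a5 a6 a7 a8; lra.
  - by move: E2; rewrite -E3; clear -a1 a2 a3 a4 a5 a6 a7 a8; lra.
  - by have := strict_mono_box H hp Byr' B2 L3; clear -E2 a1 a2 a3 a4 a5 a6 a7 a8; lra.
exists r', k; split => //; first by rewrite r'0.
move=> x z B; have [B1 E] := kP _ _ B; have D := C1box_tdiff H B1.
have [_ _ chx chy] := H _ _ B1; have hy0 := hp _ _ B1; have C := ck _ _ B.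
have hyN : hy x (k x z) != 0 by rewrite gt_eqF.
have [d' d'0 Hd'] := box_open B.
split.
- apply: is_derive_implicit => // e e0; have [d d0 {}D] := D _ e0.
  have [d2' d2'0 H3] := (cont1P _ _).1 (cont2_left C) _ d0.
  exists (Num.min (Num.min d d2') d'); first by rewrite !lt_min d0 d2'0.
  move=> x'; rewrite !lt_min => /andP[/andP[x1 x2] x3].
  have B' : box a (h a b) r' x' z by apply: Hd'; split; rewrite ?subrr ?normr0.
  have [_ E'] := kP _ _ B'.
  have := D x' (k x' z) x1 (H3 _ x2); rewrite E E' subrr sub0r.
  by rewrite mulNr [X in _ <= _ * X]addrC.
- rewrite -[X in is_derive _ _ _ X]mul1r.
  apply: is_derive_implicit => // e e0; have [d d0 {}D] := D _ e0.
  have [d2' d2'0 H3] := (cont1P _ _).1 (cont2_right C) _ d0.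
  exists (Num.min (Num.min d d2') d'); first by rewrite !lt_min d0 d2'0.
  move=> z'; rewrite !lt_min => /andP[/andP[x1 x2] x3].
  have B' : box a (h a b) r' x z' by apply: Hd'; split; rewrite ?subrr ?normr0.
  have [_ E'] := kP _ _ B'.
  have xx : `|x - x| < d by rewrite subrr normr0.
  have := D x (k x z') xx (H3 _ x2); rewrite E E' !subrr mulr0 subr0 normr0 add0r => h1.
  by rewrite mul1r; apply: (le_trans h1); apply: ler_wpM2l; rewrite ?lerDl//; exact: ltW.
- have c1 := @cont2_comp _ hx (fun x _ => x) k x z chx (@cont2_fst _ x z) C.
  have c2 := @cont2_comp _ hy (fun x _ => x) k x z chy (@cont2_fst _ x z) C.
  by apply: cont2M; [exact: cont2N|exact: cont2V].
- apply: cont2V => //; exact: (@cont2_comp _ hy (fun x _ => x) k x z chy (@cont2_fst _ x z) C).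
Qed.

End ImplicitFunction.

(** * Flows of continuous fields with a potential *)

Section ODE.
Context {R : realType}.
Implicit Types (f g h : R -> R -> R) (a b x y r s t e d z l p L M : R).

Lemma geom_small (K e : R) : 0 < e -> exists k, K / 2 ^+ k < e.
Proof.
move=> e0; pose k := Num.bound (`|K| / e); exists k.
rewrite ltr_pdivrMr ?exprn_gt0// -ltr_pdivrMl// mulrC.
apply: (@le_lt_trans _ _ (`|K| / e)); first by rewrite ler_pM2r ?invr_gt0// ler_norm.
apply: (@lt_le_trans _ _ k%:R); first by apply: archi_boundP; rewrite divr_ge0// ltW.
by rewrite -natrX ler_nat ltnW// ltn_expl.
Qed.

(** [B] is controlled for all [z], so the iterates never leave the domain, and [L * r <= 1 / 2]
    halves the distance between successive iterates. *)
Lemma picard_existence B a0 l r L M : 0 < r -> 0 <= L -> L * r <= 1 / 2 ->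
  (forall a z, `|a - a0| < r -> cont2 B a z) ->
  (forall a z, `|a - a0| < r -> `|B a z| <= M) ->
  (forall a z z', `|a - a0| < r -> `|B a z - B a z'| <= L * `|z - z'|) ->
  exists z : R -> R, z a0 = l /\
    forall a, `|a - a0| < r -> is_derive a 1 z (B a (z a)).
Proof.
move=> r0 L0 Lr cB MB LB.
pose step (u : R -> R) a := l + prim a0 (fun s => B s (u s)) a.
pose zk k := iter k step (cst l).
have cBu (u : R -> R) : (forall a, `|a - a0| < r -> {for a, continuous u}) ->
    forall a, `|a - a0| < r -> {for a, continuous (fun s => B s (u s))}.
  move=> cu a ar; apply: (@cont1_comp2 _ B id) => //; first exact: cB.
  exact: cu.
have dstep (u : R -> R) : (forall a, `|a - a0| < r -> {for a, continuous u}) ->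
    forall a, `|a - a0| < r -> is_derive a 1 (step u) (B a (u a)).
  move=> cu a ar; rewrite -[X in is_derive _ _ _ X]add0r.
  by apply: is_deriveD; exact: (is_derive_prim (cBu _ cu)).
have czk k a : `|a - a0| < r -> {for a, continuous (zk k)}.
  elim: k a => [|k IH] a ar; first exact: cvg_cst.
  exact: is_derive_cont (dstep _ IH _ ar).
have M0 : 0 <= M.
  by apply: le_trans (MB a0 0 _); rewrite ?subrr ?normr0.
have diff (u v : R -> R) c : (forall a, `|a - a0| < r -> {for a, continuous u}) ->
    (forall a, `|a - a0| < r -> {for a, continuous v}) ->
    (forall a, `|a - a0| < r -> `|u a - v a| <= c) ->
    forall a, `|a - a0| < r -> `|step u a - step v a| <= c / 2.
  move=> cu cv uv a ar; rewrite /step opprD addrACA subrr add0r.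
  have c0 : 0 <= c by apply: le_trans (uv a0 _); rewrite ?subrr ?normr0.
  rewrite -(primB (cBu _ cu) (cBu _ cv) ar).
  apply: (@le_trans _ _ (L * c * `|a - a0|)).
    apply: (@prim_le _ _ _ _ r) => //.
      by move=> s sr; apply: continuousB; exact: cBu.
    move=> s /btw_dist sI; have sr : `|s - a0| < r by exact: le_lt_trans ar.
    by apply: (le_trans (LB _ _ _ sr)); rewrite ler_wpM2l// uv.
  have : L * `|a - a0| <= 1 / 2 by apply: le_trans Lr; rewrite ler_wpM2l// ltW.
  by move=> h; rewrite mulrAC [leRHS]mulrC -[2^-1]mul1r ler_wpM2r.
have dk k a : `|a - a0| < r -> `|zk k.+1 a - zk k a| <= M * r / 2 ^+ k.
  elim: k a => [|k IH] a ar.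
    rewrite /zk/= /step addrAC subrr add0r expr0 divr1.
    apply: (@le_trans _ _ (M * `|a - a0|)); last by rewrite ler_wpM2l// ltW.
    apply: (@prim_le _ _ _ _ r) => //; first exact: (cBu (cst l) (fun a _ => cvg_cst _)).
    by move=> s /btw_dist sI; apply: MB; exact: le_lt_trans ar.
  rewrite exprS invfM mulrCA mulrC.
  exact: (diff (zk k.+1) (zk k) _ (czk _) (czk _) IH).
(* The subtracted tail makes the induction on [j] telescope exactly. *)
have dmk k j a : `|a - a0| < r -> `|zk (k + j)%N a - zk k a| <= 2 * (M * r / 2 ^+ k) - 2 * (M * r / 2 ^+ (k + j)).
  move=> ar; elim: j => [|j IH]; first by rewrite addn0 !subrr normr0.
  have -> : zk (k + j.+1)%N a - zk k a = (zk (k + j.+1)%N a - zk (k + j)%N a) + (zk (k + j)%N a - zk k a) by ring.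
  rewrite (le_trans (ler_normD _ _))// addnS; have := dk (k + j)%N a ar.
  have -> : M * r / 2 ^+ (k + j).+1 = M * r / 2 ^+ (k + j) / 2.
    by rewrite exprS invfM mulrCA mulrC.
  by clear -IH; lra.
pose c k := 2 * (M * r / 2 ^+ k).
have c0 k : 0 <= c k by rewrite !mulr_ge0 ?invr_ge0 ?exprn_ge0// ltW.
have dkm k m a : `|a - a0| < r -> (k <= m)%N -> `|zk m a - zk k a| <= c k.
  move=> ar km; rewrite -(subnKC km); apply: (le_trans (dmk _ _ _ ar)).
  by rewrite gerBl; exact: c0.
(* The limit of the iterates as a supremum of lower bounds: the intervals of radius [c k] about
   [zk k a] meet pairwise, each lower end lying below every upper end. *)
pose z a := sup (range (fun k => zk k a - c k)).
have zE k a : `|a - a0| < r -> `|z a - zk k a| <= c k.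
  move=> ar.
  have ub m j : zk m a - c m <= zk j a + c j.
    have [mj|/ltnW jm] := leqP m j.
      have := dkm _ _ _ ar mj; rewrite ler_norml => /andP[h _].
      by have := c0 j; clear -h; lra.
    have := dkm _ _ _ ar jm; rewrite ler_norml => /andP[_ h].
    by have := c0 m; clear -h; lra.
  rewrite ler_norml; apply/andP; split.
    suff : zk k a - c k <= z a by clear; lra.
    by apply: ub_le_sup; [exists (zk 0%N a + c 0%N) => _ [m _ <-]; exact: ub|exists k].
  rewrite lerBlDr addrC; apply: ge_sup; first by exists (zk 0%N a - c 0%N), 0%N.
  by move=> _ [m _ <-]; exact: ub.
have csmall e : 0 < e -> exists k, c k < e.
  by move=> /(@geom_small (2 * (M * r)))[k]; rewrite -mulrA => ?; exists k.
have cz a : `|a - a0| < r -> {for a, continuous z}.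
  move=> ar; apply/cont1P => e e0.
  have [k ck] := csmall (e / 3) ltac:(clear -e0; lra).
  have [d d0 H] := (cont1P _ _).1 (czk k _ ar) (e / 3) ltac:(clear -e0; lra).
  exists (Num.min d (r - `|a - a0|)); first by rewrite lt_min d0 subr_gt0.
  move=> a'; rewrite lt_min => /andP[/H h1 h2].
  have ar' : `|a' - a0| < r by have := ler_distD a a' a0; clear -h2; lra.
  have h3 := zE k _ ar; have h4 := zE k _ ar'; rewrite distrC in h3.
  have := ler_distD (zk k a') (z a') (z a); have := ler_distD (zk k a) (zk k a') (z a).
  by clear -h1 h3 h4 ck; lra.
have zI a : `|a - a0| < r -> z a = step z a.
  move=> ar; apply/eqP; rewrite -subr_eq0 -normr_le0; apply/ler_addgt0Pl => e e0.
  have [k ck] := csmall (e / 2) ltac:(clear -e0; lra).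
  have h1 := zE k.+1 _ ar.
  have h2 : `|step (zk k) a - step z a| <= c k / 2.
    by apply: diff ar => //; [exact: czk|move=> s sr; rewrite distrC; exact: zE].
  have : c k.+1 <= c k.
    rewrite /c ler_wpM2l// ler_wpM2l ?mulr_ge0 ?(ltW r0)//.
    by rewrite lef_pV2 ?posrE ?exprn_gt0// exprS ler_peMl ?exprn_ge0// ler1n.
  have := c0 k; have := ler_distD (step (zk k) a) (z a) (step z a).
  rewrite /zk iterS -/(zk k) in h1.
  by rewrite addr0; clear -h1 h2 ck; lra.
exists z; split; first by rewrite zI ?subrr ?normr0// /step primxx addr0.
move=> a ar; apply: (@is_derive_locally _ (step z) _ _ _ (r - `|a - a0|)); rewrite ?subr_gt0//.
  by move=> s sa; rewrite zI//; have := ler_distD a s a0; clear -sa; lra.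
exact: dstep.
Qed.

(** On so short an interval no exponential appears: at a point [m] where |w| is largest, the mean
    value theorem gives |w m| <= |w a0| + |w m| / 2 + p * d. *)
Lemma gronwall (w dw : R -> R) a0 a p L d : 0 <= L -> L * p <= 1 / 2 -> 0 <= d ->
  (forall s, `|s - a0| <= p -> is_derive s 1 w (dw s)) ->
  (forall s, `|s - a0| <= p -> `|dw s| <= L * `|w s| + d) ->
  `|a - a0| <= p -> `|w a| <= 2 * (`|w a0| + p * d).
Proof.
move=> L0 Lp d0 Dw Hw ap.
have p0 : 0 <= p by exact: le_trans ap.
have inI s : s \in `[a0 - p, a0 + p] -> `|s - a0| <= p.
  by rewrite in_itv/= ler_norml; clear; move=> /andP[? ?]; apply/andP; split; lra.
have [||m /inI mI Hm] := @EVT_max R (fun s => `|w s|) (a0 - p) (a0 + p).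
- by clear -p0; lra.
- apply: continuous_in_subspaceT => s /set_mem/inI sI.
  by apply: continuous_comp; [exact: is_derive_cont (Dw _ sI)|exact: norm_continuous].
have {}Hm s : `|s - a0| <= p -> `|w s| <= `|w m|.
  move=> sI; apply: Hm; rewrite in_itv/=; move: sI; rewrite ler_norml; clear.
  by move=> /andP[? ?]; apply/andP; split; lra.
have h : `|w m - w a0| <= (L * `|w m| + d) * `|m - a0|.
  apply: (@mean_value_le _ _ dw) => s /btw_dist sI; have sp := le_trans sI mI; first exact: Dw.
  by apply: (le_trans (Hw _ sp)); rewrite lerD2r ler_wpM2l// Hm.
have h2 : (L * `|w m| + d) * `|m - a0| <= `|w m| / 2 + p * d.
  apply: (@le_trans _ _ ((L * `|w m| + d) * p)).
    by rewrite ler_wpM2l// addr_ge0// mulr_ge0.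
  rewrite mulrDl [d * p]mulrC lerD2r mulrAC [leRHS]mulrC -[2^-1]mul1r.
  by rewrite ler_wpM2r.
have h3 := Hm _ ap; have h4 := ler_distD (w a0) (w m) 0; rewrite !subr0 in h4.
by clear -h h2 h3 h4; lra.
Qed.

(** For [p >= 0], the retraction of the line onto [[c - p, c + p]]; composing with it extends a
    field given near [c] to all [z] with the same bound and Lipschitz constant. *)
Definition clamp (c p z : R) := Num.max (c - p) (Num.min (c + p) z).

Lemma clamp_ball c p z : 0 <= p -> `|clamp c p z - c| <= p.
Proof.
move=> p0; rewrite ler_norml /clamp; apply/andP; split.
  by rewrite lerBrDr addrC le_max lexx.
by rewrite lerBlDr [p + c]addrC ge_max ge_min lexx andbT; clear -p0; lra.
Qed.

Lemma clampK c p z : `|z - c| <= p -> clamp c p z = z.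
Proof.
rewrite ler_norml => /andP[h1 h2]; rewrite /clamp.
have -> : Num.min (c + p) z = z by apply/min_idPr; lra.
by apply/max_idPr; lra.
Qed.

Lemma clamp_lip c p z z' : `|clamp c p z - clamp c p z'| <= `|z - z'|.
Proof.
have n1 := ler_norm (z - z'); have n2 := ler_norm (z' - z); rewrite distrC in n2.
have minL (m : R) : `|Num.min m z - Num.min m z'| <= `|z - z'|.
  by rewrite ler_norml; case: (leP m z) => ?; case: (leP m z') => ?; apply/andP; split; lra.
rewrite /clamp; apply: le_trans (minL (c + p)).
move: (Num.min _ z) (Num.min _ z') => u v.
have m1 := ler_norm (u - v); have m2 := ler_norm (v - u); rewrite distrC in m2.
clear -m1 m2; rewrite ler_norml.
by case: (leP (c - p) u) => ?; case: (leP (c - p) v) => ?; apply/andP; split; lra.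
Qed.

Lemma clamp_continuous c p z : {for z, continuous (clamp c p)}.
Proof.
apply/cont1P => e e0; exists e => // y; apply: le_lt_trans; exact: clamp_lip.
Qed.

(** The derivative in the label solves the linearized equation along the solution, hence the
    exponential of an integral of [Bz]. *)
Lemma ode_flow B Bz a0 z0 r : 0 < r ->
  cont_on a0 z0 r B ->
  (forall a z, box a0 z0 r a z -> is_derive z 1 (B a) (Bz a z)) ->
  cont_on a0 z0 r Bz ->
  exists r', exists Z : R -> R -> R, [/\ 0 < r' <= r,
    forall l, Z a0 l = l,
    forall a l, box a0 z0 r' a l -> box a0 z0 r a (Z a l) &
    C1box a0 z0 r' Z (fun a l => B a (Z a l))
      (fun a l => expR (prim a0 (fun s => Bz s (Z s l)) a))].
Proof.
move=> r0 cB dB cBz.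
have bc : box a0 z0 r a0 z0 by exact: box_center.
pose M := `|B a0 z0| + 1; pose L := `|Bz a0 z0| + 1.
have M0 : 0 < M by rewrite /M ltr_wpDl ?normr_ge0 ?ltr01.
have L0 : 0 < L by rewrite /L ltr_wpDl ?normr_ge0 ?ltr01.
have [d1 d10 H1] := (cont2P _ _ _).1 (cB _ _ bc) _ ltr01.
have [d2 d20 H2] := (cont2P _ _ _).1 (cBz _ _ bc) _ ltr01.
pose p := Num.min (Num.min d1 d2) r / 2.
have p0 : 0 < p by rewrite divr_gt0// !lt_min d10 d20.
have [pd1 pd2 pr] : [/\ 2 * p <= d1, 2 * p <= d2 & 2 * p <= r].
  by rewrite /p mulrC divfK//; split; rewrite !ge_min lexx ?orbT.
(* The bounds ensure, in order, that labels lie within [p / 2] of [z0], that the Picard step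
   contracts by 1/2, and that a solution moves by at most [p / 2]; it therefore stays where the
   clamp is the identity. *)
pose r' := Num.min (p / 2) (Num.min (1 / (2 * L)) (p / (2 * M))).
have r'0 : 0 < r' by rewrite !lt_min; apply/and3P; split; apply: divr_gt0 => //; exact: mulr_gt0.
have r'p : r' <= p / 2 by rewrite ge_min lexx.
have Lr' : L * r' <= 1 / 2.
  rewrite -ler_pdivlMl//; apply: (@le_trans _ _ (1 / (2 * L))).
    by rewrite /r' !ge_min lexx ?orbT.
  by rewrite le_eqVlt; apply/orP; left; apply/eqP; field; rewrite lt0r_neq0.
have Mr' : M * r' <= p / 2.
  rewrite -ler_pdivlMl//; apply: (@le_trans _ _ (p / (2 * M))).
    by rewrite /r' !ge_min lexx ?orbT.
  by rewrite le_eqVlt; apply/orP; left; apply/eqP; field; rewrite lt0r_neq0.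
have inb a z : `|a - a0| <= p -> `|z - z0| <= p -> box a0 z0 r a z.
  by move=> h1 h2; split; clear -p0 pr h1 h2; lra.
have inb' a z : `|a - a0| <= p -> `|z - z0| <= p -> `|B a z| <= M /\ `|Bz a z| <= L.
  move=> ap zp; have := H1 a z ltac:(clear -ap p0 pd1; lra) ltac:(clear -zp p0 pd1; lra).
  have := H2 a z ltac:(clear -ap p0 pd2; lra) ltac:(clear -zp p0 pd2; lra) => h1 h2.
  split; rewrite /M /L -lerBlDl; apply/ltW; apply: le_lt_trans (_ : _ <= _) _; [|exact: h2| |exact: h1];
    exact: lerB_dist.
have lip a z z' : `|a - a0| <= p -> `|z - z0| <= p -> `|z' - z0| <= p ->
    `|B a z - B a z'| <= L * `|z - z'|.
  move=> ap zp zp'; apply: (@mean_value_le _ _ (Bz a)) => s sI.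
    by apply: dB; apply: inb => //; exact: btw_ball zp' zp sI.
  by have [] := inb' a s ap (btw_ball zp' zp sI).
pose Bt a z := B a (clamp z0 p z).
have cp z : `|clamp z0 p z - z0| <= p by exact: clamp_ball (ltW p0).
have ar' a : `|a - a0| < r' -> `|a - a0| <= p by move=> h; clear -h p0 r'p; lra.
have ex l : exists z : R -> R, z a0 = l /\ forall a, `|a - a0| < r' -> is_derive a 1 z (Bt a (z a)).
  apply: (@picard_existence _ _ _ _ L M) => //; first exact: ltW.
  - move=> a z /ar' ap; apply: (@cont2_comp _ B (fun a _ => a) (fun _ z => clamp z0 p z)).
    + by apply: cB; exact: inb.
    + exact: cont2_fst.
    + by apply: (@cont2_fun1 _ _ (fun _ z => z)); [exact: clamp_continuous|exact: cont2_snd].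
  - by move=> a z /ar' ap; have [] := inb' _ _ ap (cp z).
  - move=> a z z' /ar' ap; apply: (le_trans (lip _ _ _ ap (cp z) (cp z'))).
    by rewrite ler_wpM2l ?clamp_lip// ltW.
pose Z a l := xget (fun=> 0) [set z | z a0 = l /\
   forall a, `|a - a0| < r' -> is_derive a 1 z (Bt a (z a))] a.
have [Z0 DZ] : (forall l, Z a0 l = l) /\ forall a l, `|a - a0| < r' -> is_derive a 1 (Z^~ l) (Bt a (Z a l)).
  split=> [l|a l]; have := xgetPex (fun=> 0) (ex l); rewrite /Z => -[h1 h2]; [exact: h1|exact: h2].
have ZM a s l : `|a - a0| < r' -> `|s - a0| < r' -> `|Z a l - Z s l| <= M * `|a - s|.
  move=> ar sr; apply: (@mean_value_le _ (Z^~ l) (fun a => Bt a (Z a l))) => t tI.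
    by apply: DZ; exact: btw_box tI.
  by have [] := inb' t _ (ar' _ (btw_box sr ar tI)) (cp (Z t l)).
have a0r' : `|a0 - a0| < r' by rewrite subrr normr0.
have Zp a l : box a0 z0 r' a l -> `|Z a l - z0| <= p.
  move=> [ar lr]; have := ZM a a0 l ar a0r'; rewrite Z0 => h.
  have : M * `|a - a0| <= M * r' by rewrite ler_wpM2l ?(ltW ar)// ltW.
  by have := ler_distD l (Z a l) z0; clear -h lr Mr' r'p; lra.
have {}DZ a l : box a0 z0 r' a l -> is_derive a 1 (Z^~ l) (B a (Z a l)).
  by move=> b; rewrite -[X in B _ X](@clampK z0 p) ?Zp//; apply: DZ; case: b.
have Zl a l l' : box a0 z0 r' a l -> box a0 z0 r' a l' -> `|Z a l' - Z a l| <= 2 * `|l' - l|.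
  move=> [ar lr] [_ lr'].
  (* The null term puts the estimate in the form of [gronwall] with [d = 0]. *)
  have -> : `|l' - l| = `|Z a0 l' - Z a0 l| + `|a - a0| * 0 by rewrite mulr0 addr0 !Z0.
  apply: (@gronwall (fun s => Z s l' - Z s l) (fun s => B s (Z s l') - B s (Z s l)) a0 a `|a - a0| L) => //.
  - exact: ltW.
  - by apply: le_trans Lr'; rewrite ler_wpM2l// ltW.
  - by move=> s sa; apply: is_deriveB; apply: DZ; split => //; exact: le_lt_trans ar.
  - move=> s sa; rewrite addr0; have sr := le_lt_trans sa ar.
    by apply: lip; [exact: ar'|exact: Zp|exact: Zp].
have cZ a l : box a0 z0 r' a l -> cont2 Z a l.
  move=> b; apply/cont2P => e e0; have [d d0 Hd] := box_open b.
  exists (Num.min d (Num.min (e / 4) (e / (2 * M)))).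
    by rewrite !lt_min d0 !divr_gt0// mulr_gt0.
  move=> a' l'; rewrite !lt_min => /andP[a1 /andP[_ a3]] /andP[l1 /andP[l2 _]].
  have ll : `|l - l| < d by rewrite subrr normr0.
  have b1 := Hd _ _ (conj a1 l1); have b2 := Hd _ _ (conj a1 ll).
  have h1 := Zl _ _ _ b2 b1; have h2 := ZM a' a l b2.1 b.1.
  have h3 := ler_distD (Z a' l) (Z a' l') (Z a l).
  rewrite ltr_pdivlMr ?mulr_gt0// in a3.
  by clear -h1 h2 h3 a3 l2; lra.
have cBZ a l : box a0 z0 r' a l -> cont2 (fun a l => Bz a (Z a l)) a l.
  move=> b; apply: (@cont2_comp _ Bz (fun a _ => a) Z); [|exact: cont2_fst|exact: cZ].
  by apply: cBz; apply: inb; [apply: ar'; case: b|exact: Zp].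
pose E a l := prim a0 (fun s => Bz s (Z s l)) a.
have cE a l : box a0 z0 r' a l -> cont2 E a l.
  by move=> b; exact: (@cont2_prim _ (fun a l => Bz a (Z a l)) _ _ _ _ _ cBZ b).
exists r', Z; split => //.
- by rewrite r'0 /=; clear -r'p pr p0; lra.
- by move=> a l b; apply: inb; [apply: ar'; case: b|exact: Zp].
move=> a l b; have [ar lr] := b; split.
- exact: DZ.
- apply/is_deriveP => e e0.
  have [e1 e10 e1E] : exists2 e1, 0 < e1 & e = 4 * e1 * (r' + 1).
    exists (e / (4 * (r' + 1))); last by field; clear -r'0; lra.
    by rewrite divr_gt0// mulr_gt0// addr_gt0.
  (* Uniform continuity of [Bz] across the graph of the solution with label [l], where [k] is the
     displacement from that graph. *)
  have [d d0 Hd] : exists2 d, 0 < d & forall k : R, `|k - 0| < d -> forall s, `|s - a0| <= `|a - a0| ->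
      `|Bz s (Z s l + k) - Bz s (Z s l + 0)| < e1.
    apply: (@tube _ (fun s k => Bz s (Z s l + k))) => // s sa.
    have bs : box a0 z0 r' s l by split => //; exact: le_lt_trans ar.
    apply: (@cont2_comp _ Bz (fun s _ => s) (fun s k => Z s l + k)).
    + by rewrite addr0; apply: cBz; apply: inb; [exact: ar' bs.1|exact: Zp].
    + exact: cont2_fst.
    + apply: cont2D; last exact: cont2_snd.
      apply: (@cont2_fun1 _ (Z^~ l) (fun s _ => s)); last exact: cont2_fst.
      exact: cont2_left (cZ _ _ bs).
  have [d3 d30 H3] := box_open b.
  exists (Num.min (d / 2) d3); first by rewrite lt_min d30 divr_gt0.
  move=> l'; rewrite lt_min => /andP[l1 l2].
  have lr' : `|l' - z0| < r' by apply: (H3 a l' (conj _ l2)).2; rewrite subrr normr0.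
  (* The linearization error. It satisfies [w' = Bz * w] up to the Taylor remainder of [B], which is
     at most 2 * e1 * |l' - l|, and it vanishes at [a0]. *)
  pose w s := Z s l' - Z s l - expR (E s l) * (l' - l).
  have -> : Z a l' - Z a l - expR (prim a0 (fun s => Bz s (Z s l)) a) * (l' - l) = w a by [].
  have w0 : w a0 = 0 by rewrite /w !Z0 /E primxx expR0 mul1r subrr.
  pose dw s := B s (Z s l') - B s (Z s l) - expR (E s l) * Bz s (Z s l) * (l' - l).
  have bs s : `|s - a0| <= `|a - a0| -> box a0 z0 r' s l.
    by move=> sa; split => //; exact: le_lt_trans ar.
  have bs' s : `|s - a0| <= `|a - a0| -> box a0 z0 r' s l'.
    by move=> sa; split => //; exact: le_lt_trans ar.
  apply: (@le_trans _ _ (2 * (`|w a0| + `|a - a0| * (2 * e1 * `|l' - l|)))).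
    apply: (@gronwall w dw a0 a `|a - a0| L) => //.
    + exact: ltW.
    + by apply: le_trans Lr'; rewrite ler_wpM2l// ltW.
    + by rewrite !mulr_ge0// ltW.
    + move=> s sa; apply: is_deriveB; first by apply: is_deriveB; apply: DZ; auto.
      apply: is_deriveMc; apply: (@is_derive_compR _ expR).
      have : is_derive s 1 (E^~ l) (Bz s (Z s l)).
        apply: (@is_derive_prim _ (fun s => Bz s (Z s l)) _ r'); last by have [] := bs _ sa.
        by move=> t tr; apply: (cont2_left (f := fun a l => Bz a (Z a l))); exact: cBZ.
      by [].
    + move=> s sa; have h1 := Zl _ _ _ (bs _ sa) (bs' _ sa).
      have -> : dw s = Bz s (Z s l) * w s + (B s (Z s l') - B s (Z s l) - Bz s (Z s l) * (Z s l' - Z s l)).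
        by rewrite /dw /w; ring.
      have [_ hL] := inb' s (Z s l) (ar' _ (bs _ sa).1) (Zp _ _ (bs _ sa)).
      rewrite (le_trans (ler_normD _ _))// lerD//; first by rewrite normrM ler_wpM2r.
      apply: (@le_trans _ _ (e1 * `|Z s l' - Z s l|)); last first.
        by rewrite (mulrC 2) -mulrA ler_wpM2l// ltW.
      have := @mean_value_le _ (fun t => B s t - Bz s (Z s l) * t) (fun t => Bz s t - Bz s (Z s l)) e1 (Z s l) (Z s l').
      rewrite [X in `|X|](_ : _ = B s (Z s l') - B s (Z s l) - Bz s (Z s l) * (Z s l' - Z s l)); last by rewrite mulrBr; ring.
      apply=> t tI; have tp := btw_ball (Zp _ _ (bs _ sa)) (Zp _ _ (bs' _ sa)) tI.
        apply: is_deriveB; first by apply: dB; apply: inb => //; exact: ar' (bs _ sa).1.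
        by exact: is_derive_lin.
      have := Hd (t - Z s l) _ s sa; rewrite addr0 subr0 subrKC => /(_ _)/ltW; apply.
      by have := btw_dist tI; clear -l1 h1; lra.
  rewrite w0 normr0 add0r.
  have -> : 2 * (`|a - a0| * (2 * e1 * `|l' - l|)) = 4 * e1 * `|a - a0| * `|l' - l| by ring.
  rewrite ler_wpM2r//.
  by rewrite e1E ler_wpM2l ?mulr_ge0 ?(ltW e10)//; clear -ar; lra.
- apply: (@cont2_comp _ B (fun a _ => a) Z); [|exact: cont2_fst|exact: cZ].
  by apply: cB; apply: inb; [exact: ar'|exact: Zp].
- by apply: cont2_fun1 (cE _ _ b); exact: continuous_expR.
Qed.

End ODE.

(** * Curves and fluxes in potential coordinates *)

Section Transport.
Context {R : realType}.
Implicit Types (f g h w : R -> R -> R) (a b x y r s t e d z l p L M : R).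

Lemma C1box_prim f fy a b r : cont_on a b r f ->
  (forall x y, box a b r x y -> is_derive y 1 (f x) (fy x y)) ->
  cont_on a b r fy ->
  C1box a b r (fun x y => prim a (f^~ y) x) f (fun x y => prim a (fy^~ y) x).
Proof.
move=> cf df cfy x y bxy; have [xa yb] := bxy; split.
- apply: (@is_derive_prim _ (f^~ y) _ r) => // s sa.
  by apply: cont2_left; exact: cf.
- exact: (is_derive_prim_param cf df cfy bxy).
- exact: cf.
- exact: (cont2_prim cfy bxy).
Qed.

Section Flow.
(** Along [b' = mu] the potential [w] has derivative [wa + rho * mu = beta]. For characteristics
    [rho = D * n2], [mu = - (n1 / n2)] and [gamma] is rot F; for seed curves, with the axes
    exchanged, [rho = n2], [mu = n1 / n2] and [gamma = H]. *)
Variables (a0 b0 r : R) (w wa rho mu beta gamma : R -> R -> R).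
Hypothesis r0 : 0 < r.
Hypothesis w_C1 : C1box a0 b0 r w wa rho.
Hypothesis rho_gt0 : forall a b, box a0 b0 r a b -> 0 < rho a b.
Hypothesis waE : forall a b, box a0 b0 r a b -> wa a b = beta a b - rho a b * mu a b.
Hypothesis cbeta : forall a b, box a0 b0 r a b -> cont2 beta a b.
Hypothesis dbeta : forall a b, box a0 b0 r a b -> is_derive b 1 (beta a) (gamma a b).
Hypothesis cgamma : forall a b, box a0 b0 r a b -> cont2 gamma a b.

(* In the coordinates (a, w) the curves b' = mu(a, b) solve an equation whose
   right-hand side beta is differentiable in w, although mu is only continuous. *)
Lemma flow : exists r', exists l0, exists C e : R -> R -> R,
  [/\ 0 < r' <= r, C a0 l0 = b0,
      forall a l, box a0 l0 r' a l -> box a0 b0 r a (C a l),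
      C1box a0 l0 r' C (fun a l => mu a (C a l)) (fun a l => e a l / rho a (C a l)) &
      forall a l, box a0 l0 r' a l ->
        [/\ 0 < e a l, cont2 e a l &
          is_derive a 1 (e^~ l) (gamma a (C a l) / rho a (C a l) * e a l)]].
Proof.
have [r1 [k [/andP[r10 r1r] kP kK Hk]]] := implicit_function r0 w_C1 rho_gt0.
set z0 := w a0 b0 in kP kK Hk.
have ckP f : cont_on a0 b0 r f ->
    forall a z, box a0 z0 r1 a z -> cont2 (fun a z => f a (k a z)) a z.
  move=> cf a z bz; apply: (@cont2_comp _ f (fun a _ => a) k).
  - by apply: cf; have [] := kP _ _ bz.
  - exact: cont2_fst.
  - exact: C1box_cont2 Hk bz.
have crho a b : box a0 b0 r a b -> cont2 rho a b by move=> /w_C1[].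
have ex := @ode_flow R (fun a z => beta a (k a z)) (fun a z => gamma a (k a z) / rho a (k a z)) a0 z0 r1 r10.
have [||| r2 [Z [/andP[r20 r2r] Z0 Zb HZ]]] := ex.
- exact: ckP.
- move=> a z bz; have [_ D _ _] := Hk _ _ bz.
  by apply: (@is_derive_compR _ (beta a) (k a)) => //; apply: dbeta; have [] := kP _ _ bz.
- move=> a z bz; apply: cont2M; first exact: ckP.
  by apply: cont2V; [rewrite gt_eqF// rho_gt0//; have [] := kP _ _ bz|exact: ckP].
clear ex.
(* Labels are values of [w] on the line [a = a0]. The function [e] is the derivative of
   [w a (C a l)] in [l], so dividing it by [rho] gives that of [C]. *)
exists r2, z0, (fun a l => k a (Z a l)).
exists (fun a l => expR (prim a0 (fun s => gamma s (k s (Z s l)) / rho s (k s (Z s l))) a)).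
have kZ a l : box a0 z0 r2 a l -> box a0 b0 r a (k a (Z a l)).
  by move=> /Zb/kP[].
split=> //.
- by rewrite r20 (le_trans r2r).
- by rewrite Z0 kK//; exact: box_center.
- have := C1box_comp (@C1box_fst R a0 z0 r2) HZ Zb Hk.
  apply: eq_C1box => a l bl; have bk := kZ _ _ bl.
  have rN : rho a (k a (Z a l)) != 0 by rewrite gt_eqF// rho_gt0.
  split; last by rewrite mulr0 add0r mulrC.
  by rewrite (waE bk); field.
move=> a l bl; split; first exact: expR_gt0.
- by have [] := HZ _ _ bl.
- rewrite mulrC; apply: (@is_derive_compR _ expR).
  apply: (@is_derive_prim _ (fun s => gamma s (k s (Z s l)) / rho s (k s (Z s l))) _ r2); last by case: bl.
  move=> s sr; have bs : box a0 z0 r2 s l by split => //; case: bl.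
  have c f : cont_on a0 b0 r f -> {for s, continuous (fun s => f s (k s (Z s l)))}.
    move=> cf; apply: (@cont1_comp2 _ (fun s z => f s (k s z)) id (Z^~ l)) => //.
      by apply: ckP => //; exact: Zb.
    exact: cont2_left (C1box_cont2 HZ bs).
  apply: continuousM; first exact: c.
  by apply: continuousV; [rewrite gt_eqF// rho_gt0//; exact: kZ|exact: c].
Qed.

(* The product rule div (h rho mu, h rho) = kappa rho + h gamma, in terms of
   potentials, for h differentiable only along the curves b' = mu. *)
Lemma transport_potential h kappa :
  cont_on a0 b0 r h ->
  cont_on a0 b0 r kappa ->
  (forall (u : R -> R) a p, 0 < p ->
    (forall s, `|s - a| < p -> box a0 b0 r s (u s) /\ is_derive s 1 u (mu s (u s))) ->
    is_derive a 1 (fun s => h s (u s)) (kappa a (u a))) ->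
  exists r', exists Y Q : R -> R -> R,
    [/\ 0 < r' <= r,
     C1box a0 b0 r' Y (fun a b => Q a b - h a b * (rho a b * mu a b)) (fun a b => h a b * rho a b),
     cont_on a0 b0 r' Q &
     forall a b, box a0 b0 r' a b -> is_derive b 1 (Q a) (kappa a b * rho a b + h a b * gamma a b)].
Proof.
move=> ch ckappa Hh.
have [r1 [l0 [C [e [/andP[r10 r1r] C0 Cb HC He]]]]] := flow.
have cC f : cont_on a0 b0 r f ->
    forall a z, box a0 l0 r1 a z -> cont2 (fun a z => f a (C a z)) a z.
  move=> cf a z bz; apply: (@cont2_comp _ f (fun a _ => a) C).
  - by apply: cf; exact: Cb.
  - exact: cont2_fst.
  - exact: C1box_cont2 HC bz.
have crho a b : box a0 b0 r a b -> cont2 rho a b by move=> /w_C1[].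
have rN a l : box a0 l0 r1 a l -> rho a (C a l) != 0.
  by move=> /Cb bl; rewrite gt_eqF// rho_gt0.
(* [F] is the density of [h * rho * db] in the label, as [C] has derivative [e / rho] in [l]. At a
   fixed label, varying [a] follows a curve, and there [h] is differentiable. *)
pose F l a := h a (C a l) * e a l.
pose Fa l a := (kappa a (C a l) + h a (C a l) * gamma a (C a l) / rho a (C a l)) * e a l.
have cF l a : box l0 a0 r1 l a -> cont2 F l a.
  move=> [bl ba]; have bal : box a0 l0 r1 a l by split.
  by apply: (@cont2_swap _ (fun a l => F l a)); apply: cont2M; [exact: cC|have [] := He _ _ bal].
have cFa l a : box l0 a0 r1 l a -> cont2 Fa l a.
  move=> [bl ba]; have bal : box a0 l0 r1 a l by split.
  apply: (@cont2_swap _ (fun a l => Fa l a)); apply: cont2M; last by have [] := He _ _ bal.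
  apply: cont2D; first exact: cC.
  apply: cont2M; last by apply: cont2V; [exact: rN|exact: cC].
  by apply: cont2M; exact: cC.
have dF l a : box l0 a0 r1 l a -> is_derive a 1 (F l) (Fa l a).
  move=> [bl ba]; have bal : box a0 l0 r1 a l by split.
  have [_ _ de] := He _ _ bal.
  have dh : is_derive a 1 (fun a => h a (C a l)) (kappa a (C a l)).
    apply: (Hh (C^~ l) a (r1 - `|a - a0|)); first by rewrite subr_gt0.
    move=> s sa; have bs : box a0 l0 r1 s l.
      by split => //; rewrite (le_lt_trans (ler_distD a s a0))// -ltrBrDr.
    by split; [exact: Cb|have [] := HC _ _ bs].
  apply: (is_derive_val (is_derive_mul dh de)).
  by rewrite /Fa; field; exact: rN.
have Hy := C1box_swap (C1box_prim cF dF cFa).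
have Cl a l : box a0 l0 r1 a l -> 0 < e a l / rho a (C a l).
  by move=> bl; rewrite divr_gt0//; [have [] := He _ _ bl|rewrite rho_gt0//; exact: Cb].
have [r2 [k [/andP[r20 r2r] kP kK]]] := implicit_function r10 HC Cl.
rewrite C0 => Hk.
rewrite C0 in kP kK.
have kb a b : box a0 b0 r2 a b -> box a0 l0 r1 a (k a b) by move=> /kP[].
(* The density and its derivative are integrated in the label, then pulled back by [k], the label as
   a function of [(a, b)]. *)
exists r2, (fun a b => prim l0 (F^~ a) (k a b)), (fun a b => prim l0 (Fa^~ a) (k a b)).
split.
- by rewrite r20 (le_trans r2r).
- have := C1box_comp (@C1box_fst R a0 b0 r2) Hk kb Hy.
  apply: eq_C1box => a b bb; have [bk Ck] := kP _ _ bb.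
  have e0 : e a (k a b) != 0 by have [eg _ _] := He _ _ bk; rewrite gt_eqF.
  by have := rN _ _ bk; rewrite /F Ck => rN'; split; field; rewrite ?e0 ?rN'.
- move=> a b bb; apply: (@cont2_comp _ (fun a l => prim l0 (Fa^~ a) l) (fun a _ => a) k).
  + have [bk1 bk2] := kb _ _ bb.
    apply: (@cont2_swap _ (fun l a => prim l0 (Fa^~ a) l)).
    by apply: (cont2_prim cFa).
  + exact: cont2_fst.
  + exact: C1box_cont2 Hk bb.
- move=> a b bb; have [bk Ck] := kP _ _ bb; have [_ dk _ _] := Hk _ _ bb.
  have [bk1 bk2] := bk.
  have D : is_derive (k a b) 1 (prim l0 (Fa^~ a)) (Fa (k a b) a).
    apply: (@is_derive_prim _ (Fa^~ a) _ r1) => // s sr.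
    by apply: cont2_left; exact: cFa.
  apply: (is_derive_val (is_derive_compR dk D)).
  have e0 : e a (k a b) != 0 by have [eg _ _] := He _ _ bk; rewrite gt_eqF.
  by have := rN _ _ bk; rewrite /Fa Ck => rN'; field; rewrite ?e0 ?rN'.
Qed.

End Flow.

(** Subtracting the primitive of [Q] in [a] moves the correction from one partial derivative to the
    other. Both gauges encode the same weak equation: the [b]-derivative of [q] plus the
    [a]-derivative of [Yb] is [K]. *)
Lemma change_gauge a0 b0 r Y Ya Yb q Q K : C1box a0 b0 r Y Ya Yb ->
  (forall a b, box a0 b0 r a b -> Ya a b = Q a b - q a b) ->
  cont_on a0 b0 r Q ->
  (forall a b, box a0 b0 r a b -> is_derive b 1 (Q a) (K a b)) ->
  cont_on a0 b0 r K ->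
  C1box a0 b0 r (fun a b => Y a b - prim a0 (Q^~ b) a) (fun a b => - q a b)
    (fun a b => Yb a b - prim a0 (K^~ b) a).
Proof.
move=> HY YE cQ dQ cK; have := C1boxB HY (C1box_prim cQ dQ cK).
by apply: eq_C1box => a b /YE ->; split => //; ring.
Qed.

End Transport.

(** * Differentiability of the angle *)

Section Core.
Context {R : realType}.
Implicit Types (f g h w : R -> R -> R) (a b x y r s t e d z l p L M : R).

(* The field (n1, n2) has flux at most the length through any curve, with
   equality along a characteristic c; so the flux through c + eta is maximal at
   eta = 0 and its derivative in eta vanishes there. *)
Lemma normal_along_char n1 n2 H W ht x0 y0 r (c : R -> R) x p :
  (forall x y, box x0 y0 r x y -> 0 < n2 x y /\ n1 x y ^+ 2 + n2 x y ^+ 2 = 1) ->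
  C1box x0 y0 r W (fun x y => n2 x y - ht x y) (fun x y => - n1 x y) ->
  (forall x y, box x0 y0 r x y -> is_derive y 1 (ht x) (H x y)) ->
  cont_on x0 y0 r H ->
  0 < p -> (forall s, `|s - x| < p -> box x0 y0 r s (c s) /\
    is_derive s 1 c (- (n1 s (c s) / n2 s (c s)))) ->
  is_derive x 1 (fun s => n1 s (c s)) (H x (c x)).
Proof.
move=> Hn HW Hht cH p0 Hc; apply/is_deriveP => e e0.
have [bx dcx] : box x0 y0 r x (c x) /\ is_derive x 1 c (- (n1 x (c x) / n2 x (c x))).
  by apply: Hc; rewrite subrr normr0.
have [d1 d10 H1] := (cont2P _ _ _).1 (cH _ _ bx) _ e0.
have [d2 d20 H2] := box_open bx.
have [d d0 [dd1 dd2]] : exists2 d, 0 < d & d <= d1 /\ d <= d2.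
  by exists (Num.min d1 d2); rewrite ?lt_min ?d10// !ge_min !lexx orbT.
have [d3 d30 H3] := (cont1P _ _).1 (is_derive_cont dcx) (d / 2) ltac:(by rewrite divr_gt0).
pose q := Num.min (Num.min d3 p) d.
have [q3 qp qd] : [/\ q <= d3, q <= p & q <= d] by split; rewrite !ge_min lexx ?orbT.
have q0 : 0 < q by rewrite !lt_min d30 p0.
exists q => //.
set H0 := H x (c x).
have near1 s (k : R) : `|s - x| < q -> `|k| < d / 2 -> `|s - x| < d /\ `|c s + k - c x| < d.
  move=> sq kd; split; first exact: lt_le_trans qd.
  have := H3 s (lt_le_trans sq q3) => h; rewrite addrAC (le_lt_trans (ler_normD _ _))//.
  by clear -h kd; lra.
have inb s (k : R) : `|s - x| < q -> `|k| < d / 2 -> box x0 y0 r s (c s + k) /\ `|H s (c s + k) - H0| < e.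
  move=> sq kd; have [h1 h2] := near1 _ _ sq kd; split.
    by apply: H2; split; [exact: lt_le_trans h1 dd2|exact: lt_le_trans h2 dd2].
  by apply: H1; [exact: lt_le_trans h1 dd1|exact: lt_le_trans h2 dd1].
have d20' : `|0 : R| < d / 2 by rewrite normr0 divr_gt0.
have inb0 s : `|s - x| < q -> box x0 y0 r s (c s) by move=> /inb/(_ d20')[]; rewrite addr0.
(* Between two abscissae, [g k] grows by the flux through [c + k] minus the flux through [c], both
   corrected by [ht]. *)
pose g (k : R) s := W s (c s + k) - W s (c s).
have dg (k : R) s : `|k| < d / 2 -> `|s - x| < q -> exists2 G, is_derive s 1 (g k) G & G <= - H0 * k + e * `|k|.
  move=> kd sq; have [b1 _] := inb _ _ sq kd; have b0 := inb0 _ sq.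
  have [_ dc] := Hc s (lt_le_trans sq qp).
  have D1 := @tdiff_curve _ W id (fun s => c s + k) s _ _ _ _ (C1box_tdiff HW b1) (is_derive_id s 1) (is_deriveD dc (is_derive_cst k s 1)).
  have D0 := @tdiff_curve _ W id c s _ _ _ _ (C1box_tdiff HW b0) (is_derive_id s 1) dc.
  eexists; first exact: (is_deriveB D1 D0).
  have [n20 nE] := Hn _ _ b0; have [n20' nE'] := Hn _ _ b1.
  have [z zI zE] : exists2 z, btw (c s) (c s + k) z & ht s (c s + k) - ht s (c s) = H s z * k.
    have [z zI|z zI] := @mean_value _ (ht s) (H s) (c s) (c s + k).
      by apply: Hht; apply: (box_btw b0 b1 _ zI); left; rewrite lexx.
    by rewrite addrAC subrr add0r; exists z.
  have [_ Hz] := inb s (z - c s) sq ltac:(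
    by have := btw_dist zI; rewrite addrAC subrr add0r => /le_lt_trans; apply).
  rewrite subrKC in Hz.
  have hz : - (H s z * k) <= - H0 * k + e * `|k|.
    have : `|(H s z - H0) * k| <= e * `|k| by rewrite normrM ler_wpM2r// ltW.
    by rewrite ler_norml => /andP[h _]; clear -h; lra.
  apply: le_trans hz; move: zE n20 nE n20' nE'.
  move: (n1 s (c s)) (n2 s (c s)) (n1 s (c s + k)) (n2 s (c s + k)) => m1 m2 m1' m2'.
  move: (ht s (c s + k)) (ht s (c s)) (H s z * k) => u v w zE n20 nE n20' nE'.
  (* Cauchy-Schwarz for two unit vectors, divided by [m2 > 0]. *)
  have : (m1 * m1' + m2 * m2') / m2 <= (m1 ^+ 2 + m2 ^+ 2) / m2.
    rewrite ler_pM2r ?invr_gt0// nE.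
    have := sqr_ge0 (m1 - m1'); have := sqr_ge0 (m2 - m2').
    by clear -nE nE'; lra.
  have -> : (m1 * m1' + m2 * m2') / m2 = m2' + m1' * (m1 / m2) by field; rewrite gt_eqF.
  have -> : (m1 ^+ 2 + m2 ^+ 2) / m2 = m2 + m1 * (m1 / m2) by field; rewrite gt_eqF.
  by rewrite addr0; clear -zE; lra.
have key u v : `|u - x| < q -> `|v - x| < q -> u < v ->
    `|n1 v (c v) - n1 u (c u) - H0 * (v - u)| <= e * (v - u).
  move=> ux vx uv; set D := n1 v (c v) - n1 u (c u).
  have dk : is_derive (0 : R) 1 (fun k => W v (c v + k) - W u (c u + k)) (- D).
    have Dv : is_derive (0 : R) 1 (fun k => W v (c v + k)) (- n1 v (c v)).
      have [_ + _ _] := HW _ _ (inb0 _ vx); rewrite -{1}[c v]addr0 => h.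
      rewrite -[X in is_derive _ _ _ X]mulr1.
      apply: (@is_derive_compR _ (W v) (fun k => c v + k) 0) => //.
      by rewrite -[X in is_derive _ _ _ X]add0r; apply: is_deriveD.
    have Du : is_derive (0 : R) 1 (fun k => W u (c u + k)) (- n1 u (c u)).
      have [_ + _ _] := HW _ _ (inb0 _ ux); rewrite -{1}[c u]addr0 => h.
      rewrite -[X in is_derive _ _ _ X]mulr1.
      apply: (@is_derive_compR _ (W u) (fun k => c u + k) 0) => //.
      by rewrite -[X in is_derive _ _ _ X]add0r; apply: is_deriveD.
    by have := is_deriveB Dv Du; congr is_derive; rewrite /D; ring.
  have up (k : R) : `|k| < d / 2 -> g k v - g k u <= (- H0 * k + e * `|k|) * (v - u).
    move=> kd.
    have ex s : exists G, `|s - x| < q -> is_derive s 1 (g k) G /\ G <= - H0 * k + e * `|k|.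
      have [sq|sq] := ltP `|s - x| q; last by exists 0.
      by have [G ? ?] := dg _ _ kd sq; exists G.
    have [G HG] := choice ex.
    have [s sI|s sI ->] := @mean_value _ (g k) G u v.
      by have [] := HG s (btw_box ux vx sI).
    rewrite ler_wpM2r ?subr_ge0 ?(ltW uv)//.
    by have [] := HG s (btw_box ux vx sI).
  (* The one-sided bound [up] is used at [k] and at [- k], which encloses the derivative at 0 from
     both sides. *)
  have main (e' : R) : 0 < e' -> `|D - H0 * (v - u)| <= e * (v - u) + e'.
    move=> e'0; have [d4 d40 H4] := (is_deriveP _ _ _).1 dk _ e'0.
    pose k := Num.min d4 (d / 2) / 2.
    have k0 : 0 < k by rewrite !divr_gt0// lt_min d40 divr_gt0.
    have [kd4 kd] : k < d4 /\ k < d / 2.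
      have : 2 * k <= d4 /\ 2 * k <= d / 2.
        by rewrite /k mulrC divfK//; rewrite !ge_min !lexx orbT.
      by clear -k0 => -[? ?]; lra.
    have n1k : `|k| = k by rewrite gtr0_norm.
    have n2k : `|- k| = k by rewrite normrN.
    have h1 := up k; rewrite n1k in h1; have {}h1 := h1 kd.
    have h2 := up (- k); rewrite n2k in h2; have {}h2 := h2 kd.
    have h3 := H4 k; rewrite subr0 n1k in h3; have {}h3 := h3 kd4.
    have h4 := H4 (- k); rewrite subr0 n2k in h4; have {}h4 := h4 kd4.
    rewrite !addr0 in h3 h4; rewrite ler_norml in h3; rewrite ler_norml in h4.
    have [/andP[h3l _] /andP[h4l _]] := conj h3 h4; rewrite /g in h1 h2.
    have a1 : (H0 * (v - u) - D) * k <= (e * (v - u) + e') * k by clear -h1 h3l; lra.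
    have a2 : (D - H0 * (v - u)) * k <= (e * (v - u) + e') * k by clear -h2 h4l; lra.
    rewrite ler_pM2r// in a1; rewrite ler_pM2r// in a2.
    by rewrite ler_norml; apply/andP; split; clear -a1 a2; lra.
  by apply/ler_addgt0Pr.
move=> s sx; have xx : `|x - x| < q by rewrite subrr normr0.
have [sx'|sx'|->] := ltgtP s x; last by rewrite !subrr mulr0 subrr normr0 mulr0.
- have h := key _ _ sx xx sx'; rewrite (ltr0_norm (x := s - x)) ?subr_lt0// opprB.
  by rewrite -normrN (le_trans _ h)// le_eqVlt; apply/orP; left; apply/eqP; congr Num.norm; rewrite /H0; ring.
- have := key _ _ xx sx sx'; rewrite (gtr0_norm (x := s - x)) ?subr_gt0//.
Qed.

Lemma continuous_bound (f : R -> R) a p : 0 <= p ->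
  (forall s, `|s - a| <= p -> {for s, continuous f}) ->
  exists2 B, 0 <= B & forall s, `|s - a| <= p -> `|f s| <= B.
Proof.
move=> p0 cf; have inI s : s \in `[a - p, a + p] <-> `|s - a| <= p.
  by rewrite in_itv/= ler_norml; clear; split => /andP[? ?]; apply/andP; split; lra.
have [||m /inI mI Hm] := @EVT_max R (fun s => `|f s|) (a - p) (a + p).
- by clear -p0; lra.
- apply: continuous_in_subspaceT => s /set_mem/inI sI.
  by apply: continuous_comp; [exact: cf|exact: norm_continuous].
by exists `|f m| => // s /inI; exact: Hm.
Qed.

End Core.

(** * The angle as a function of the label of a characteristic *)

Section Angle.
Context {R : realType}.
Implicit Types (f g h w : R -> R -> R) (a b x y r s t e d z l p L M : R).

Lemma acos_unit (u v : R) : 0 < v -> u ^+ 2 + v ^+ 2 = 1 ->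
  [/\ -1 < u < 1, cos (acos u) = u & sin (acos u) = v].
Proof.
move=> v0 uv; have u1 : -1 < u < 1 by have v2 := exprn_gt0 2 v0; apply/andP; split; nra.
have u1' : -1 <= u <= 1 by case/andP: u1 => h1 h2; rewrite (ltW h1) (ltW h2).
split => //; first by apply: acosK; rewrite in_itv.
by rewrite sin_acos// -uv addrAC subrr add0r sqrtr_sqr gtr0_norm.
Qed.

Lemma sin_near0 e : 0 < e -> exists2 d, 0 < d & forall x, `|x| < d -> `|sin x - x| <= e * `|x|.
Proof.
move=> e0; have [d d0 H] := (is_deriveP _ _ _).1 (@is_derive_sin R 0) _ e0.
by exists d => // x; have := H x; rewrite cos0 sin0 !subr0 mul1r.
Qed.

(** A difference of two values of - cot: only the sine of the difference of the angles remains, and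
    it equals that difference to first order. *)
Lemma quot_sub_sin (a b u v : R) : sin a = u -> sin b = v -> u != 0 -> v != 0 ->
  - (cos a / u) - - (cos b / v) = sin (a - b) / (u * v).
Proof. by move=> <- <- u0 v0; rewrite sinB; field; rewrite u0 v0. Qed.

(** The linearization error of the slope. [I] and [I'] stand for 1 / sin of the two angles, [D] for
    the increment of the angle and [S] for its sine, [Dl] for the increment of [o], and [g * k + E]
    for that of [G]. *)
Lemma quot_sub_sin_bound (B Bg e1 I I' D E S Dl k g : R) : 0 <= B -> 0 <= Bg -> 0 <= e1 <= 1 ->
  `|I| <= B -> `|I' - I| <= e1 -> `|S - D| <= e1 * `|D| -> `|E| <= e1 * `|k| -> `|g| <= Bg ->
  D = Dl - (g * k + E) ->
  `|S * (I' * I) - I * I * (Dl - g * k)| <=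
    e1 * ((B * (B + 1) + B) * (Bg + 1) + B * B) * (`|Dl| + `|k|).
Proof.
move=> B0 Bg0 /andP[e0 e1l] HI HI' HS HE Hg DE.
have k0 := normr_ge0 k; have Dl0 := normr_ge0 Dl.
have HI2 : `|I'| <= B + 1 by have := ler_distD I I' 0; rewrite !subr0; clear -HI HI' e1l; lra.
have HD : `|D| <= (Bg + 1) * (`|Dl| + `|k|).
  have h1 : `|g * k| <= Bg * `|k| by rewrite normrM ler_wpM2r.
  have h2 : e1 * `|k| <= `|k| by rewrite -[leRHS]mul1r ler_wpM2r.
  have h3 : 0 <= Bg * `|Dl| by exact: mulr_ge0.
  have := ler_normB Dl (g * k + E); have := ler_normD (g * k) E; rewrite -DE.
  by clear -h1 h2 h3 HE; lra.
have -> : S * (I' * I) - I * I * (Dl - g * k) = (S - D) * (I' * I) + D * (I * (I' - I)) - I * I * E.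
  by rewrite DE; ring.
have b1 : `|(S - D) * (I' * I)| <= e1 * `|D| * ((B + 1) * B).
  by rewrite !normrM; apply: ler_pM; rewrite ?mulr_ge0//; apply: ler_pM.
have b2 : `|D * (I * (I' - I))| <= `|D| * (B * e1).
  by rewrite !normrM ler_wpM2l//; apply: ler_pM.
have b3 : `|I * I * E| <= B * B * (e1 * `|k|).
  by rewrite !normrM; apply: ler_pM; rewrite ?mulr_ge0//; apply: ler_pM.
have b4 : `|D| * (e1 * (B * (B + 1) + B)) <= (Bg + 1) * (`|Dl| + `|k|) * (e1 * (B * (B + 1) + B)).
  by apply: ler_wpM2r => //; rewrite mulr_ge0// addr_ge0// mulr_ge0// addr_ge0.
have b5 : 0 <= B * B * e1 * `|Dl| by rewrite !mulr_ge0.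
have := ler_normB ((S - D) * (I' * I) + D * (I * (I' - I))) (I * I * E).
have := ler_normD ((S - D) * (I' * I)) (D * (I * (I' - I))).
by clear -b1 b2 b3 b4 b5; lra.
Qed.

(* A characteristic x |-> C(x, t) has slope - cot th, where th(x, t) = o t - G(x, t)
   and G is C^1 in t; since C(x0 + p, t) - C(x0, t) is C^1 in t and cot is strictly
   monotone, o is differentiable. *)
Lemma angle_label_derive (th G Gt C A nu : R -> R -> R) (o : R -> R) x0 t p q r :
  0 < p < q -> 0 < r ->
  (forall x s, `|x - x0| < q -> `|s - t| < r -> [/\ 0 < nu x s, sin (th x s) = nu x s,
     th x s = o s - G x s & is_derive x 1 (C^~ s) (- (cos (th x s) / nu x s))]) ->
  (forall x s, `|x - x0| < q -> `|s - t| < r ->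
     [/\ is_derive s 1 (G x) (Gt x s), is_derive s 1 (C x) (A x s), cont2 Gt x s,
      cont2 th x s & cont2 nu x s]) ->
  is_derive t 1 o ((A (x0 + p) t - A x0 t + prim x0 (fun x => Gt x t / nu x t ^+ 2) (x0 + p))
      / prim x0 (fun x => (nu x t ^+ 2)^-1) (x0 + p)).
Proof.
move=> /andP[p0 pq] r0 H1 H2.
have tt : `|t - t| < r by rewrite subrr normr0.
have pp : `|x0 + p - x0| = p by rewrite addrAC subrr add0r gtr0_norm.
have xpq : `|x0 + p - x0| < q by rewrite pp.
have x0q : `|x0 - x0| < q by rewrite subrr normr0 (lt_trans p0).
pose I x s := (nu x s)^-1.
have cI x s : `|x - x0| < q -> `|s - t| < r -> cont2 I x s.
  move=> xq sr; have [n0 _ _ _] := H1 _ _ xq sr; have [_ _ _ _ cn] := H2 _ _ xq sr.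
  by apply: cont2V => //; rewrite gt_eqF.
have cI1 x : `|x - x0| < q -> {for x, continuous (I^~ t)}.
  by move=> xq; exact: cont2_left (cI _ _ xq tt).
have cG1 x : `|x - x0| < q -> {for x, continuous (Gt^~ t)}.
  by move=> xq; have [_ _ c _ _] := H2 _ _ xq tt; exact: cont2_left c.
have cf1 x : `|x - x0| < q -> {for x, continuous (fun x => I x t * I x t)}.
  by move=> xq; apply: continuousM; exact: cI1.
have cf2 x : `|x - x0| < q -> {for x, continuous (fun x => Gt x t * (I x t * I x t))}.
  by move=> xq; apply: continuousM; [exact: cG1|exact: cf1].
have [B B0 HB] := @continuous_bound R (I^~ t) x0 p (ltW p0) (fun s sp => cI1 s (le_lt_trans sp pq)).
have [Bg Bg0 HBg] := @continuous_bound R (Gt^~ t) x0 p (ltW p0) (fun s sp => cG1 s (le_lt_trans sp pq)).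
set c := _ - _ + _; set M := prim _ _ _.
have ME : M = prim x0 (fun x => I x t * I x t) (x0 + p).
  by apply: eq_prim => s _; rewrite /I -invfM -expr2.
have cE : c = A (x0 + p) t - A x0 t + prim x0 (fun x => Gt x t * (I x t * I x t)) (x0 + p).
  by congr (_ + _); apply: eq_prim => s _; rewrite /I -invfM -expr2.
have M0 : 0 < M.
  have [s sI E] := @mean_value _ (prim x0 (fun x => I x t * I x t)) (fun x => I x t * I x t) x0 (x0 + p)
    (fun s sI => is_derive_prim cf1 (btw_box x0q xpq sI)).
  have [n0 _ _ _] := H1 s t (btw_box x0q xpq sI) tt.
  rewrite ME -[prim _ _ _]subr0 -[X in _ - X](primxx x0 (fun x => I x t * I x t)) E addrAC subrr add0r.
  by rewrite !mulr_gt0// invr_gt0.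
(* To first order, [M] times the increment of [o] equals [c * (s - t)]: this is the difference of
   the slopes of two characteristics, integrated over [[x0, x0 + p]]. *)
apply: is_derive_implicit; first by rewrite gt_eqF.
move=> e e0.
pose K := (B * (B + 1) + B) * (Bg + 1) + B * B.
have K0 : 0 <= K by rewrite /K addr_ge0 ?mulr_ge0 ?addr_ge0 ?mulr_ge0 ?addr_ge0.
(* Half of [e] is spent on the slopes over [[x0, x0 + p]], a quarter on [C] at each end. *)
have [e1 /andP[e10 e11] e1K] : exists2 e1, 0 < e1 <= 1 & e1 * K * p <= e / 2.
  exists (Num.min 1 (e / 2 / (K * p + 1))).
    by rewrite lt_min ge_min lexx ltr01 !divr_gt0// ltr_wpDl// mulr_ge0// ltW.
  have k1 : 0 < K * p + 1 by rewrite ltr_wpDl// mulr_ge0// ltW.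
  apply: (@le_trans _ _ (e / 2 / (K * p + 1) * (K * p))).
    by rewrite -mulrA ler_wpM2r ?mulr_ge0 ?(ltW p0)// ge_min lexx orbT.
  by rewrite mulrAC ler_pdivrMr// ler_wpM2l ?lerDl// ltW// divr_gt0.
have [ds ds0 Hs] := sin_near0 e10.
have tubeq f : (forall x, `|x - x0| < q -> cont2 f x t) -> forall d, 0 < d ->
    exists2 d', 0 < d' & forall s, `|s - t| < d' -> forall x, `|x - x0| <= p -> `|f x s - f x t| < d.
  by move=> cf d d0; apply: tube => // x xp; apply: cf; exact: le_lt_trans pq.
have [d1 d10 T1] := tubeq th (fun x xq => let: And5 _ _ _ c _ := H2 _ _ xq tt in c) _ ds0.
have [d2 d20 T2] := tubeq I (fun x xq => cI _ _ xq tt) _ e10.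
have [d3 d30 T3] := tubeq Gt (fun x xq => let: And5 _ _ c _ _ := H2 _ _ xq tt in c) _ e10.
have [_ dC0 _ _ _] := H2 _ _ x0q tt; have [_ dC1 _ _ _] := H2 _ _ xpq tt.
have [d4 d40 T4] := (is_deriveP _ _ _).1 dC0 (e / 4) ltac:(by rewrite divr_gt0).
have [d5 d50 T5] := (is_deriveP _ _ _).1 dC1 (e / 4) ltac:(by rewrite divr_gt0).
exists (Num.min (Num.min (Num.min d1 d2) (Num.min d3 d4)) (Num.min d5 r)).
  by rewrite !lt_min d10 d20 d30 d40 d50.
move=> s; rewrite !lt_min => /andP[/andP[/andP[s1 s2] /andP[s3 s4]] /andP[s5 s6]].
set Dl := o s - o t; set k := s - t.
(* The variation of [F] over [[x0, x0 + p]] is the error made when the slopes are linearized in the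
   increments [Dl] and [k]. *)
pose F x := C x s - C x t - (prim x0 (fun x => I x t * I x t) x * Dl
  - prim x0 (fun x => Gt x t * (I x t * I x t)) x * k).
pose dF x := - (cos (th x s) / nu x s) - - (cos (th x t) / nu x t) - (I x t * I x t * Dl - Gt x t * (I x t * I x t) * k).
have FB : `|F (x0 + p) - F x0| <= e1 * K * (`|Dl| + `|k|) * `|x0 + p - x0|.
  apply: (@mean_value_le _ F dF) => x xI; have xq := btw_box x0q xpq xI.
    have [_ _ _ D1] := H1 _ _ xq s6; have [_ _ _ D2] := H1 _ _ xq tt.
    have D3 := is_deriveMc Dl (is_derive_prim cf1 xq).
    have D4 := is_deriveMc k (is_derive_prim cf2 xq).
    exact: (is_deriveB (is_deriveB D1 D2) (is_deriveB D3 D4)).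
  have xp : `|x - x0| <= p by rewrite -pp; exact: btw_dist.
  have [n1 sn1 th1 _] := H1 _ _ xq s6; have [n2 sn2 th2 _] := H1 _ _ xq tt.
  rewrite /dF (quot_sub_sin sn1 sn2) ?gt_eqF// invfM -/(I x s) -/(I x t).
  have -> : I x t * I x t * Dl - Gt x t * (I x t * I x t) * k = I x t * I x t * (Dl - Gt x t * k) by ring.
  apply: (@quot_sub_sin_bound _ _ _ _ _ (th x s - th x t) (G x s - G x t - Gt x t * k)) => //.
  - by rewrite (ltW e10).
  - exact: HB.
  - by apply/ltW/T2.
  - by apply: Hs; exact: T1.
  - have := @mean_value_le _ (fun y => G x y - Gt x t * y) (fun y => Gt x y - Gt x t) e1 t s.
    rewrite [X in `|X|](_ : _ = G x s - G x t - Gt x t * k); last by rewrite /k; ring.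
    apply=> y yI.
      have yr : `|y - t| < r by exact: btw_box tt s6 yI.
      have [D _ _ _ _] := H2 _ _ xq yr; apply: is_deriveB => //.
      by exact: is_derive_lin.
    by apply/ltW/T3 => //; exact: le_lt_trans (btw_dist yI) s3.
  - exact: HBg.
  - by rewrite th1 th2 /Dl; ring.
have {}T4 := T4 _ s4; have {}T5 := T5 _ s5; rewrite -/k in T4 T5.
have FE : c * k - M * Dl = (F (x0 + p) - F x0) - (C (x0 + p) s - C (x0 + p) t - A (x0 + p) t * k)
   + (C x0 s - C x0 t - A x0 t * k).
  by rewrite cE ME /F !primxx; ring.
rewrite pp in FB.
have h1 : e1 * K * (`|Dl| + `|k|) * p <= e / 2 * (`|Dl| + `|k|).
  by rewrite mulrAC ler_wpM2r// addr_ge0.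
have h2 : 0 <= e * `|Dl| by rewrite mulr_ge0// ltW.
rewrite FE; set u := F _ - F _ in FB *; set v := _ - _ * k in T5 *; set w := _ - _ * k in T4 *.
have := ler_normD (u - v) w; have := ler_normB u v.
by clear -h1 h2 FB T4 T5; lra.
Qed.

End Angle.

(** * From the characteristics to a C^1 angle *)

Section Regularity.
Context {R : realType}.
Implicit Types (f g h w : R -> R -> R) (a b x y r s t e d z l p L M : R).

(** [W] and [Y] are potentials for [n] and [H n] in the gauge where the [y]-derivative carries no
    correction. The corrections [ht] and [kt] are then differentiable in [y], the direction in which
    characteristics are displaced. *)
Lemma angle_C1_of_chars n1 n2 H K W ht Y kt C A x0 y0 t0 r r1 :
  (forall x y, box x0 y0 r x y ->
    [/\ cont2 n1 x y, cont2 n2 x y, 0 < n2 x y & n1 x y ^+ 2 + n2 x y ^+ 2 = 1]) ->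
  C1box x0 y0 r W (fun x y => n2 x y - ht x y) (fun x y => - n1 x y) ->
  (forall x y, box x0 y0 r x y -> is_derive y 1 (ht x) (H x y)) ->
  cont_on x0 y0 r H ->
  C1box x0 y0 r Y (fun x y => H x y * n2 x y - kt x y) (fun x y => - (H x y * n1 x y)) ->
  (forall x y, box x0 y0 r x y -> is_derive y 1 (kt x) (K x y)) ->
  (forall x y, box x0 y0 r x y -> cont2 kt x y /\ cont2 K x y) ->
  0 < r1 -> C x0 t0 = y0 ->
  (forall x t, box x0 t0 r1 x t -> box x0 y0 r x (C x t)) ->
  C1box x0 t0 r1 C (fun x t => - (n1 x (C x t) / n2 x (C x t))) A ->
  (forall x t, box x0 t0 r1 x t -> 0 < A x t) ->
  exists r2, exists th thx thy, [/\ 0 < r2, C1box x0 y0 r2 th thx thy &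
    forall x y, box x0 y0 r2 x y -> n1 x y = cos (th x y) /\ n2 x y = sin (th x y)].
Proof.
move=> Hn HW Hht cH HY Hkt ckK r10 C0 Cb HC A0.
pose th x t := acos (n1 x (C x t)); pose nu x t := n2 x (C x t).
have cC f : cont_on x0 y0 r f ->
    forall x t, box x0 t0 r1 x t -> cont2 (fun x t => f x (C x t)) x t.
  move=> cf x t bt; apply: (@cont2_comp _ f (fun x _ => x) C).
  - by apply: cf; exact: Cb.
  - exact: cont2_fst.
  - exact: C1box_cont2 HC bt.
have cnu x t : box x0 t0 r1 x t -> cont2 nu x t.
  by apply: (cC n2) => u v /Hn[].
have nu0 x t : box x0 t0 r1 x t -> 0 < nu x t by move=> /Cb/Hn[].
have thE x t : box x0 t0 r1 x t -> [/\ -1 < n1 x (C x t) < 1, cos (th x t) = n1 x (C x t) & sin (th x t) = nu x t].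
  by move=> /Cb/Hn[_ _ h1 h2]; have := acos_unit h1 h2.
have cth x t : box x0 t0 r1 x t -> cont2 th x t.
  move=> bt; apply: (@cont2_fun1 _ acos (fun x t => n1 x (C x t))).
    by apply: continuous_acos; have [] := thE _ _ bt.
  by apply: (cC n1) => // u v /Hn[].
have dth x t : box x0 t0 r1 x t -> is_derive x 1 (th^~ t) (- (H x (C x t) / nu x t)).
  move=> bt; have [xr tr] := bt.
  have D : is_derive x 1 (fun s => n1 s (C s t)) (H x (C x t)).
    apply: (@normal_along_char _ n1 n2 H W ht x0 y0 r (C^~ t) x (r1 - `|x - x0|)) => //.
    - by move=> u v /Hn[].
    - by rewrite subr_gt0.
    - move=> s sx; have bs : box x0 t0 r1 s t.
        by split => //; rewrite (le_lt_trans (ler_distD x s x0))// -ltrBrDr.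
      by split; [exact: Cb|have [] := HC _ _ bs].
  have [n1b _ sE] := thE _ _ bt.
  have := is_derive_compR D (is_derive1_acos n1b).
  have [_ _ h1 h2] := Hn _ _ (Cb _ _ bt).
  by rewrite -h2 addrAC subrr add0r sqrtr_sqr gtr0_norm// mulNr mulrC.
pose kh x t := kt x (C x t); pose khd x t := K x (C x t) * A x t.
have ckh x t : box x0 t0 r1 x t -> cont2 kh x t.
  by apply: (cC kt) => u v /ckK[].
have ckhd x t : box x0 t0 r1 x t -> cont2 khd x t.
  move=> bt; apply: cont2M; last by have [] := HC _ _ bt.
  by apply: (cC K) => // u v /ckK[].
have dkh x t : box x0 t0 r1 x t -> is_derive t 1 (kh x) (khd x t).
  move=> bt; have [_ D _ _] := HC _ _ bt.
  by apply: (@is_derive_compR _ (kt x) (C x)) => //; apply: Hkt; exact: Cb.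
(* Along a characteristic [Y] has derivative [H / n2 - kt]; adding the primitive of [kt] leaves
   [H / n2], the opposite of the derivative of [th]. *)
have HG := C1boxD (C1box_comp (@C1box_fst R x0 t0 r1) HC Cb HY) (C1box_prim ckh dkh ckhd).
set G := (fun x t => Y x (C x t) + _) in HG.
pose Gt x t := - (H x (C x t) * n1 x (C x t)) * A x t + prim x0 (khd^~ t) x.
have {}HG : C1box x0 t0 r1 G (fun x t => H x (C x t) / nu x t) Gt.
  move: HG; apply: eq_C1box => x t bt; split; last by rewrite /Gt mulr0 add0r.
  have [_ _ h1 h2] := Hn _ _ (Cb _ _ bt).
  rewrite mulr1 -/(kh x t) /nu.
  have -> : H x (C x t) * n2 x (C x t) - kh x t + - (H x (C x t) * n1 x (C x t)) *
     - (n1 x (C x t) / n2 x (C x t)) + kh x t = H x (C x t) * (n1 x (C x t) ^+ 2 + n2 x (C x t) ^+ 2) / n2 x (C x t).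
    by field; rewrite gt_eqF.
  by rewrite h2 mulr1.
pose o t := th x0 t + G x0 t.
have thG x t : box x0 t0 r1 x t -> th x t = o t - G x t.
  move=> [xr tr]; suff : th x t + G x t = o t by move=> <-; ring.
  apply: (@derive0_eq _ (fun x => th x t + G x t)) => s sI.
  have bs : box x0 t0 r1 s t by split => //; exact: le_lt_trans (btw_dist sI) xr.
  have [dG _ _ _] := HG _ _ bs.
  by have := is_deriveD (dth _ _ bs) dG; rewrite addNr.
pose p := r1 / 2.
have p0 : 0 < p < r1 by rewrite /p; apply/andP; split; lra.
pose od t := (A (x0 + p) t - A x0 t + prim x0 (fun x => Gt x t / nu x t ^+ 2) (x0 + p))
      / prim x0 (fun x => (nu x t ^+ 2)^-1) (x0 + p).
have d_o t : `|t - t0| < r1 -> is_derive t 1 o (od t).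
  move=> tr; pose r2 := r1 - `|t - t0|.
  have bx x s : `|x - x0| < r1 -> `|s - t| < r2 -> box x0 t0 r1 x s.
    by move=> xr sr; split => //; rewrite (le_lt_trans (ler_distD t s t0))// -ltrBrDr.
  apply: (@angle_label_derive _ th G Gt C A nu o x0 t p r1 r2) => //.
  - by rewrite subr_gt0.
  - move=> x s xr sr; have b := bx _ _ xr sr; have [_ cE sE] := thE _ _ b; split => //.
    + exact: nu0.
    + exact: thG.
    + by rewrite cE; have [] := HC _ _ b.
  - move=> x s xr sr; have b := bx _ _ xr sr.
    have [_ ? _ ?] := HG _ _ b; have [_ ? _ ?] := HC _ _ b.
    by split => //; [exact: cth|exact: cnu].
have cI x t : box x0 t0 r1 x t -> cont2 (fun x t => (nu x t ^+ 2)^-1) x t.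
  move=> bt; apply: cont2V; first by rewrite expf_neq0// gt_eqF// nu0.
  by rewrite (_ : (fun x t => nu x t ^+ 2) = (fun x t => nu x t * nu x t))//; apply: cont2M; exact: cnu.
(* [od] depends on [t] alone but is viewed on the box, to serve as a partial derivative in a
   [C1box]. Its denominator is the integral of a positive function. *)
have cod x t : box x0 t0 r1 x t -> cont2 (fun _ t => od t) x t.
  move=> [xr tr]; apply: (@cont2_fun1 _ od (fun _ t => t)); last exact: cont2_snd.
  have x0r : `|x0 - x0| < r1 by rewrite subrr normr0.
  have xpr : `|x0 + p - x0| < r1.
    by rewrite addrAC subrr add0r gtr0_norm; case/andP: p0.
  have cA x' : `|x' - x0| < r1 -> {for t, continuous (A x')}.
    by move=> xr'; have [|_ _ _] := HC x' t; [split|exact: cont2_right].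
  have bp : box x0 t0 r1 (x0 + p) t by [].
  apply: (@continuousM _ _ (fun t => A (x0 + p) t - A x0 t + prim x0 (fun x => Gt x t / nu x t ^+ 2) (x0 + p))
     (fun t => (prim x0 (fun x => (nu x t ^+ 2)^-1) (x0 + p))^-1)).
    apply: continuousD; first by apply: continuousB; exact: cA.
    apply: (cont2_right (f := fun x t => prim x0 (fun x => Gt x t / nu x t ^+ 2) x)).
    apply: (@cont2_prim _ (fun x t => Gt x t / nu x t ^+ 2)) bp => x' t' b.
    by apply: cont2M; [have [] := HG _ _ b|exact: cI].
  apply: continuousV; last first.
    apply: (cont2_right (f := fun x t => prim x0 (fun x => (nu x t ^+ 2)^-1) x)).
    exact: cont2_prim cI bp.
  have cI1 x' : `|x' - x0| < r1 -> {for x', continuous (fun x => (nu x t ^+ 2)^-1)}.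
    by move=> xr'; apply: (cont2_left (f := fun x t => (nu x t ^+ 2)^-1)); exact: cI.
  have [s sI E] := @mean_value _ (prim x0 (fun x => (nu x t ^+ 2)^-1)) (fun x => (nu x t ^+ 2)^-1) x0 (x0 + p)
    (fun s sI => is_derive_prim cI1 (btw_box x0r xpr sI)).
  rewrite -[prim _ _ _]subr0 -[X in _ - X](primxx x0 (fun x => (nu x t ^+ 2)^-1)) E addrAC subrr add0r.
  rewrite gt_eqF// mulr_gt0//; last by case/andP: p0.
  by rewrite invr_gt0 exprn_gt0// nu0//; split => //; exact: btw_box x0r xpr sI.
have Hth : C1box x0 t0 r1 th (fun x t => - (H x (C x t) / nu x t)) (fun x t => od t - Gt x t).
  move=> x t bt; have [dGx dGt cGx cGt] := HG _ _ bt; have [xr tr] := bt; split.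
  - exact: dth.
  - have [d d0 Hd] := box_open bt.
    apply: (@is_derive_locally _ (fun t => o t - G x t) _ _ _ d) => //.
      by move=> s sd; rewrite thG//; apply: Hd; split => //; rewrite subrr normr0.
    by apply: is_deriveB => //; exact: d_o.
  - exact: cont2N.
  - by apply: cont2B => //; exact: cod.
(* As [A > 0], the label can be solved for, which carries [th] back to the variables [(x, y)]. *)
have [r2 [k [/andP[r20 r2r] kP kK]]] := implicit_function r10 HC A0.
rewrite C0 in kP kK *; move=> Hk.
have kb x y : box x0 y0 r2 x y -> box x0 t0 r1 x (k x y) by move=> /kP[].
exists r2, (fun x y => th x (k x y)); eexists; eexists; split => //.
  exact: (C1box_comp (@C1box_fst R x0 y0 r2) Hk kb Hth).
move=> x y bxy; have [bk Ck] := kP _ _ bxy; have [_ -> ->] := thE _ _ bk.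
by rewrite /nu Ck.
Qed.

End Regularity.

(** * Reduction to a field with positive second component *)

Section LocalRegularity.
Context {R : realType}.
Implicit Types (f g h w : R -> R -> R) (a b x y r s t e d z l p L M : R).

(* The speed [lam] is arbitrary, so that reversing [n] or exchanging the axes
   preserves the notion. *)
Definition derivative_along_field n1 n2 H k x0 y0 r :=
  forall (c1 c2 lam : R -> R) t p, 0 < p ->
    (forall s, `|s - t| < p -> [/\ box x0 y0 r (c1 s) (c2 s), lam s != 0,
       {for s, continuous lam}, is_derive s 1 c1 (lam s * n1 (c1 s) (c2 s)) &
       is_derive s 1 c2 (lam s * n2 (c1 s) (c2 s))]) ->
    is_derive t 1 (fun s => H (c1 s) (c2 s)) (lam t * k (c1 t) (c2 t)).

(* [ld_V] encodes div n = H through a potential of the rotated field. *)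
Record local_data n1 n2 D H k u F1 F1x F1y F2 F2x F2y x0 y0 r := LocalData {
  ld_r : 0 < r;
  ld_cont : forall x y, box x0 y0 r x y -> [/\ cont2 n1 x y, cont2 n2 x y, cont2 H x y & cont2 k x y];
  ld_unit : forall x y, box x0 y0 r x y -> n1 x y ^+ 2 + n2 x y ^+ 2 = 1;
  ld_D : forall x y, box x0 y0 r x y -> 0 < D x y;
  ld_along : derivative_along_field n1 n2 H k x0 y0 r;
  ld_u : C1box x0 y0 r u (fun x y => D x y * n1 x y - F1 x y) (fun x y => D x y * n2 x y - F2 x y);
  ld_F1 : C1box x0 y0 r F1 F1x F1y;
  ld_F2 : C1box x0 y0 r F2 F2x F2y;
  ld_V : exists V hh, [/\ C1box x0 y0 r V n2 (fun x y => hh x y - n1 x y),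
    forall x y, box x0 y0 r x y -> is_derive x 1 (hh^~ y) (H x y) &
    forall x y, box x0 y0 r x y -> cont2 hh x y] }.

(** The second clause gives a characteristic through the center, as [derivative_along] asks for one.
    [lam] allows for the parameter [x] or [y] in place of arc length, and for the orientation, which
    the exchange of axes reverses. *)
Definition regular_at n1 n2 x0 y0 r :=
  (exists r' n1x n1y n2x n2y, [/\ 0 < r', C1box x0 y0 r' n1 n1x n1y & C1box x0 y0 r' n2 n2x n2y]) /\
  exists (c1 c2 lam : R -> R) t p, [/\ 0 < p, c1 t = x0, c2 t = y0 &
    forall s, `|s - t| < p -> [/\ box x0 y0 r (c1 s) (c2 s), lam s != 0,
       {for s, continuous lam}, is_derive s 1 c1 (lam s * n2 (c1 s) (c2 s)) &
       is_derive s 1 c2 (- (lam s * n1 (c1 s) (c2 s)))]].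

Lemma box_swap x0 y0 r x y : box x0 y0 r x y -> box y0 x0 r y x.
Proof. by case. Qed.

Lemma local_data_le n1 n2 D H k u F1 F1x F1y F2 F2x F2y x0 y0 r r' :
  0 < r' <= r -> local_data n1 n2 D H k u F1 F1x F1y F2 F2x F2y x0 y0 r ->
  local_data n1 n2 D H k u F1 F1x F1y F2 F2x F2y x0 y0 r'.
Proof.
move=> /andP[r'0 rr] [] r0 h1 h2 h3 h4 h5 h6 h7 [V [hh [h8 h9 h10]]].
have B x y : box x0 y0 r' x y -> box x0 y0 r x y by exact: box_le.
split => //.
- by move=> x y /B/h1.
- by move=> x y /B/h2.
- by move=> x y /B/h3.
- by move=> c1 c2 lam t p p0 Hc; apply: (h4 _ _ _ _ p) => // s /Hc[/B].
- exact: C1box_le rr h5.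
- exact: C1box_le rr h6.
- exact: C1box_le rr h7.
- exists V, hh; split; first exact: C1box_le rr h8.
    by move=> x y /B; exact: h9.
  by move=> x y /B; exact: h10.
Qed.

(** [k] keeps its sign: N(H) changes sign with [n] and again with [H]. *)
Lemma local_data_neg n1 n2 D H k u F1 F1x F1y F2 F2x F2y x0 y0 r :
  local_data n1 n2 D H k u F1 F1x F1y F2 F2x F2y x0 y0 r ->
  local_data (fun x y => - n1 x y) (fun x y => - n2 x y) D (fun x y => - H x y) k
    (fun x y => - u x y) (fun x y => - F1 x y) (fun x y => - F1x x y) (fun x y => - F1y x y)
    (fun x y => - F2 x y) (fun x y => - F2x x y) (fun x y => - F2y x y) x0 y0 r.
Proof.
move=> [] r0 h1 h2 h3 h4 h5 h6 h7 [V [hh [h8 h9 h10]]]; split => //.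
- by move=> x y /h1[? ? ? ?]; split => //; exact: cont2N.
- by move=> x y /h2; rewrite !sqrrN.
- move=> c1 c2 lam t p p0 Hc.
  have : is_derive t 1 (fun s => H (c1 s) (c2 s)) (- lam t * k (c1 t) (c2 t)).
    apply: (h4 c1 c2 (fun s => - lam s) t p) => // s /Hc[b l0 cl d1 d2]; split => //.
    + by rewrite oppr_eq0.
    + exact: continuousN.
    + by rewrite mulNr -mulrN.
    + by rewrite mulNr -mulrN.
  by move=> /is_deriveN; rewrite mulNr opprK.
- by have := C1boxN h5; apply: eq_C1box => x y _; split; ring.
- exact: C1boxN.
- exact: C1boxN.
- exists (fun x y => - V x y), (fun x y => - hh x y); split.
  + by have := C1boxN h8; apply: eq_C1box => x y _; split => //; ring.
  + by move=> x y /h9 ?; exact: is_deriveN.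
  + by move=> x y /h10 ?; exact: cont2N.
Qed.

(** The potential is the delicate item: its correction has to become a primitive of [H] in the other
    variable, hence [change_gauge]. *)
Lemma local_data_swap n1 n2 D H k u F1 F1x F1y F2 F2x F2y x0 y0 r :
  local_data n1 n2 D H k u F1 F1x F1y F2 F2x F2y x0 y0 r ->
  local_data (fun y x => n2 x y) (fun y x => n1 x y) (fun y x => D x y) (fun y x => H x y)
    (fun y x => k x y) (fun y x => u x y) (fun y x => F2 x y) (fun y x => F2y x y) (fun y x => F2x x y)
    (fun y x => F1 x y) (fun y x => F1y x y) (fun y x => F1x x y) y0 x0 r.
Proof.
move=> [] r0 h1 h2 h3 h4 h5 h6 h7 [V [hh [h8 h9 h10]]]; split => //.
- by move=> y x /box_swap/h1[? ? ? ?]; split; exact: cont2_swap.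
- by move=> y x /box_swap/h2; rewrite addrC.
- by move=> y x /box_swap/h3.
- move=> c1 c2 lam t p p0 Hc; apply: (h4 c2 c1 lam t p) => // s /Hc[/box_swap b l0 cl d1 d2].
  by split.
- exact: C1box_swap.
- exact: C1box_swap.
- exact: C1box_swap.
- have cH y x : box y0 x0 r y x -> cont2 (fun y x => H x y) y x.
    by move=> /box_swap/h1[_ _ ? _]; exact: cont2_swap.
  have chh y x : box y0 x0 r y x -> cont2 (fun y x => hh x y) y x.
    by move=> /box_swap/h10; exact: cont2_swap.
  have dhh y x : box y0 x0 r y x -> is_derive x 1 (hh^~ y) (H x y) by move=> /box_swap/h9.
  have HW := @change_gauge R y0 x0 r (fun y x => V x y) _ _
     (fun y x => n1 x y) (fun y x => hh x y) (fun y x => H x y) (C1box_swap h8)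
     (fun _ _ _ => erefl) chh dhh cH.
  eexists; exists (fun y x => prim y0 (fun y' => H x y') y); split.
  + by have := C1boxN HW; apply: eq_C1box => y x _; rewrite opprK opprB.
  + move=> y x [yr xr]; apply: (@is_derive_prim _ (fun y' => H x y') _ r) => // s sr.
    by apply: (cont2_left (f := fun y x => H x y)); exact: cH.
  + by move=> y x; exact: (cont2_prim cH).
Qed.

(* [u] corrected by a primitive of [F2] has the same characteristics, and its
   derivative along them is differentiable transversally. *)
Lemma gradient_potential n1 n2 D u F1 F1x F1y F2 F2x F2y x0 y0 r :
  C1box x0 y0 r u (fun x y => D x y * n1 x y - F1 x y) (fun x y => D x y * n2 x y - F2 x y) ->
  C1box x0 y0 r F1 F1x F1y -> C1box x0 y0 r F2 F2x F2y ->
  exists U beta, [/\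
    C1box x0 y0 r U (fun x y => beta x y + D x y * n1 x y) (fun x y => D x y * n2 x y),
    cont_on x0 y0 r beta,
    forall x y, box x0 y0 r x y -> is_derive y 1 (beta x) (F2x x y - F1y x y) &
    forall x y, box x0 y0 r x y -> cont2 (fun x y => F2x x y - F1y x y) x y].
Proof.
move=> Hu HF1 HF2.
have cF2x y x : box y0 x0 r y x -> cont2 (fun y x => F2x x y) y x.
  by move=> /box_swap/HF2[_ _ ? _]; exact: cont2_swap.
have cF2 y x : box y0 x0 r y x -> cont2 (fun y x => F2 x y) y x.
  by move=> /box_swap/(C1box_cont2 HF2); exact: cont2_swap.
have dF2 y x : box y0 x0 r y x -> is_derive x 1 (F2^~ y) (F2x x y) by move=> /box_swap/HF2[].
have HP := C1box_swap (@C1box_prim R (fun y x => F2 x y) (fun y x => F2x x y) y0 x0 r cF2 dF2 cF2x).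
pose beta x y := prim y0 (fun y' => F2x x y') y - F1 x y.
exists (fun x y => u x y + prim y0 (fun y => F2 x y) y), beta; split.
- have := C1boxD Hu HP; apply: eq_C1box => x y _; rewrite /beta; split; ring.
- move=> x y b; apply: cont2B; last exact: C1box_cont2 HF1 b.
  by have [] := HP _ _ b.
- move=> x y b; apply: is_deriveB; last by have [] := HF1 _ _ b.
  have [xr yr] := b.
  apply: (@is_derive_prim _ (fun y' => F2x x y') _ r) => // s sr.
  by apply: (cont2_left (f := fun y x => F2x x y)); exact: cF2x.
- by move=> x y b; have [_ _ ? _] := HF2 _ _ b; have [_ _ _ ?] := HF1 _ _ b; exact: cont2B.
Qed.

Lemma regular_of_pos n1 n2 D H k u F1 F1x F1y F2 F2x F2y x0 y0 r :
  local_data n1 n2 D H k u F1 F1x F1y F2 F2x F2y x0 y0 r ->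
  (forall x y, box x0 y0 r x y -> 0 < n2 x y) -> regular_at n1 n2 x0 y0 r.
Proof.
move=> [] r0 h1 h2 h3 h4 h5 h6 h7 [V [hh [h8 h9 h10]]] n2p.
have c1 x y : box x0 y0 r x y -> cont2 n1 x y by move=> /h1[].
have c2 x y : box x0 y0 r x y -> cont2 n2 x y by move=> /h1[].
have cH x y : box x0 y0 r x y -> cont2 H x y by move=> /h1[].
have ck x y : box x0 y0 r x y -> cont2 k x y by move=> /h1[].
have sw f : cont_on x0 y0 r f ->
    forall y x, box y0 x0 r y x -> cont2 (fun y x => f x y) y x.
  by move=> cf y x /box_swap/cf; exact: cont2_swap.
have n2N x y : box x0 y0 r x y -> n2 x y != 0 by move=> /n2p ?; rewrite gt_eqF.
(* This is div (H n) by the product rule, as [k] is N(H) and div n = H. *)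
pose K x y := k x y + H x y * H x y.
have cK x y : box x0 y0 r x y -> cont2 K x y.
  by move=> b; apply: cont2D; [exact: ck|apply: cont2M; exact: cH].
(* As [n2 > 0], seed curves are graphs over the [y]-axis with dx/dy = n1 / n2, hence the exchanged
   variables; in the parameter [y] the derivative of [H] is [k / n2]. *)
have [r1 [Y0 [Q [/andP[r10 r1r] HY0 cQ dQ]]]] : exists r', exists Y Q : R -> R -> R,
    [/\ 0 < r' <= r,
     C1box y0 x0 r' Y (fun y x => Q y x - H x y * (n2 x y * (n1 x y / n2 x y))) (fun y x => H x y * n2 x y),
     cont_on y0 x0 r' Q &
     forall y x, box y0 x0 r' y x -> is_derive x 1 (Q y) (k x y / n2 x y * n2 x y + H x y * H x y)].
  apply: (@transport_potential R y0 x0 r (fun y x => V x y) (fun y x => hh x y - n1 x y)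
    (fun y x => n2 x y) (fun y x => n1 x y / n2 x y) (fun y x => hh x y) (fun y x => H x y) _ _ _ _ _ _ _
    (fun y x => H x y) (fun y x => k x y / n2 x y)) => //.
  - exact: C1box_swap h8.
  - by move=> y x /box_swap/n2p.
  - by move=> y x /box_swap/n2N ?; field.
  - exact: (sw hh).
  - by move=> y x /box_swap/h9.
  - exact: (sw H).
  - exact: (sw H).
  - apply: (sw (fun x y => k x y / n2 x y)) => x y b.
    by apply: cont2M; [exact: ck|apply: cont2V; [exact: n2N|exact: c2]].
  - move=> v y p p0 Hv.
    have := h4 v id (fun s => (n2 (v s) s)^-1) y p p0.
    rewrite mulrC; apply => s sp; have [/box_swap b dv] := Hv s sp; split => //=.
    + by rewrite invr_neq0// n2N.
    + apply: continuousV; first exact: n2N.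
      by apply: (@cont1_comp2 _ n2 v id) => //; [exact: c2|exact: is_derive_cont dv].
    + by rewrite mulrC.
    + by rewrite mulVf ?n2N//; exact: is_derive_id.
have rr : r1 <= r by [].
have B x y : box x0 y0 r1 x y -> box x0 y0 r x y by exact: box_le.
have B' y x : box y0 x0 r1 y x -> box x0 y0 r x y by move=> /box_swap/B.
pose kt x y := prim y0 (fun y' => K x y') y.
pose ht x y := prim y0 (fun y' => H x y') y.
have dprim f : cont_on x0 y0 r f -> forall x y, box x0 y0 r x y ->
    is_derive y 1 (fun y => prim y0 (fun y' => f x y') y) (f x y).
  move=> cf x y [xr yr]; apply: (@is_derive_prim _ (fun y' => f x y') _ r) => // s sr.
  by apply: (cont2_left (f := fun y x => f x y)); exact: (sw f).
have dhh y x : box y0 x0 r y x -> is_derive x 1 (hh^~ y) (H x y) by move=> /box_swap/h9.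
(* The gauge of [V] suits seed curves; characteristics call for a [y]-derivative equal to [- n1]
   without correction. *)
have HW := C1box_swap (@change_gauge R y0 x0 r (fun y x => V x y) _ _ (fun y x => n1 x y)
  (fun y x => hh x y) (fun y x => H x y) (C1box_swap h8)
  (fun _ _ _ => erefl) (sw hh h10) dhh (sw H cH)).
have {}dQ y x : box y0 x0 r1 y x -> is_derive x 1 (Q y) (K x y).
  by move=> b; have := dQ _ _ b; rewrite mulfVK ?n2N//; exact: B'.
have {}HY0 : C1box y0 x0 r1 Y0 (fun y x => Q y x - H x y * n1 x y) (fun y x => H x y * n2 x y).
  by move: HY0; apply: eq_C1box => y x /B'/n2N n0; split => //; field.
have cK1 y x : box y0 x0 r1 y x -> cont2 (fun y x => K x y) y x.
  by move=> /(box_le rr)/(sw K cK).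
have HY := C1box_swap (@change_gauge R y0 x0 r1 Y0 _ _ (fun y x => H x y * n1 x y) Q (fun y x => K x y) HY0
  (fun _ _ _ => erefl) cQ dQ cK1).
have [U [beta [HU cb db cg]]] := gradient_potential h5 h6 h7.
have ld1 x y : box x0 y0 r1 x y -> 0 < D x y * n2 x y by move=> /B b; rewrite mulr_gt0 ?h3 ?n2p.
have waE x y : box x0 y0 r1 x y ->
    beta x y + D x y * n1 x y = beta x y - D x y * n2 x y * - (n1 x y / n2 x y).
  by move=> /B/n2N ?; field.
have cb1 x y : box x0 y0 r1 x y -> cont2 beta x y by move=> /B/cb.
have db1 x y : box x0 y0 r1 x y -> is_derive y 1 (beta x) (F2x x y - F1y x y) by move=> /B/db.
have cg1 x y : box x0 y0 r1 x y -> cont2 (fun x y => F2x x y - F1y x y) x y by move=> /B/cg.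
have [r2 [t0 [C [e [/andP[r20 r2r] C0 Cb HC He]]]]] :=
  @flow R x0 y0 r1 U _ _ _ beta _ r10 (C1box_le rr HU) ld1 waE cb1 db1 cg1.
have t0r : `|t0 - t0| < r2 by rewrite subrr normr0.
split.
  have hn x y : box x0 y0 r1 x y ->
      [/\ cont2 n1 x y, cont2 n2 x y, 0 < n2 x y & n1 x y ^+ 2 + n2 x y ^+ 2 = 1].
    by move=> /B b; split; [exact: c1|exact: c2|exact: n2p|exact: h2].
  have dht x y : box x0 y0 r1 x y -> is_derive y 1 (ht x) (H x y) by move=> /B/(dprim H cH).
  have dkt x y : box x0 y0 r1 x y -> is_derive y 1 (kt x) (K x y) by move=> /B/(dprim K cK).
  have cH1 x y : box x0 y0 r1 x y -> cont2 H x y by move=> /B/cH.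
  have ckt x y : box x0 y0 r1 x y -> cont2 kt x y /\ cont2 K x y.
    move=> /B b; split; last exact: cK.
    apply: (@cont2_swap _ (fun y x => prim y0 (fun y' => K x y') y)).
    exact: (cont2_prim (sw K cK) (box_swap b)).
  have A0 x t : box x0 t0 r2 x t -> 0 < e x t / (D x (C x t) * n2 x (C x t)).
    by move=> b; have [e0 _ _] := He _ _ b; rewrite divr_gt0// ld1//; exact: Cb.
  have [r3 [th [thx [thy [r30 Hth thE]]]]] := @angle_C1_of_chars R n1 n2 H K _ ht _ kt C _ x0 y0 t0 r1 r2
    hn (C1box_le rr HW) dht cH1 HY dkt ckt r20 C0 Cb HC A0.
  have Hc := C1box_comp1 Hth (fun x y _ => is_derive_cos (th x y)) (fun x y _ => continuousN (@continuous_sin R (th x y))).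
  have Hs := C1box_comp1 Hth (fun x y _ => is_derive_sin (th x y)) (fun x y _ => @continuous_cos R (th x y)).
  exists r3; do 4 eexists; split => //.
  - by apply: C1box_eq Hc => x y /thE[].
  - by apply: C1box_eq Hs => x y /thE[].
(* In the parameter [x] the direction [(1, - n1 / n2)] is N^perp at speed [1 / n2]. *)
exists id, (C^~ t0), (fun s => (n2 s (C s t0))^-1), x0, r2; split => //.
move=> s sr; have b : box x0 t0 r2 s t0 by split.
have bC := B _ _ (Cb _ _ b); have [dC _ _ _] := HC _ _ b; split => //=.
- by rewrite invr_neq0// n2N.
- apply: continuousV; first exact: n2N.
  by apply: (@cont1_comp2 _ n2 id (C^~ t0)) => //; [exact: c2|exact: is_derive_cont dC].
- by rewrite mulVf ?n2N//; exact: is_derive_id.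
- by rewrite mulrC.
Qed.

Lemma regular_neg n1 n2 x0 y0 r :
  regular_at (fun x y => - n1 x y) (fun x y => - n2 x y) x0 y0 r -> regular_at n1 n2 x0 y0 r.
Proof.
have NN f : (fun x y => - - f x y) = f by apply/funext => x; apply/funext => y; rewrite opprK.
move=> [[r' [n1x [n1y [n2x [n2y [r'0 H1 H2]]]]]] [c1 [c2 [lam [t [p [p0 ? ? H]]]]]]]; split.
  exists r'; do 4 eexists; split => //.
    by have := C1boxN H1; rewrite NN; exact.
  by have := C1boxN H2; rewrite NN; exact.
exists c1, c2, (fun s => - lam s), t, p; split => // s /H[b l0 cl d1 d2]; split => //.
- by rewrite oppr_eq0.
- exact: continuousN.
- by rewrite mulNr -mulrN.
- by move: d2; rewrite mulrN mulNr.
Qed.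

Lemma regular_swap n1 n2 x0 y0 r :
  regular_at (fun y x => n2 x y) (fun y x => n1 x y) y0 x0 r -> regular_at n1 n2 x0 y0 r.
Proof.
move=> [[r' [n1x [n1y [n2x [n2y [r'0 H1 H2]]]]]] [c1 [c2 [lam [t [p [p0 ? ? H]]]]]]]; split.
  exists r'; do 4 eexists; split => //; first exact: C1box_swap H2.
  exact: C1box_swap H1.
exists c2, c1, (fun s => - lam s), t, p; split => // s /H[/box_swap b l0 cl d1 d2]; split => //.
- by rewrite oppr_eq0.
- exact: continuousN.
- by rewrite mulNr.
- by rewrite mulNr opprK.
Qed.

Lemma regular_at_le n1 n2 x0 y0 r r' : r' <= r -> regular_at n1 n2 x0 y0 r' -> regular_at n1 n2 x0 y0 r.
Proof.
move=> rr [h [c1 [c2 [lam [t [p [p0 ? ? H]]]]]]]; split => //.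
by exists c1, c2, lam, t, p; split => // s /H[/(box_le rr)].
Qed.

(** A unit vector has a nonzero component; an exchange of axes and a change of sign make it the
    second one, positive at the center and hence on a smaller square. *)
Lemma local_regularity n1 n2 D H k u F1 F1x F1y F2 F2x F2y x0 y0 r :
  local_data n1 n2 D H k u F1 F1x F1y F2 F2x F2y x0 y0 r -> regular_at n1 n2 x0 y0 r.
Proof.
have pos m1 m2 D' H' k' u' G1 G1x G1y G2 G2x G2y a b :
    local_data m1 m2 D' H' k' u' G1 G1x G1y G2 G2x G2y a b r -> 0 < m2 a b -> regular_at m1 m2 a b r.
  move=> ld m20; have [r0 hc _ _ _ _ _ _ _] := ld.
  have [_ /cont2P/(_ _ m20)[d d0 Hd] _ _] := hc _ _ (box_center a b r0).
  pose r' := Num.min d r.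
  have r'0 : 0 < r' <= r by rewrite lt_min d0 r0 ge_min lexx orbT.
  have rd : r' <= d by rewrite ge_min lexx.
  apply: (regular_at_le (proj2 (andP r'0))).
  apply: regular_of_pos (local_data_le r'0 ld) _ => x y [xa yb].
  have := Hd x y (lt_le_trans xa rd) (lt_le_trans yb rd).
  by rewrite ltr_norml => /andP[h _]; clear -h; lra.
move=> ld; have [r0 _ hu _ _ _ _ _ _] := ld; have un := hu _ _ (box_center x0 y0 r0).
have [n20|n20|n20] := ltgtP (n2 x0 y0) 0.
- by apply: regular_neg; apply: pos (local_data_neg ld) _; rewrite oppr_gt0.
- exact: pos ld n20.
apply: regular_swap; have lds := local_data_swap ld.
have [n10|n10|n10] := ltgtP (n1 x0 y0) 0.
- by apply: regular_neg; apply: pos (local_data_neg lds) _; rewrite oppr_gt0.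
- exact: pos lds n10.
- by move: un; rewrite n10 n20 expr0n addr0 => /eqP; rewrite eq_sym oner_eq0.
Qed.

End LocalRegularity.

(** * From the weak equation to a potential *)

Section LebesgueRectangle.
Context {R : realType}.
Implicit Types (f g h w : R -> R -> R) (a b x y r s t e d z l L M q : R).
Let mu := @lebesgue_measure R.

(** The integral over [[a - q, a + q]], written with [prim] so that the calculus of primitives
    applies to it. *)
Definition seg a q (f : R -> R) : R := prim a f (a + q) - prim a f (a - q).

Lemma integral_seg (f : R -> R) a q : 0 < q -> (forall x, {for x, continuous f}) ->
  (forall x, q <= `|x - a| -> f x = 0) -> (\int[mu]_x (f x)%:E = (seg a q f)%:E)%E.
Proof.
move=> q0 cf f0.
have -> : seg a q f = \int[mu]_(x in `[a - q, a + q]) f x.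
  rewrite /seg (@primE _ (a - q) _ _ _ (a + q + 1))//; try lra.
  rewrite (@primE _ (a - q) _ _ (a - q) (a + q + 1))//; try lra.
  by rewrite set_itv1 Rintegral_set1; ring.
have fi : mu.-integrable `[a - q, a + q] (EFin \o f) by exact: cont_integrable.
rewrite /Rintegral fineK; last exact: integrable_fin_num.
rewrite [RHS]integral_mkcond; apply: eq_integral => x _.
rewrite patchE; case: ifPn => //; rewrite notin_setE/= in_itv/= => xI.
rewrite f0// leNgt; apply/negP => h; apply: xI.
by move: h; rewrite ltr_norml => /andP[? ?]; apply/andP; split; lra.
Qed.

(** An open set is the union of the countably many squares with rational center and radius that it
    contains. *)
Lemma open_measurable2 (U : set (R * R)) : open U ->
  measurable (U : set (measurableTypeR R * measurableTypeR R)).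
Proof.
move=> oU.
pose rect (i : rat * rat * rat) : set (measurableTypeR R * measurableTypeR R) :=
  ball (ratr i.1.1 : R) (ratr i.2 : R) `*` ball (ratr i.1.2 : R) (ratr i.2 : R).
pose F i := if pselect (rect i `<=` U) then rect i else set0.
have -> : U = \bigcup_i F i.
  apply/seteqP; split => [[x y] Uxy|p [i _]]; last first.
    by rewrite /F; case: pselect => // H /H.
  have /nbhs_ballP[d /= d0 Hd] := oU _ Uxy.
  have d2 : 0 < d / 2 by rewrite divr_gt0.
  have [e eI] := rat_in_itvoo d2.
  have [e0 ed] : 0 < ratr e :> R /\ ratr e < d / 2 by move: eI; rewrite in_itv => /andP[].
  have [a aI] : exists a : rat, ratr a \in `]x - ratr e, x + ratr e[ by apply: rat_in_itvoo; lra.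
  have [b bI] : exists b : rat, ratr b \in `]y - ratr e, y + ratr e[ by apply: rat_in_itvoo; lra.
  have xa : `|ratr a - x| < ratr e by rewrite ltr_distl; move: aI; rewrite in_itv.
  have yb : `|ratr b - y| < ratr e by rewrite ltr_distl; move: bI; rewrite in_itv.
  exists (a, b, e) => //; rewrite /F; case: pselect => [?|H]; first by split.
  exfalso; apply: H => -[x' y'] [/= h1 h2]; rewrite /ball/= in h1; rewrite /ball/= in h2.
  apply: Hd; split; rewrite /ball/=.
    by have := ler_distD (ratr a) x x'; rewrite (distrC x (ratr a)); lra.
  by have := ler_distD (ratr b) y y'; rewrite (distrC y (ratr b)); lra.
apply: countable_bigcupT_measurable; first exact: countableP.
move=> i; rewrite /F; case: pselect => ?; last exact: measurable0.
by apply: measurableX; exact: measurable_realfun.measurable_ball.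
Qed.

Lemma cont2_measurable f : (forall x y, cont2 f x y) ->
  @measurable_fun _ _ (measurableTypeR R * measurableTypeR R)%type (measurableTypeR R) setT
    (fun p => f p.1 p.2).
Proof.
move=> cf; apply: (measurability _ (measurable_realfun.RGenOpens.measurableE R)).
move=> _ [_ [a [b ->] <-]]; rewrite setTI; apply: open_measurable2.
apply: open_comp; last exact: interval_open.
by move=> [x y] _; exact: cf.
Qed.

Lemma seg0 a q (f : R -> R) : (forall x, f x = 0) -> seg a q f = 0.
Proof.
move=> f0; rewrite /seg; have p0 x : prim a f x = 0.
  have := @prim_uniq _ (cst 0) f a (`|x - a| + 1) x; rewrite /= subrr; apply.
  - by move=> s _; rewrite (_ : f = cst 0); [exact: cvg_cst|apply/funext].
  - by move=> s _; rewrite f0; exact: is_derive_cst.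
  - by rewrite ltrDl.
by rewrite !p0 subrr.
Qed.

Lemma cont_seg f b q x : (forall x y, cont2 f x y) -> {for x, continuous (fun x => seg b q (f x))}.
Proof.
move=> cf; have c y : {for x, continuous (fun x => prim b (f x) y)}.
  apply: (cont2_right (f := fun y x => prim b (f x) y)).
  apply: (@cont2_prim _ (fun y x => f x y) b x (`|y - b| + 1)).
    by move=> y' x' _; exact: cont2_swap.
  by split; rewrite ?ltrDl// subrr normr0 ltr_wpDl.
exact: continuousB (c _) (c _).
Qed.

(** The passage from the product Lebesgue integral of the weak equation to iterated primitives: [f]
    vanishes off a square inside [Omega], so the integral extends to the plane and Fubini
    applies. *)
Lemma integral_rectangle f x0 y0 q (Omega : set (R * R)) : 0 < q ->
  (forall x y, cont2 f x y) -> (forall x y, ~ box x0 y0 q x y -> f x y = 0) ->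
  (forall x y, box x0 y0 q x y -> Omega (x, y)) ->
  (\int[(mu \x mu)%E]_(p in Omega) (f p.1 p.2)%:E = (seg x0 q (fun x => seg y0 q (f x)))%:E)%E.
Proof.
move=> q0 cf f0 BO.
have -> : (\int[(mu \x mu)%E]_(p in Omega) (f p.1 p.2)%:E = \int[(mu \x mu)%E]_p (f p.1 p.2)%:E)%E.
  rewrite integral_mkcond; apply: eq_integral => -[x y] _; rewrite patchE; case: ifPn => //=.
  by rewrite notin_setE => H; rewrite f0// => /BO.
have offy g x : (forall x y, ~ box x0 y0 q x y -> g x y = 0) -> forall y, q <= `|y - y0| -> g x y = 0.
  by move=> g0 y yq; apply: g0 => -[_]; rewrite ltNge yq.
have offx g x : (forall x y, ~ box x0 y0 q x y -> g x y = 0) -> q <= `|x - x0| -> seg y0 q (g x) = 0.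
  by move=> g0 xq; apply: seg0 => y; apply: g0 => -[]; rewrite ltNge xq.
have iter g : (forall x y, cont2 g x y) -> (forall x y, ~ box x0 y0 q x y -> g x y = 0) ->
    (\int[mu]_x \int[mu]_y (g x y)%:E = (seg x0 q (fun x => seg y0 q (g x)))%:E)%E.
  move=> cg g0; under eq_integral => x _.
    rewrite (@integral_seg (g x) y0 q)//; first over.
      by move=> y; exact: cont2_right (cg x y).
    exact: offy.
  by apply: integral_seg => // x; [exact: cont_seg|exact: offx].
have mf : measurable_fun [set: measurableTypeR R * measurableTypeR R] (fun p => (f p.1 p.2)%:E).
  by apply/measurable_realfun.measurable_EFinP; exact: cont2_measurable.
(* Tonelli: the iterated integral of |f| is again a [seg], hence finite. *)
have intf : integrable (mu \x mu)%E setT (fun p : measurableTypeR R * measurableTypeR R => (f p.1 p.2)%:E).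
  apply/(integrable12ltyP _ _ mf) => /=.
  rewrite (iter (fun x y => `|f x y|)) ?ltry//.
    move=> x y; apply: (@cont2_fun1 _ (fun z => `|z|)); last exact: cf.
    exact: norm_continuous.
  by move=> x y /f0 ->; rewrite normr0.
rewrite -(integral12_prod_meas1 intf); exact: iter.
Qed.

End LebesgueRectangle.

(** * Smooth test functions *)

Section SmoothBump.
Context {R : realType}.
Implicit Types (f g : R -> R) (x y c d e s t : R) (n k : nat).

Fixpoint smooth n f : Prop :=
  if n is n'.+1 then exists2 df : R -> R, (forall x, is_derive x 1 f (df x)) & smooth n' df
  else forall x, {for x, continuous f}.

Lemma smoothW n f : smooth n.+1 f -> smooth n f.
Proof.
elim: n f => [|n IH] f [df Df sdf]; first by move=> x; exact: is_derive_cont (Df x).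
by exists df => //; exact: IH.
Qed.

Lemma smoothD n f g : smooth n f -> smooth n g -> smooth n (fun x => f x + g x).
Proof.
elim: n f g => [|n IH] f g; first by move=> cf cg x; exact: continuousD (cf x) (cg x).
move=> [df Df sf] [dg Dg sg]; exists (fun x => df x + dg x); last exact: IH.
by move=> x; exact: is_deriveD.
Qed.

Lemma smoothMc n f c : smooth n f -> smooth n (fun x => f x * c).
Proof.
elim: n f => [|n IH] f; first by move=> cf x; apply: continuousM; [exact: cf|exact: cvg_cst].
by move=> [df Df sf]; exists (fun x => df x * c); [move=> x; exact: is_deriveMc|exact: IH].
Qed.

Lemma smoothM n f g : smooth n f -> smooth n g -> smooth n (fun x => f x * g x).
Proof.
elim: n f g => [|n IH] f g; first by move=> cf cg x; exact: continuousM (cf x) (cg x).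
move=> sf sg; have [sf' sg'] := (smoothW sf, smoothW sg).
have [df Df sdf] := sf; have [dg Dg sdg] := sg.
exists (fun x => df x * g x + f x * dg x); first by move=> x; exact: is_derive_mul.
by apply: smoothD; exact: IH.
Qed.

Lemma smooth_affine n f c d : smooth n f -> smooth n (fun x => f (c * x + d)).
Proof.
have D x : is_derive x 1 (fun x => c * x + d) c.
  rewrite -[X in is_derive _ _ _ X]addr0; apply: is_deriveD.
  by exact: is_derive_lin.
elim: n f => [|n IH] f.
  move=> cf x; apply: (@continuous_comp _ _ _ (fun x => c * x + d) f); last exact: cf.
  exact: is_derive_cont (D x).
move=> [df Df sf]; exists (fun x => df (c * x + d) * c).
  by move=> x; exact: (is_derive_compR (D x) (Df _)).
by apply: (@smoothMc n (fun x => df (c * x + d)) c); exact: IH.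
Qed.

(** exp(-1/x) / x^k on the positive axis, extended by 0. Differentiation maps each member to a
    linear combination of members, so smoothness is an induction over the whole family. *)
Definition expV k x : R := if 0 < x then x^-1 ^+ k * expR (- x^-1) else 0.

(** One term of the exponential series, exp z >= z^(k+2) / (k+2)! at z = 1/x, gives a quadratic
    bound, which forces a zero derivative at 0. *)
Lemma expV_le k x : 0 < x -> expV k x <= (k.+2)`!%:R * x ^+ 2.
Proof.
move=> x0; rewrite /expV x0; have z0 : 0 < x^-1 by rewrite invr_gt0.
have h := expR_ge1Dxn (k.+1) (ltW z0).
have F0 : 0 < (k.+2)`!%:R :> R by rewrite ltr0n fact_gt0.
rewrite expRN ler_pdivrMr ?expR_gt0//.
apply: (@le_trans _ _ ((k.+2)`!%:R * x ^+ 2 * (x^-1 ^+ k.+2 / (k.+2)`!%:R))); last first.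
  rewrite ler_wpM2l ?mulr_ge0 ?exprn_ge0 ?(ltW x0)//; lra.
rewrite le_eqVlt -addn2 exprD; apply/orP; left; apply/eqP; field.
by rewrite gt_eqF ?gt_eqF.
Qed.

Lemma expV_eq0 k x : x <= 0 -> expV k x = 0.
Proof. by rewrite /expV leNgt => /negbTE ->. Qed.

Lemma is_derive_expV k x : is_derive x 1 (expV k) (expV k.+2 x - k%:R * expV k.+1 x).
Proof.
have [x0|x0|<-] := ltgtP 0 x; last first.
- rewrite !(@expV_eq0 _ 0)// mulr0 subr0; apply/is_deriveP => e e0.
  have F0 : 0 < (k.+2)`!%:R :> R by rewrite ltr0n fact_gt0.
  exists (e / (k.+2)`!%:R); first exact: divr_gt0.
  move=> y; rewrite mul0r (@expV_eq0 _ 0)// !subr0 => yd.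
  have [y0|y0] := ltP 0 y; last by rewrite expV_eq0// normr0 mulr_ge0// ltW.
  have h := expV_le k y0.
  have h0 : 0 <= expV k y by rewrite /expV y0 mulr_ge0 ?expR_ge0// exprn_ge0// invr_ge0 ltW.
  rewrite (gtr0_norm y0) ltr_pdivlMr// in yd.
  rewrite (ger0_norm h0) (gtr0_norm y0) (le_trans h)// expr2 mulrA ler_wpM2r ?(ltW y0)//.
  by rewrite mulrC ltW.
- rewrite !(@expV_eq0 _ x) ?(ltW x0)// mulr0 subr0.
  apply: (@is_derive_locally _ (cst 0) _ _ _ (- x)); rewrite ?oppr_gt0//.
  by move=> y; rewrite ltr_norml => /andP[_ h]; rewrite expV_eq0//; lra.
have xN : x != 0 by rewrite gt_eqF.
apply: (@is_derive_locally _ (fun x => x^-1 ^+ k * expR (- x^-1)) _ _ _ x) => //.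
  by move=> y; rewrite ltr_norml /expV => /andP[h _]; have -> : 0 < y by lra.
have D1 : is_derive x (1 : R) (fun y => y^-1) (- x ^- 2 * 1) := is_deriveV xN (is_derive_id x 1).
have D2 : is_derive x^-1 (1 : R) (fun z => z ^+ k) (k%:R * x^-1 ^+ k.-1).
  rewrite (_ : (fun z => z ^+ k) = id ^+ k); last by apply/funext => z; rewrite exprfctE.
  by rewrite -[X in is_derive _ _ _ X]mulr1; exact: (is_deriveX k (is_derive_id x^-1 1)).
have D3 : is_derive x^-1 (1 : R) (fun z => expR (- z)) (expR (- x^-1) * - 1).
  by apply: (@is_derive_compR _ expR); exact: is_deriveN.
apply: (is_derive_val (is_derive_compR D1 (is_derive_mul D2 D3))).
have xp : x ^- 2 = x^-1 ^+ 2 by rewrite exprVn.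
rewrite /expV x0 xp; case: k {D2} => [|k] /=; first by rewrite !expr0 !mul0r; ring.
by rewrite !exprS; ring.
Qed.

Lemma smooth_expV n k : smooth n (expV k).
Proof.
elim: n k => [|n IH] k; first by move=> x; exact: is_derive_cont (is_derive_expV k x).
exists (fun x => expV k.+2 x - k%:R * expV k.+1 x); first exact: is_derive_expV.
have := smoothD (IH k.+2) (smoothMc (- k%:R) (IH k.+1)).
by congr smooth; apply/funext => x; ring.
Qed.

Lemma expV_gt0 k x : 0 < x -> 0 < expV k x.
Proof. by move=> x0; rewrite /expV x0 mulr_gt0 ?expR_gt0// exprn_gt0// invr_gt0. Qed.

(** Smooth, and positive exactly on []-d, d[]. *)
Definition bump d x := expV 0 (d + x) * expV 0 (d - x).

Lemma bump_ge0 d x : 0 <= bump d x.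
Proof.
rewrite /bump; have h z : 0 <= expV 0 z.
  by have [/(expV_gt0 0)/ltW|/(expV_eq0 0) ->] := ltP 0 z.
exact: mulr_ge0.
Qed.

Lemma bump0_gt0 d : 0 < d -> 0 < bump d 0.
Proof. by move=> d0; rewrite /bump addr0 subr0 mulr_gt0// expV_gt0. Qed.

Lemma bump_out d x : d <= `|x| -> bump d x = 0.
Proof.
rewrite /bump; case: (ger0P x) => _ h; first by rewrite [X in _ * X]expV_eq0 ?mulr0//; lra.
by rewrite expV_eq0 ?mul0r//; lra.
Qed.

Lemma smooth_bump n d : smooth n (bump d).
Proof.
apply: smoothM.
  have := @smooth_affine n _ 1 d (smooth_expV n 0).
  by congr smooth; apply/funext => x; rewrite mul1r addrC.
have := @smooth_affine n _ (- 1) d (smooth_expV n 0).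
by congr smooth; apply/funext => x; rewrite mulN1r addrC.
Qed.

Lemma bump_cont d x : {for x, continuous (bump d)}.
Proof. exact: (smooth_bump 0 d). Qed.

Lemma is_derive_prim_bump d x : is_derive x 1 (prim 0 (bump d)) (bump d x).
Proof.
apply: (@is_derive_prim _ _ _ (`|x| + 1)); first by move=> s _; exact: bump_cont.
by rewrite subr0 ltrDl.
Qed.

Lemma prim_bump_right d x y : 0 < d -> d <= x -> d <= y -> prim 0 (bump d) x = prim 0 (bump d) y.
Proof.
move=> d0 dx dy; apply: derive0_eq => s sI; have := is_derive_prim_bump d s; rewrite bump_out//.
by case: sI => /andP[h1 h2]; rewrite ger0_norm; lra.
Qed.

Lemma prim_bump_left d x y : 0 < d -> x <= - d -> y <= - d -> prim 0 (bump d) x = prim 0 (bump d) y.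
Proof.
move=> d0 dx dy; apply: derive0_eq => s sI; have := is_derive_prim_bump d s; rewrite bump_out//.
by case: sI => /andP[h1 h2]; rewrite ler0_norm; lra.
Qed.

(** The difference of two smoothed steps of equal height, hence compactly supported. Its derivative,
    a bump at [x1] minus the same bump at [x2], compares the values of a function at the two
    points. *)
Definition plateau d x1 x2 x := prim 0 (bump d) (x - x1) - prim 0 (bump d) (x - x2).

Lemma smooth_plateau n d x1 x2 : smooth n (plateau d x1 x2).
Proof.
apply: (@smoothW n); exists (fun x => bump d (x - x1) - bump d (x - x2)).
  have D z x : is_derive x 1 (fun x => prim 0 (bump d) (x - z)) (bump d (x - z)).
    rewrite -[X in is_derive _ _ _ X]mulr1.
    apply: (@is_derive_compR _ (prim 0 (bump d)) (fun x => x - z)); last exact: is_derive_prim_bump.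
    by rewrite -[X in is_derive _ _ _ X]subr0; apply: is_deriveB.
  by move=> x; exact: is_deriveB (D x1 x) (D x2 x).
have h1 := @smooth_affine n _ 1 (- x1) (smooth_bump n d).
have h2 := @smooth_affine n _ 1 (- x2) (smooth_bump n d).
have := smoothD h1 (smoothMc (- 1) h2).
by congr smooth; apply/funext => x; rewrite !mul1r mulrN1.
Qed.

Lemma is_derive_plateau d x1 x2 x :
  is_derive x 1 (plateau d x1 x2) (bump d (x - x1) - bump d (x - x2)).
Proof.
have D z : is_derive x 1 (fun x => prim 0 (bump d) (x - z)) (bump d (x - z)).
  rewrite -[X in is_derive _ _ _ X]mulr1.
  apply: (@is_derive_compR _ (prim 0 (bump d)) (fun x => x - z)); last exact: is_derive_prim_bump.
  by rewrite -[X in is_derive _ _ _ X]subr0; apply: is_deriveB.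
exact: is_deriveB (D x1) (D x2).
Qed.

Lemma plateau_out d x1 x2 x0 q x : 0 < d -> `|x1 - x0| + d <= q -> `|x2 - x0| + d <= q ->
  q <= `|x - x0| -> plateau d x1 x2 x = 0 /\ bump d (x - x1) - bump d (x - x2) = 0.
Proof.
move=> d0 h1 h2 qx.
have b z : `|z - x0| + d <= q -> d <= `|x - z|.
  by move=> h; have := ler_distD z x x0; lra.
split; last by rewrite !bump_out ?subrr// b.
rewrite /plateau; have [xx|xx] := lerP 0 (x - x0).
  rewrite (ger0_norm xx) in qx.
  have k z : `|z - x0| + d <= q -> d <= x - z by move=> h; have := ler_norm (z - x0); lra.
  by rewrite (@prim_bump_right d (x - x1) (x - x2)) ?k// subrr.
rewrite (ltr0_norm xx) in qx.
have k z : `|z - x0| + d <= q -> x - z <= - d.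
  by move=> h; have := ler_norm (x0 - z); rewrite distrC; lra.
by rewrite (@prim_bump_left d (x - x1) (x - x2)) ?k// subrr.
Qed.

(** The difference quotients of [h] along [v] and of [f] are the same function, which reduces
    partial derivatives on the plane to one variable. *)
Lemma is_derive_slice (h : R * R -> R) (p v : R * R) (f : R -> R) t (l : R) :
  h p = f t -> (forall s, h (s *: v + p) = f (s + t)) -> is_derive p v h l <-> is_derive t 1 f l.
Proof.
move=> hp E; have {}E : (fun s : R => s^-1 *: ((h \o shift p) (s *: v) - h p)) =
    (fun s : R => s^-1 *: ((f \o shift t) (s *: (1 : R)) - f t)).
  by apply/funext => s; rewrite hp /shift /= E [s *: 1]mulr1.
split=> -[D1 D2]; apply: DeriveDef.
- by move: D1; rewrite /derivable E.
- by move: D2; rewrite /derive E.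
- by move: D1; rewrite /derivable -E.
- by move: D2; rewrite /derive -E.
Qed.

Lemma is_derive_ex (h : R * R -> R) (p : R * R) (l : R) :
  is_derive p (e_x : R * R) h l <-> is_derive p.1 1 (fun s => h (s, p.2)) l.
Proof.
apply: is_derive_slice => [|s]; first by rewrite -surjective_pairing.
by congr h; congr (_, _) => /=; rewrite ?scaler0 ?add0r// [_ *: 1]mulr1.
Qed.

Lemma is_derive_ey (h : R * R -> R) (p : R * R) (l : R) :
  is_derive p (e_y : R * R) h l <-> is_derive p.2 1 (fun s => h (p.1, s)) l.
Proof.
apply: is_derive_slice => [|s]; first by rewrite -surjective_pairing.
by congr h; congr (_, _) => /=; rewrite ?scaler0 ?add0r// [_ *: 1]mulr1.
Qed.

Lemma is_derive_tensor_x f (g : R -> R) (df : R -> R) (p : R * R) : (forall x, is_derive x 1 f (df x)) ->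
  is_derive p (e_x : R * R) (fun p : R * R => f p.1 * g p.2) (df p.1 * g p.2).
Proof. by move=> Df; apply/is_derive_ex => /=; exact: (is_deriveMc (g p.2) (Df p.1)). Qed.

Lemma is_derive_tensor_y f (g : R -> R) (dg : R -> R) (p : R * R) : (forall x, is_derive x 1 g (dg x)) ->
  is_derive p (e_y : R * R) (fun p : R * R => f p.1 * g p.2) (f p.1 * dg p.2).
Proof.
move=> Dg; apply/is_derive_ey => /=; rewrite mulrC; have := is_deriveMc (f p.1) (Dg p.2).
by congr is_derive; apply/funext => y; rewrite mulrC.
Qed.

Lemma Ck_tensor n f (g : R -> R) : smooth n f -> smooth n g ->
  Ck n setT (fun p : R * R => f p.1 * g p.2).
Proof.
have sc m (k : R -> R) : smooth m k -> forall x, {for x, continuous k}.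
  by case: m => [//|m] [dk Dk _] x; exact: is_derive_cont (Dk x).
have cont m f' (g' : R -> R) : smooth m f' -> smooth m g' ->
    continuous_in setT (fun p : R * R => f' p.1 * g' p.2).
  move=> sf sg p _; apply: continuousM.
    by apply: continuous_comp; [exact: cvg_fst|exact: sc sf _].
  by apply: continuous_comp; [exact: cvg_snd|exact: sc sg _].
elim: n f g => [|n IH] f g sf sg; first by split => //; exact: cont sf sg.
have [sf' sg'] := (smoothW sf, smoothW sg).
have [df Df sdf] := sf; have [dg Dg sdg] := sg.
split; first exact: cont sf sg.
split.
- move=> p _; have [] := is_derive_tensor_x g p Df; have [] := is_derive_tensor_y f p Dg.
  by move=> ? _ ? _; split.
- have := IH _ _ sdf sg'; congr (Ck n setT _); apply/funext => p.
  by have [_ ->] := is_derive_tensor_x g p Df.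
- have := IH _ _ sf' sdg; congr (Ck n setT _); apply/funext => p.
  by have [_ ->] := is_derive_tensor_y f p Dg.
Qed.

End SmoothBump.

(** * Weak derivatives in one variable *)

Section WeakPotential.
Context {R : realType}.
Implicit Types (f g : R -> R) (a b x y r s t e d q m : R).

Lemma seg_bounds a q r : 0 < q < r -> `|a + q - a| < r /\ `|a - q - a| < r.
Proof.
move=> /andP[q0 qr]; have E1 : a + q - a = q by ring.
have E2 : a - q - a = - q by ring.
by rewrite E1 E2 normrN gtr0_norm.
Qed.

Lemma segD f g a q r : 0 < q < r -> (forall s, `|s - a| < r -> {for s, continuous f}) ->
  (forall s, `|s - a| < r -> {for s, continuous g}) ->
  seg a q (fun s => f s + g s) = seg a q f + seg a q g.
Proof.
move=> qr cf cg; have [b1 b2] := seg_bounds a qr.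
by rewrite /seg (primD cf cg b1) (primD cf cg b2); ring.
Qed.

Lemma segMc f (c : R) a q r : 0 < q < r -> (forall s, `|s - a| < r -> {for s, continuous f}) ->
  seg a q (fun s => f s * c) = seg a q f * c.
Proof.
move=> qr cf; have [b1 b2] := seg_bounds a qr.
by rewrite /seg (primMc c cf b1) (primMc c cf b2); ring.
Qed.

Lemma seg_ftc (F : R -> R) f a q r : 0 < q < r -> (forall s, `|s - a| < r -> {for s, continuous f}) ->
  (forall s, `|s - a| < r -> is_derive s 1 F (f s)) -> seg a q f = F (a + q) - F (a - q).
Proof.
move=> qr cf dF; have [b1 b2] := seg_bounds a qr.
by rewrite /seg (prim_uniq cf dF b1) (prim_uniq cf dF b2); ring.
Qed.

Lemma eq_seg f g a q : 0 < q -> (forall s, `|s - a| <= q -> f s = g s) -> seg a q f = seg a q g.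
Proof.
move=> q0 fg; congr (_ - _); apply: eq_prim => s sI; apply: fg; have := btw_dist sI.
  by rewrite addrAC subrr add0r (gtr0_norm q0).
by rewrite addrAC subrr add0r normrN (gtr0_norm q0).
Qed.

Definition dplateau d x1 x2 x : R := bump d (x - x1) - bump d (x - x2).

Lemma dplateau_cont d x1 x2 x : {for x, continuous (dplateau d x1 x2)}.
Proof.
have c z : {for x, continuous (fun x => bump d (x - z))}.
  apply: (@continuous_comp _ _ _ (fun x => x - z) (bump d)); last exact: bump_cont.
  by apply: continuousB; [exact: cvg_id|exact: cvg_cst].
exact: continuousB (c x1) (c x2).
Qed.

(* The lemma of du Bois-Reymond. *)
Lemma weak_primitive f g a q r : 0 < q < r ->
  (forall s, `|s - a| < r -> {for s, continuous f}) ->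
  (forall s, `|s - a| < r -> {for s, continuous g}) ->
  (forall d x1 x2, 0 < d -> `|x1 - a| + d <= q -> `|x2 - a| + d <= q ->
     seg a q (fun x => dplateau d x1 x2 x * f x + plateau d x1 x2 x * g x) = 0) ->
  forall x, `|x - a| < q -> f x = f a + prim a g x.
Proof.
move=> qr cf cg H; have /andP[q0 qr'] := qr.
(* Integration by parts makes the weak derivative of [k] vanish; [key] rules out two distinct
   values. *)
pose k x := f x - prim a g x.
have ck s : `|s - a| < r -> {for s, continuous k}.
  by move=> sr; apply: continuousB; [exact: cf|exact: is_derive_cont (is_derive_prim cg sr)].
have cp d x1 x2 s : {for s, continuous (plateau d x1 x2)} by exact: (smooth_plateau 0).
have key x1 x2 : `|x1 - a| < q -> `|x2 - a| < q -> ~ k x1 < k x2.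
  move=> x1q x2q k12.
  (* [e] separates the two values, and [d] will be so small that [k < e] on the support of the first
     bump and [k > e] on that of the second. *)
  have [e /andP[e1 e2]] : exists m, k x1 < m < k x2 by exists ((k x1 + k x2) / 2); apply/andP; split; lra.
  have [d1 d10 D1] := (cont1P _ _).1 (ck _ (lt_trans x1q qr')) (e - k x1) ltac:(by rewrite subr_gt0).
  have [d2 d20 D2] := (cont1P _ _).1 (ck _ (lt_trans x2q qr')) (k x2 - e) ltac:(by rewrite subr_gt0).
  have [d d0 [dd1 dd2 dq1 dq2]] : exists2 d, 0 < d & [/\ d <= d1, d <= d2, `|x1 - a| + d <= q & `|x2 - a| + d <= q].
    exists (Num.min (Num.min d1 d2) (Num.min (q - `|x1 - a|) (q - `|x2 - a|))).
      by rewrite !lt_min d10 d20 !subr_gt0 x1q x2q.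
    split; [by rewrite !ge_min lexx|by rewrite !ge_min lexx orbT|..].
      by rewrite -lerBrDl !ge_min lexx !orbT.
    by rewrite -lerBrDl !ge_min lexx !orbT.
  have h := H d x1 x2 d0 dq1 dq2.
  set P := plateau d x1 x2 in h; set B := dplateau d x1 x2 in h.
  have cB s : {for s, continuous B} by exact: dplateau_cont.
  have cP s : {for s, continuous P} by exact: cp.
  have dP s : is_derive s 1 P (B s) by exact: is_derive_plateau.
  have P0 z : q <= `|z - a| -> P z = 0 by move=> /(plateau_out d0 dq1 dq2)[].
  have Pl : P (a + q) = 0 by apply: P0; rewrite addrAC subrr add0r gtr0_norm.
  have Pr : P (a - q) = 0 by apply: P0; rewrite addrAC subrr add0r normrN gtr0_norm.
  have cBk s : `|s - a| < r -> {for s, continuous (fun x => B x * k x)}.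
    by move=> sr; apply: continuousM; [exact: cB|exact: ck].
  have cBe s : `|s - a| < r -> {for s, continuous (fun x => B x * - e)}.
    by move=> sr; apply: continuousM; [exact: cB|exact: cvg_cst].
  have cPg s : `|s - a| < r -> {for s, continuous (fun x => B x * prim a g x + P x * g x)}.
    move=> sr; apply: continuousD; apply: continuousM; [exact: cB| |exact: cP|exact: cg].
    exact: is_derive_cont (is_derive_prim cg sr).
  have s1 : seg a q (fun x => B x * prim a g x + P x * g x) = 0.
    have dd s : `|s - a| < r -> is_derive s 1 (fun x => P x * prim a g x) (B s * prim a g s + P s * g s).
      by move=> sr; exact: is_derive_mul (dP s) (is_derive_prim cg sr).
    by rewrite (seg_ftc qr cPg dd) Pl Pr !mul0r subrr.
  have s2 : seg a q (fun x => B x * k x) = 0.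
    have := segD qr cBk cPg; rewrite s1 addr0 -h => <-; apply: eq_seg => // s _.
    by rewrite /k; ring.
  have s3 : seg a q (fun x => B x * - e) = 0.
    rewrite (segMc (- e) qr (fun s _ => cB s)) (seg_ftc qr (fun s _ => cB s) (fun s _ => dP s)).
    by rewrite Pl Pr subrr mul0r.
  (* [F] has integral 0, is nonpositive and is negative at [x1]. Its primitive is monotone with
     equal end values, hence constant, which contradicts the value at [x1]. *)
  pose F x := B x * k x + B x * - e.
  have cF s : `|s - a| < r -> {for s, continuous F}.
    by move=> sr; apply: continuousD; [exact: cBk|exact: cBe].
  have sF : seg a q F = 0 by rewrite (segD qr cBk cBe) s2 s3 addr0.
  have F0 z : F z <= 0.
    have -> : F z = bump d (z - x1) * (k z - e) + bump d (z - x2) * (e - k z).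
      by rewrite /F /B /dplateau; ring.
    rewrite -[X in _ <= X](addr0 0) lerD//.
      have [h1|h1] := ltP `|z - x1| d; last by rewrite bump_out// mul0r.
      rewrite mulr_ge0_le0 ?bump_ge0//.
      by have := D1 z (lt_le_trans h1 dd1); rewrite ltr_norml => /andP[_]; clear; lra.
    have [h1|h1] := ltP `|z - x2| d; last by rewrite bump_out// mul0r.
    rewrite mulr_ge0_le0 ?bump_ge0//.
    by have := D2 z (lt_le_trans h1 dd2); rewrite ltr_norml => /andP[+ _]; clear; lra.
  have F1 : F x1 < 0.
    have -> : F x1 = bump d 0 * (k x1 - e) + bump d (x1 - x2) * (e - k x1).
      by rewrite /F /B /dplateau subrr; ring.
    have h1 : bump d 0 * (k x1 - e) < 0 by rewrite pmulr_rlt0 ?bump0_gt0// subr_lt0.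
    have [h2|h2] := ltP `|x1 - x2| d; last by rewrite [bump d (x1 - x2)]bump_out// mul0r addr0.
    have := D2 x1 (lt_le_trans h2 dd2); rewrite ltr_norml => /andP[h3 _].
    by exfalso; clear -h3 e1; lra.
  have mono u v : a - q <= u -> u <= v -> v <= a + q -> prim a F v <= prim a F u.
    move=> au uv va; have br z : u <= z <= v -> `|z - a| < r.
      by move=> /andP[h1 h2]; rewrite (le_lt_trans _ qr')// ler_norml; clear -au va h1 h2; apply/andP; split; lra.
    have [s sI|s sI E] := @mean_value _ (prim a F) F u v.
      by apply: (is_derive_prim cF); apply: br; case: sI => // /andP[h1 h2]; clear -h1 h2 uv; apply/andP; split; lra.
    by rewrite -subr_le0 E mulr_le0_ge0// subr_ge0.
  have pE : prim a F (a + q) = prim a F (a - q) by move: sF; rewrite /seg => /eqP; rewrite subr_eq0 => /eqP.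
  have cst z : `|z - a| < q -> prim a F z = prim a F (a - q).
    rewrite ltr_norml => /andP[h1 h2]; apply/eqP; rewrite eq_le; apply/andP; split.
      by apply: mono; clear -q0 h1 h2; lra.
    by rewrite -pE; apply: mono; clear -q0 h1 h2; lra.
  have dF : is_derive x1 1 (prim a F) (F x1) by exact: is_derive_prim cF (lt_trans x1q qr').
  have : is_derive x1 1 (prim a F) 0.
    apply: (@is_derive_locally _ (fun=> prim a F (a - q)) _ _ _ d) => //.
    by move=> z zd; rewrite cst//; have := ler_distD x1 z a; clear -zd dq1; lra.
  by move=> /(is_derive1_uniq dF) F0'; rewrite F0' ltxx in F1.
move=> x xq; suff : k x = k a by rewrite /k primxx subr0 => <-; ring.
have aq : `|a - a| < q by rewrite subrr normr0.
by have [h|h|//] := ltgtP (k x) (k a); exfalso; [exact: key xq aq h|exact: key aq xq h].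
Qed.

Lemma cont2_uncurry (h : R * R -> R) x y : {for (x, y), continuous h} -> cont2 (fun x y => h (x, y)) x y.
Proof. by rewrite /cont2 (_ : (fun p : R * R => h (p.1, p.2)) = h)//; apply/funext => -[]. Qed.

Lemma cont2_cutoff (F : R -> R -> R) f g x0 y0 q r : q < r ->
  cont_on x0 y0 r F ->
  (forall x, {for x, continuous f}) -> (forall y, {for y, continuous g}) ->
  (forall x, q <= `|x - x0| -> f x = 0) -> (forall y, q <= `|y - y0| -> g y = 0) ->
  forall x y, cont2 (fun x y => F x y * (f x * g y)) x y.
Proof.
move=> qr cF cf cg f0 g0 x y; have rq : 0 < r - q by rewrite subr_gt0.
have far z z0 z' : r <= `|z - z0| -> `|z' - z| < r - q -> q <= `|z' - z0|.
  by move=> h1 h2; have := ler_distD z' z z0; rewrite (distrC z z'); lra.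
have [xr|xr] := ltP `|x - x0| r; last first.
  apply: (@cont2_locally _ (fun _ _ => 0) _ _ _ (r - q)) => //; last exact: cont2_cst.
  by move=> x' y' [h _]; rewrite f0 ?mul0r ?mulr0//; exact: far xr h.
have [yr|yr] := ltP `|y - y0| r; last first.
  apply: (@cont2_locally _ (fun _ _ => 0) _ _ _ (r - q)) => //; last exact: cont2_cst.
  by move=> x' y' [_ h]; rewrite g0 ?mulr0//; exact: far yr h.
apply: cont2M; first exact: cF.
apply: cont2M; first by apply: (@cont2_fun1 _ f (fun x _ => x)); [exact: cf|exact: cont2_fst].
by apply: (@cont2_fun1 _ g (fun _ y => y)); [exact: cg|exact: cont2_snd].
Qed.

(** Both sides vanish at [x0] and have the same [x]-derivative, by differentiation under the
    integral. *)
Lemma prim_seg_swap (h : R -> R -> R) x0 y0 q r x : 0 < q < r ->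
  cont_on x0 y0 r h -> `|x - x0| < r ->
  prim x0 (fun x => seg y0 q (h x)) x = seg y0 q (fun y => prim x0 (h^~ y) x).
Proof.
move=> qr ch xr; have [b1 b2] := seg_bounds y0 qr; have r0 : 0 < r by exact: le_lt_trans xr.
have cQ y x' : box y0 x0 r y x' -> cont2 (fun y x => prim x0 (h^~ y) x) y x'.
  move=> b; apply: (@cont2_swap _ (fun x y => prim x0 (h^~ y) x)).
  by apply: (cont2_prim ch); case: b.
have dQ y x' : box y0 x0 r y x' -> is_derive x' 1 (fun x => prim x0 (h^~ y) x) (h x' y).
  move=> [yb xb]; apply: (@is_derive_prim _ (h^~ y) _ r) => // s sr.
  by apply: cont2_left; exact: ch.
have ch' y x' : box y0 x0 r y x' -> cont2 (fun y x => h x y) y x'.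
  by move=> [? ?]; apply: cont2_swap; exact: ch.
have D y x' : `|y - y0| < r -> `|x' - x0| < r ->
    is_derive x' 1 (fun x => prim y0 (fun y => prim x0 (h^~ y) x) y) (prim y0 (h x') y).
  by move=> yr xr'; exact: (is_derive_prim_param cQ dQ ch' (conj yr xr')).
have cs x' : `|x' - x0| < r -> {for x', continuous (fun x => seg y0 q (h x))}.
  move=> xr'; have c y : `|y - y0| < r -> {for x', continuous (fun x => prim y0 (h x) y)}.
    move=> yr; apply: (cont2_right (f := fun y x => prim y0 (h x) y)).
    exact: (cont2_prim ch' (conj yr xr')).
  exact: continuousB (c _ b1) (c _ b2).
have dS s : `|s - x0| < r -> is_derive s 1 (fun x => seg y0 q (fun y => prim x0 (h^~ y) x)) (seg y0 q (h s)).
  by move=> sr; exact: is_deriveB (D _ _ b1 sr) (D _ _ b2 sr).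
rewrite (prim_uniq cs dS xr) [X in _ - X]seg0 ?subr0// => y.
by rewrite primxx.
Qed.

End WeakPotential.

(** * Testing against products, and the potential of the rotated field *)

Section WeakTensor.
Context {R : realType}.
Implicit Types (a b x y r s t e d q m : R).

Lemma compact_square x0 y0 q : compact [set p : R * R | `|p.1 - x0| <= q /\ `|p.2 - y0| <= q].
Proof.
have -> : [set p : R * R | `|p.1 - x0| <= q /\ `|p.2 - y0| <= q] =
    `[x0 - q, x0 + q]%classic `*` `[y0 - q, y0 + q]%classic.
  apply/seteqP; split=> p /=; rewrite !in_itv/= !ler_distl => -[h1 h2]; split.
  - exact: h1.
  - exact: h2.
  - exact: h1.
  - exact: h2.
by apply: compact_setX; exact: segment_compact.
Qed.

(** With a product as test function, one factor can be held fixed while [weak_primitive] is applied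
    in the other variable. The margin [q < r] keeps the support a compact subset of [Omega]. *)
Lemma weak_tensor (Omega : set (R * R)) (N : R * R -> R * R) (H : R * R -> R)
    x0 y0 q r (al dal be dbe : R -> R) : 0 < q < r ->
  (forall x y, box x0 y0 r x y -> [/\ Omega (x, y), cont2 (fun x y => (N (x, y)).1) x y,
    cont2 (fun x y => (N (x, y)).2) x y & cont2 (fun x y => H (x, y)) x y]) ->
  weak_div_eq Omega N H ->
  (forall n, smooth n al /\ smooth n be) ->
  (forall x, is_derive x 1 al (dal x) /\ is_derive x 1 be (dbe x)) ->
  (forall x, {for x, continuous dal} /\ {for x, continuous dbe}) ->
  (forall x, q <= `|x - x0| -> al x = 0 /\ dal x = 0) ->
  (forall y, q <= `|y - y0| -> be y = 0 /\ dbe y = 0) ->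
  seg x0 q (fun x => seg y0 q (fun y => (N (x, y)).1 * (dal x * be y) +
     (N (x, y)).2 * (al x * dbe y) + H (x, y) * (al x * be y))) = 0.
Proof.
move=> qr HO weak sm D cd al0 be0; have /andP[q0 qr'] := qr.
have cal x : {for x, continuous al} by have [+ _] := sm 0; apply.
have cbe x : {for x, continuous be} by have [_ +] := sm 0; apply.
pose phi (p : R * R) := al p.1 * be p.2.
have testphi : test_function Omega phi.
  split; first by move=> n; have [? ?] := sm n; exact: Ck_tensor.
  exists [set p : R * R | `|p.1 - x0| <= q /\ `|p.2 - y0| <= q]; split.
  - exact: compact_square.
  - move=> [x y] /= [h1 h2]; have [|] := HO x y => //.
    by split; exact: le_lt_trans qr'.
  - move=> [x y] /= K; rewrite /phi /=.
    have [h1|h1] := ltP `|x - x0| q; last by rewrite (al0 _ h1).1 mul0r.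
    have [h2|h2] := ltP `|y - y0| q; last by rewrite (be0 _ h2).1 mulr0.
    by exfalso; apply: K; rewrite !ltW.
have gradphi p : grad phi p = (dal p.1 * be p.2, al p.1 * dbe p.2).
  rewrite /grad; have [_ ->] := is_derive_tensor_x be p (fun x => (D x).1).
  by have [_ ->] := is_derive_tensor_y al p (fun x => (D x).2).
pose G1 x y := (N (x, y)).1 * (dal x * be y); pose G2 x y := (N (x, y)).2 * (al x * dbe y).
pose G3 x y := H (x, y) * (al x * be y).
have cG1 x y : cont2 G1 x y.
  apply: (@cont2_cutoff _ (fun x y => (N (x, y)).1) dal be x0 y0 q r qr') => //.
  - by move=> u v /HO[].
  - by move=> u; have [] := cd u.
  - by move=> u /al0[].
  - by move=> u /be0[].
have cG2 x y : cont2 G2 x y.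
  apply: (@cont2_cutoff _ (fun x y => (N (x, y)).2) al dbe x0 y0 q r qr') => //.
  - by move=> u v /HO[].
  - by move=> u; have [] := cd u.
  - by move=> u /al0[].
  - by move=> u /be0[].
have cG3 x y : cont2 G3 x y.
  apply: (@cont2_cutoff _ (fun x y => H (x, y)) al be x0 y0 q r qr') => //.
  - by move=> u v /HO[].
  - by move=> u /al0[].
  - by move=> u /be0[].
have off (f g : R -> R) (F : R -> R -> R) x y : (forall x, q <= `|x - x0| -> f x = 0) ->
    (forall y, q <= `|y - y0| -> g y = 0) -> ~ box x0 y0 q x y -> F x y * (f x * g y) = 0.
  move=> f0 g0 B; have [h1|h1] := ltP `|x - x0| q; last by rewrite (f0 _ h1) mul0r mulr0.
  have [h2|h2] := ltP `|y - y0| q; last by rewrite (g0 _ h2) !mulr0.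
  by exfalso; apply: B.
have BO x y : box x0 y0 q x y -> Omega (x, y) by move=> /(box_le (ltW qr'))/HO[].
have := weak _ testphi.
have -> : (fun p => (dot (N p) (grad phi p))%:E) = (fun p => (G1 p.1 p.2 + G2 p.1 p.2)%:E).
  by apply/funext => -[x y]; rewrite gradphi.
have -> : (fun p => (H p * phi p)%:E) = (fun p => (G3 p.1 p.2)%:E).
  by apply/funext => -[x y].
rewrite (@integral_rectangle _ (fun x y => G1 x y + G2 x y) x0 y0 q)//; last 2 first.
- by move=> x y; exact: cont2D.
- move=> x y B.
  have -> : G1 x y = 0 by apply: (@off dal be (fun x y => (N (x, y)).1)) => // u; [move=> /al0[]|move=> /be0[]].
  have -> : G2 x y = 0 by apply: (@off al dbe (fun x y => (N (x, y)).2)) => // u; [move=> /al0[]|move=> /be0[]].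
  by rewrite addr0.
rewrite (@integral_rectangle _ G3 x0 y0 q)//; last first.
  by move=> x y B; apply: (@off al be (fun x y => H (x, y))) => // u; [move=> /al0[]|move=> /be0[]].
rewrite -EFinD => -[E]; rewrite -[RHS]E.
rewrite -(@segD _ (fun x => seg y0 q (fun y => G1 x y + G2 x y)) (fun x => seg y0 q (G3 x)) x0 q r qr).
- apply: eq_seg => // x _; rewrite -(@segD _ (fun y => G1 x y + G2 x y) (G3 x) y0 q r qr)//.
  + move=> y _; apply: (cont2_right (f := fun x y => G1 x y + G2 x y)).
    exact: cont2D (cG1 x y) (cG2 x y).
  + by move=> y _; exact: cont2_right (cG3 x y).
- by move=> x _; apply: (@cont_seg _ (fun x y => G1 x y + G2 x y)) => u v; exact: cont2D (cG1 u v) (cG2 u v).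
- by move=> x _; exact: cont_seg.
Qed.

(** [V] is the [x]-primitive of N2, normalized by the flux of N1 through the line [x = x0]. Its
    [x]-derivative is immediate; the weak equation provides the [y]-derivative. *)
Lemma weak_potential (Omega : set (R * R)) (N : R * R -> R * R) (H : R * R -> R) x0 y0 q r :
  0 < q < r ->
  (forall x y, box x0 y0 r x y -> [/\ Omega (x, y), cont2 (fun x y => (N (x, y)).1) x y,
    cont2 (fun x y => (N (x, y)).2) x y & cont2 (fun x y => H (x, y)) x y]) ->
  weak_div_eq Omega N H ->
  exists V hh : R -> R -> R, [/\
    C1box x0 y0 q V (fun x y => (N (x, y)).2) (fun x y => hh x y - (N (x, y)).1),
    forall x y, box x0 y0 q x y -> is_derive x 1 (hh^~ y) (H (x, y)) &
    forall x y, box x0 y0 q x y -> cont2 hh x y].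
Proof.
move=> qr HO weak; have /andP[q0 qr'] := qr; have r0 : 0 < r by exact: lt_trans qr'.
pose n1 x y := (N (x, y)).1; pose n2 x y := (N (x, y)).2; pose h x y := H (x, y).
have c1 x y : box x0 y0 r x y -> cont2 n1 x y by move=> /HO[].
have c2 x y : box x0 y0 r x y -> cont2 n2 x y by move=> /HO[].
have ch x y : box x0 y0 r x y -> cont2 h x y by move=> /HO[].
have Bqr x y : box x0 y0 q x y -> box x0 y0 r x y by exact: box_le (ltW qr').
pose hh x y := prim x0 (h^~ y) x; pose P x y := prim x0 (n2^~ y) x.
(* The [y]-derivative in integrated form, by [weak_primitive] in [y]; for each test function [be],
   the hypothesis of that lemma comes from [weak_primitive] in [x]. *)
have key x : `|x - x0| < q -> forall y, `|y - y0| < q ->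
    P x y = P x y0 + prim y0 (fun y => hh x y - n1 x y + n1 x0 y) y.
  move=> xq; have xr := lt_trans xq qr'.
  have x0r : `|x0 - x0| < r by rewrite subrr normr0.
  have cP y : `|y - y0| < r -> {for y, continuous (P x)}.
    by move=> yr; apply: (cont2_right (f := P)); exact: (cont2_prim c2 (conj xr yr)).
  have chh y : `|y - y0| < r -> {for y, continuous (hh x)}.
    by move=> yr; apply: (cont2_right (f := hh)); exact: (cont2_prim ch (conj xr yr)).
  have cn1 x' y : `|x' - x0| < r -> `|y - y0| < r -> {for y, continuous (n1 x')}.
    by move=> x'r yr; apply: cont2_right; exact: c1.
  apply: (weak_primitive qr cP).
    by move=> y yr; apply: continuousD; [apply: continuousB; [exact: chh|exact: cn1]|exact: cn1].
  move=> d y1 y2 d0 h1 h2; set be := plateau d y1 y2; set dbe := dplateau d y1 y2.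
  have cbe y : {for y, continuous be} by exact: (smooth_plateau 0).
  have cdbe y : {for y, continuous dbe} by exact: dplateau_cont.
  have cm (k : R -> R -> R) (b : R -> R) : cont_on x0 y0 r k ->
      (forall y, {for y, continuous b}) ->
      forall x y, box x0 y0 r x y -> cont2 (fun x y => k x y * b y) x y.
    move=> ck cb x' y' bb; apply: cont2M; first exact: ck.
    by apply: (@cont2_fun1 _ b (fun _ y => y)); [exact: cb|exact: cont2_snd].
  have cg x' y : box x0 y0 r x' y -> cont2 (fun x y => n2 x y * dbe y + h x y * be y) x' y.
    by move=> b; apply: cont2D; apply: cm.
  have cs (k : R -> R -> R) : cont_on x0 y0 r k ->
      forall s, `|s - x0| < r -> {for s, continuous (fun x => seg y0 q (k x))}.
    move=> ck s sr; have [b1 b2] := seg_bounds y0 qr.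
    have c y : `|y - y0| < r -> {for s, continuous (fun x => prim y0 (k x) y)}.
      move=> yr; apply: (cont2_right (f := fun y x => prim y0 (k x) y)).
      apply: (@cont2_prim _ (fun y x => k x y) y0 x0 r _ _ _ (conj yr sr)).
      by move=> y' x' [? ?]; apply: cont2_swap; exact: ck.
    exact: continuousB (c _ b1) (c _ b2).
  have slice (k : R -> R -> R) x' : cont_on x0 y0 r k -> `|x' - x0| < r ->
      forall s, `|s - y0| < r -> {for s, continuous (k x')}.
    by move=> ck x'r s sr; apply: cont2_right; exact: ck.
  (* With [be] fixed, the weak equation says that [g] is the weak [x]-derivative of [f]. *)
  pose f x := seg y0 q (fun y => n1 x y * be y).
  pose g x := seg y0 q (fun y => n2 x y * dbe y + h x y * be y).
  have stepA : f x = f x0 + prim x0 g x.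
    apply: (@weak_primitive _ f g x0 q r qr) => //; [exact: cs (cm _ _ c1 cbe)|exact: cs cg|].
    move=> d' x1 x2 d'0 k1 k2.
    rewrite -[RHS](@weak_tensor Omega N H x0 y0 q r (plateau d' x1 x2) (dplateau d' x1 x2) be dbe)//.
    - apply: eq_seg => // s sq; have sr : `|s - x0| < r by exact: le_lt_trans qr'.
      rewrite mulrC [X in _ + X]mulrC.
      rewrite -(segMc _ qr (slice _ _ (cm _ _ c1 cbe) sr)) -(segMc _ qr (slice _ _ cg sr)).
      rewrite -(@segD _ (fun y => n1 s y * be y * dplateau d' x1 x2 s)
        (fun y => (n2 s y * dbe y + h s y * be y) * plateau d' x1 x2 s) y0 q r qr).
      + by apply: eq_seg => // y _; rewrite -/(n1 s y) -/(n2 s y) -/(h s y); ring.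
      + move=> y yr; apply: continuousM; last exact: cvg_cst.
        exact: slice (cm _ _ c1 cbe) sr _ yr.
      + move=> y yr; apply: continuousM; last exact: cvg_cst.
        exact: slice cg sr _ yr.
    - by move=> n; split; exact: smooth_plateau.
    - by move=> y; split; exact: is_derive_plateau.
    - by move=> y; split; [exact: dplateau_cont|exact: cdbe].
    - by move=> y; exact: plateau_out.
    - by move=> y; exact: plateau_out.
  have swap : prim x0 g x = seg y0 q (fun y => P x y * dbe y + hh x y * be y).
    rewrite (prim_seg_swap qr cg xr); apply: eq_seg => // y yq.
    have yr : `|y - y0| < r by exact: le_lt_trans qr'.
    have cl (k : R -> R -> R) : cont_on x0 y0 r k ->
        forall s, `|s - x0| < r -> {for s, continuous (k^~ y)}.
      by move=> ck s sr; apply: cont2_left; exact: ck.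
    rewrite (primD (cl _ (cm _ _ c2 cdbe)) (cl _ (cm _ _ ch cbe)) xr).
    by rewrite (primMc _ (cl _ c2) xr) (primMc _ (cl _ ch) xr).
  have cA s : `|s - y0| < r -> {for s, continuous (fun y => P x y * dbe y + hh x y * be y)}.
    move=> sr; apply: continuousD; apply: continuousM; [exact: cP|exact: cdbe|exact: chh|exact: cbe].
  have cB x' s : `|x' - x0| < r -> `|s - y0| < r -> {for s, continuous (fun y => n1 x' y * be y)}.
    by move=> x'r sr; apply: continuousM; [exact: cn1|exact: cbe].
  have cC s : `|s - y0| < r -> {for s, continuous (fun y => n1 x y * be y * - 1)}.
    by move=> sr; apply: continuousM; [exact: cB|exact: cvg_cst].
  have cD s : `|s - y0| < r -> {for s, continuous (fun y => n1 x y * be y * - 1 + n1 x0 y * be y)}.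
    by move=> sr; apply: continuousD; [exact: cC|exact: cB].
  transitivity (seg y0 q (fun y => (P x y * dbe y + hh x y * be y) + (n1 x y * be y * - 1 + n1 x0 y * be y))).
    by apply: eq_seg => // y _; ring.
  rewrite (segD qr cA cD) (segD qr cC (fun s => cB x0 s x0r)) (segMc _ qr (fun s => cB x s xr)).
  by rewrite -swap -/(f x) -/(f x0) stepA; ring.
exists (fun x y => P x y - prim y0 (n1 x0) y), hh; split.
- move=> x y b; have [xq yq] := b; have [xr yr] := Bqr _ _ b; split.
  + have cl s : `|s - x0| < r -> {for s, continuous (n2^~ y)}.
      by move=> sr; apply: (cont2_left (f := n2)); exact: c2.
    have := is_deriveB (is_derive_prim cl xr) (is_derive_cst (prim y0 (n1 x0) y) x 1).
    by rewrite subr0.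
  + have cn s : `|s - y0| < r -> {for s, continuous (n1 x0)}.
      by move=> sr; apply: cont2_right; apply: c1; split => //; rewrite subrr normr0.
    have cG s : `|s - y0| < r -> {for s, continuous (fun y => hh x y - n1 x y + n1 x0 y)}.
      move=> sr; apply: continuousD; last exact: cn.
      apply: continuousB; first by apply: (cont2_right (f := hh)); exact: (cont2_prim ch (conj xr sr)).
      by apply: (cont2_right (f := n1)); exact: c1.
    apply: (@is_derive_locally _ (fun y => P x y0 + prim y0 (fun y => hh x y - n1 x y + n1 x0 y) y
        - prim y0 (n1 x0) y) _ _ _ (q - `|y - y0|)); first by rewrite subr_gt0.
      by move=> s sy; rewrite -key//; have := ler_distD y s y0; clear -sy; lra.
    have D1 := is_derive_prim cG yr; have D2 := is_derive_prim cn yr.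
    have D := is_deriveB (is_deriveD (is_derive_cst (P x y0) y 1) D1) D2.
    by apply: (is_derive_val D); rewrite add0r addrK.
  + by have [_ _ ? _] := HO _ _ (Bqr _ _ b).
  + by apply: cont2B; [exact: (cont2_prim ch (Bqr _ _ b))|exact: c1 (Bqr _ _ b)].
- move=> x y /Bqr[xr yr]; apply: (@is_derive_prim _ (h^~ y) _ r) => // s sr.
  by apply: (cont2_left (f := h)); exact: ch.
- by move=> x y b; exact: (cont2_prim ch (Bqr _ _ b)).
Qed.

End WeakTensor.

(** * Curves, angle and speed *)

Section Bridge.
Context {R : realType}.
Implicit Types (a b x y r s t e d q m : R) (h : R * R -> R) (U : set (R * R)) (V : R * R -> R * R)
  (c : R -> R * R).

Lemma is_derive_pair (c1 c2 : R -> R) t (l m : R) : is_derive t 1 c1 l -> is_derive t 1 c2 m ->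
  is_derive t 1 (fun s => (c1 s, c2 s)) (l, m).
Proof.
move=> [d1 <-] [d2 <-].
have C : (fun h : R => h^-1 *: (((fun s => (c1 s, c2 s)) \o shift t) (h *: (1 : R)) - (c1 t, c2 t)))
    @ 0^' --> ('D_1 c1 t, 'D_1 c2 t).
  exact: (cvg_pair d1 d2).
by apply: DeriveDef; [exact: cvgP C|exact: cvg_lim C].
Qed.

Lemma is_derive_proj c t (l : R * R) : is_derive t 1 c l ->
  is_derive t 1 (fun s => (c s).1) l.1 /\ is_derive t 1 (fun s => (c s).2) l.2.
Proof.
move=> [dc <-].
have dc' : (fun h : R => h^-1 *: ((c \o shift t) (h *: (1 : R)) - c t)) @ 0^' --> 'D_1 c t by exact: dc.
have C1 : (fun h : R => h^-1 *: (((fun s => (c s).1) \o shift t) (h *: (1 : R)) - (c t).1)) @ 0^' --> ('D_1 c t).1.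
  exact: (@cvg_comp _ _ _ _ fst _ _ _ dc' cvg_fst).
have C2 : (fun h : R => h^-1 *: (((fun s => (c s).2) \o shift t) (h *: (1 : R)) - (c t).2)) @ 0^' --> ('D_1 c t).2.
  exact: (@cvg_comp _ _ _ _ snd _ _ _ dc' cvg_snd).
split; apply: DeriveDef.
- exact: cvgP C1.
- exact: cvg_lim C1.
- exact: cvgP C2.
- exact: cvg_lim C2.
Qed.

Lemma cont_pair (c1 c2 : R -> R) t : {for t, continuous c1} -> {for t, continuous c2} ->
  {for t, continuous (fun s => (c1 s, c2 s))}.
Proof. by move=> h1 h2; exact: cvg_pair h1 h2. Qed.

Lemma Ck1_C1box U h x0 y0 r : Ck 1 U h -> (forall x y, box x0 y0 r x y -> U (x, y)) ->
  C1box x0 y0 r (fun x y => h (x, y)) (fun x y => 'D_e_x h (x, y)) (fun x y => 'D_e_y h (x, y)).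
Proof.
move=> [_ [dh [cx _] [cy _]]] BU x y /BU Uxy; have [dx dy] := dh _ Uxy; split.
- exact/(is_derive_ex h (x, y))/derivableP.
- exact/(is_derive_ey h (x, y))/derivableP.
- exact: (@cont2_uncurry _ (fun p => 'D_e_x h p) x y (cx _ Uxy)).
- exact: (@cont2_uncurry _ (fun p => 'D_e_y h p) x y (cy _ Uxy)).
Qed.

Lemma for_continuous_locally (f g : R * R -> R) x y r : 0 < r ->
  (forall x' y', box x y r x' y' -> f (x', y') = g (x', y')) ->
  {for (x, y), continuous f} -> {for (x, y), continuous g}.
Proof.
move=> r0 fg cf; have E (k : R * R -> R) : (fun p : R * R => k (p.1, p.2)) = k by apply/funext => -[].
have := @cont2_locally R (fun x y => f (x, y)) (fun x y => g (x, y)) x y r r0 fg.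
by rewrite /cont2 !E; exact.
Qed.

Lemma Ck1_of_local U h : (forall x y, U (x, y) -> exists r fx fy, 0 < r /\
  C1box x y r (fun x y => h (x, y)) fx fy) -> Ck 1 U h.
Proof.
move=> H; have E (k : R * R -> R) : (fun p : R * R => k (p.1, p.2)) = k by apply/funext => -[].
have D x y r fx fy x' y' : C1box x y r (fun x y => h (x, y)) fx fy -> box x y r x' y' ->
    is_derive (x', y') (e_x : R * R) h (fx x' y') /\ is_derive (x', y') (e_y : R * R) h (fy x' y').
  move=> HC /HC[d1 d2 _ _]; split; [exact/(is_derive_ex h (x', y'))|exact/(is_derive_ey h (x', y'))].
split; [|split].
- move=> [x y] /H[r [fx [fy [r0 HC]]]].
  by have := C1box_cont2 HC (box_center x y r0); rewrite /cont2 E.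
- move=> [x y] /H[r [fx [fy [r0 HC]]]].
  by have [[? _] [? _]] := D _ _ _ _ _ _ _ HC (box_center x y r0).
- split => // -[x y] /H[r [fx [fy [r0 HC]]]].
  apply: (@for_continuous_locally (fun p => fx p.1 p.2) _ _ _ r) => //.
    by move=> x' y' b; have [[_ ->] _] := D _ _ _ _ _ _ _ HC b.
  by have [_ _ ? _] := HC _ _ (box_center x y r0).
- split => // -[x y] /H[r [fx [fy [r0 HC]]]].
  apply: (@for_continuous_locally (fun p => fy p.1 p.2) _ _ _ r) => //.
    by move=> x' y' b; have [_ [_ ->]] := D _ _ _ _ _ _ _ HC b.
  by have [_ _ _ ?] := HC _ _ (box_center x y r0).
Qed.

Lemma open_box U x y : open U -> U (x, y) ->
  exists2 r, 0 < r & forall x' y', box x y r x' y' -> U (x', y').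
Proof.
move=> oU Uxy; have /nbhs_ballP[d /= d0 Hd] := oU _ Uxy.
by exists d => // x' y' [h1 h2]; apply: Hd; split; rewrite /ball/= distrC.
Qed.

Definition itv0 (r : R) : set R := [set s | `|s| < r].

Lemma itv0_open r : open (itv0 r).
Proof.
rewrite (_ : itv0 r = ball (0 : R) r); first exact: ball_open.
by apply/seteqP; split => s; rewrite /ball/= sub0r normrN.
Qed.

Lemma itv0_interval r : is_interval (itv0 r).
Proof.
move=> s t; rewrite /itv0 /= !ltr_norml => /andP[? ?] /andP[? ?] z; rewrite ltr_norml => /andP[? ?].
by apply/andP; split; lra.
Qed.

(** The new parameter is the primitive [T] of [lam]; its inverse [K] turns a curve of nonvanishing
    speed along [V] into an integral curve. *)
Lemma reparametrize V U (c1 c2 lam : R -> R) t r : 0 < r ->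
  (forall s, `|s - t| < r -> [/\ U (c1 s, c2 s), lam s != 0, {for s, continuous lam},
     is_derive s 1 c1 (lam s * (V (c1 s, c2 s)).1) & is_derive s 1 c2 (lam s * (V (c1 s, c2 s)).2)]) ->
  exists r' (c : R -> R * R), [/\ 0 < r', integral_curve V U (itv0 r') c, c 0 = (c1 t, c2 t) &
    exists (T : R -> R) d, [/\ 0 < d, T t = 0, is_derive t 1 T (lam t) &
      forall s, `|s - t| < d -> c (T s) = (c1 s, c2 s)]].
Proof.
move=> r0 H; have tt : `|t - t| < r by rewrite subrr normr0.
have [_ l0 cl _ _] := H _ tt.
(* [implicit_function] asks for a positive derivative, so [lam] is multiplied by its sign at [t]. *)
pose sg := Num.sg (lam t); have sg2 : sg * sg = 1.
  by rewrite /sg -expr2 sqr_sg l0.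
have sl : 0 < sg * lam t by rewrite -normrEsg normr_gt0.
have csl s : `|s - t| < r -> {for s, continuous (fun s => sg * lam s)}.
  by move=> /H[_ _ ? _ _]; apply: continuousM => //; exact: cvg_cst.
have [d1 d10 D1] := (cont1P _ _).1 (csl _ tt) _ sl.
pose p := Num.min d1 r; have p0 : 0 < p by rewrite lt_min d10.
have [pd pr] : p <= d1 /\ p <= r by rewrite !ge_min !lexx orbT.
pose L := prim t (fun s => sg * lam s).
(* The inverse function theorem is the implicit one for a function that ignores its first
   variable. *)
have HL : C1box 0 t p (fun _ y => L y) (fun _ _ => 0) (fun _ y => sg * lam y).
  move=> x y [_ yt]; have yr := lt_le_trans yt pr; split.
  - exact: is_derive_cst.
  - exact: (is_derive_prim csl).
  - exact: cont2_cst.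
  - by apply: (@cont2_fun1 _ (fun s => sg * lam s) (fun _ y => y)); [exact: csl|exact: cont2_snd].
have Lp x y : box 0 t p x y -> 0 < sg * lam y.
  by move=> [_ yt]; have := D1 y (lt_le_trans yt pd); rewrite ltr_norml => /andP[h _]; clear -h; lra.
have [q [k [/andP[q0 qp] kP kK Hk]]] := implicit_function p0 HL Lp.
have L0 : L t = 0 by exact: primxx.
rewrite L0 in kP kK Hk.
have b0 s : `|s| < q -> box 0 0 q 0 s by move=> sq; split; rewrite ?subrr ?normr0 ?subr0.
have sgn s : `|sg * s| = `|s|.
  by rewrite normrM /sg normr_sg l0 mul1r.
pose K s := k 0 (sg * s).
have dK s : `|s| < q -> is_derive s 1 K (lam (K s))^-1.
  move=> sq; have bs : box 0 0 q 0 (sg * s) by apply: b0; rewrite sgn.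
  have [_ dk _ _] := Hk _ _ bs.
  have dsg : is_derive s 1 (fun s => sg * s) sg.
    by exact: is_derive_lin.
  apply: (is_derive_val (is_derive_compR dsg dk)); rewrite -/(K s).
  have [bk _] := kP _ _ bs; have := Lp _ _ bk; rewrite -/(K s) => l1.
  have lN : lam (K s) != 0 by apply/eqP => z; rewrite z mulr0 ltxx in l1.
  have sN : sg != 0 by apply/eqP => z; rewrite z mul0r ltxx in l1.
  by field; rewrite lN sN.
have KP s : `|s| < q -> `|K s - t| < r.
  move=> sq; have [[_ h] _] := kP 0 (sg * s) (b0 (sg * s) ltac:(by rewrite sgn)).
  exact: lt_le_trans pr.
exists q, (fun s => (c1 (K s), c2 (K s))); split => //.
- split; [exact: itv0_open|exact: itv0_interval|move=> s sq].
  have [HU lN _ dc1 dc2] := H _ (KP _ sq); split => //.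
  have d1' := is_derive_compR (dK _ sq) dc1; have d2' := is_derive_compR (dK _ sq) dc2.
  have := is_derive_pair d1' d2'; congr is_derive.
  by rewrite [RHS]surjective_pairing; congr (_, _); field.
- have Kt : K 0 = t.
    rewrite /K mulr0 -[X in k _ X]L0; apply: kK; first by split; rewrite subrr normr0.
    by rewrite L0; apply: b0; rewrite normr0.
  by rewrite Kt.
pose T s := sg * L s.
have dT : is_derive t 1 T (lam t).
  have -> : lam t = sg * (sg * lam t) by rewrite mulrA sg2 mul1r.
  by apply: is_deriveZ; exact: (is_derive_prim csl tt).
have [d3 d30 D3] := (cont1P _ _).1 (is_derive_cont dT) _ q0.
have T0 : T t = 0 by rewrite /T L0 mulr0.
exists T, (Num.min d3 p); split => //; first by rewrite lt_min d30.
move=> s; rewrite lt_min => /andP[s1 s2].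
have : `|T s| < q by have := D3 s s1; rewrite T0 subr0.
rewrite /T sgn => Lq.
rewrite /K /T mulrA sg2 mul1r kK//; last by apply: b0.
by split; rewrite ?subrr ?normr0.
Qed.

Lemma derivative_along_reparam V U h (l : R) (c1 c2 lam : R -> R) t r : 0 < r ->
  derivative_along V U h (c1 t, c2 t) l ->
  (forall s, `|s - t| < r -> [/\ U (c1 s, c2 s), lam s != 0, {for s, continuous lam},
     is_derive s 1 c1 (lam s * (V (c1 s, c2 s)).1) & is_derive s 1 c2 (lam s * (V (c1 s, c2 s)).2)]) ->
  is_derive t 1 (fun s => h (c1 s, c2 s)) (lam t * l).
Proof.
move=> r0 [_ Hl] H; have [r' [c [r'0 ic c0 [T [d [d0 T0 dT cT]]]]]] := reparametrize r0 H.
have D := Hl _ _ ic _ c0.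
have {}D : is_derive (T t) 1 (h \o c) l by rewrite T0; apply: D; rewrite /itv0/= normr0.
apply: (@is_derive_locally _ (fun s => (h \o c) (T s)) _ _ _ d) => //.
  by move=> s /cT /= ->.
by have := is_derive_compR dT D; rewrite mulrC.
Qed.

End Bridge.

(** * The gradient of u along a characteristic *)

Section Along.
Context {R : realType}.
Implicit Types (a b x y r s t e d m : R) (f : R -> R -> R).

Lemma derive_bound (G : R -> R) (l M d : R) : 0 < d -> is_derive (0 : R) 1 G l -> G 0 = 0 ->
  (forall e, `|e| < d -> `|G e| <= M * `|e|) -> `|l| <= M.
Proof.
move=> d0 dG G0 HM; apply/ler_addgt0Pr => e e0.
have [d1 d10 H] := (is_deriveP _ _ _).1 dG _ e0.
pose t := Num.min d d1 / 2.
have m0 : 0 < Num.min d d1 by rewrite lt_min d0.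
have t0 : 0 < t by rewrite divr_gt0.
have [td td1] : t < d /\ t < d1.
  have [h1 h2] : Num.min d d1 <= d /\ Num.min d d1 <= d1 by rewrite !ge_min !lexx orbT.
  by split; rewrite /t; clear -h1 h2 m0; lra.
have nt : `|t| = t by rewrite gtr0_norm.
have := H t; rewrite subr0 nt G0 subr0 => /(_ td1) h1.
have := HM t; rewrite nt => /(_ td) h2.
have : `|l| * t <= (M + e) * t.
  rewrite -[in leLHS]nt -normrM mulrDl.
  have -> : l * t = G t - (G t - l * t) by ring.
  by apply: (le_trans (ler_normB _ _)); exact: lerD.
by rewrite ler_pM2r.
Qed.

(** At [e = 0] the quotient is filled in with the derivative. Joint continuity at [(0, 0)], where
    base point and increment vary together, is strict differentiability. *)
Lemma directional_quotient x0 y0 r f fx fy (c1 c2 : R -> R) a b : 0 < r -> C1box x0 y0 r f fx fy ->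
  c1 0 = x0 -> c2 0 = y0 -> {for 0, continuous c1} -> {for 0, continuous c2} ->
  exists al, [/\ cont2 al 0 0, al 0 0 = a * fx x0 y0 + b * fy x0 y0 &
    forall s e, f (c1 s + e * a) (c2 s + e * b) - f (c1 s) (c2 s) = e * al s e].
Proof.
move=> r0 Hf c10 c20 cc1 cc2.
pose l := a * fx x0 y0 + b * fy x0 y0.
pose al s e := if e == 0 then l else (f (c1 s + e * a) (c2 s + e * b) - f (c1 s) (c2 s)) / e.
exists al; split; last first.
- move=> s e; rewrite /al; case: eqP => [->|/eqP e0]; last by rewrite [RHS]mulrC divfK.
  by rewrite !mul0r !addr0 subrr.
- by rewrite /al eqxx.
apply/cont2P => e e0; have al0 : al 0 0 = l by rewrite /al eqxx.
pose K := `|a| + `|b| + 1.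
have K0 : 0 < K by rewrite /K ltr_wpDl// addr_ge0.
have eK : 0 < e / K by rewrite divr_gt0.
have [d d0 Hd] := C1box_strict r0 Hf eK.
have q1 : cont2 (fun s e => c1 s + e * a) (0 : R) (0 : R).
  apply: (@cont2D _ (fun s _ => c1 s)); first by apply: (@cont2_fun1 _ c1 (fun x _ => x)); [exact: cc1|exact: cont2_fst].
  by apply: cont2M; [exact: cont2_snd|exact: cont2_cst].
have q2 : cont2 (fun s e => c2 s + e * b) (0 : R) (0 : R).
  apply: (@cont2D _ (fun s _ => c2 s)); first by apply: (@cont2_fun1 _ c2 (fun x _ => x)); [exact: cc2|exact: cont2_fst].
  by apply: cont2M; [exact: cont2_snd|exact: cont2_cst].
have [d1 d10 H1] := (cont2P _ _ _).1 q1 _ d0; have [d2 d20 H2] := (cont2P _ _ _).1 q2 _ d0.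
rewrite !mul0r !addr0 c10 in H1; rewrite !mul0r !addr0 c20 in H2.
exists (Num.min d1 d2); first by rewrite lt_min d10.
move=> s t; rewrite !subr0 !lt_min => /andP[s1 s2] /andP[t1 t2]; rewrite al0.
have bq : box x0 y0 d (c1 s + t * a) (c2 s + t * b).
  by split; [apply: H1|apply: H2]; rewrite subr0.
have bc : box x0 y0 d (c1 s) (c2 s).
  split; [have := H1 s 0|have := H2 s 0]; rewrite !mul0r !addr0 subrr normr0 subr0; exact.
rewrite /al; case: eqP => [_|/eqP tN]; first by rewrite subrr normr0.
have := Hd _ _ _ _ bc bq.
rewrite ![_ + _ - c1 s]addrAC ![_ + _ - c2 s]addrAC !subrr !add0r !normrM -mulrDr.
set X := f _ _; set Y := f _ _ => h.
have -> : (X - Y) / t - l = (X - Y - fx x0 y0 * (t * a) - fy x0 y0 * (t * b)) / t.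
  by rewrite /l; field.
rewrite normrM normfV ltr_pdivrMr ?normr_gt0//; apply: (le_lt_trans h).
have tp : 0 < `|t| by rewrite normr_gt0.
rewrite mulrCA [ltRHS]mulrC ltr_pM2l// -mulrA gtr_pMr// mulrC ltr_pdivrMr// mul1r /K.
by rewrite ltrDl.
Qed.

(* For [g_e s = u (c s + e v) - u (c s)] one has [g_e' = e K], with [K] continuous
   at [(0, 0)] although [D] itself is not known to be differentiable. *)
Lemma gradient_along (n1 n1x n1y n2 n2x n2y D F1 F1x F1y F2 F2x F2y u : R -> R -> R)
    x0 y0 r p (c1 c2 : R -> R) a b : 0 < r -> 0 < p ->
  C1box x0 y0 r n1 n1x n1y -> C1box x0 y0 r n2 n2x n2y ->
  C1box x0 y0 r F1 F1x F1y -> C1box x0 y0 r F2 F2x F2y -> cont2 D x0 y0 ->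
  C1box x0 y0 r u (fun x y => D x y * n1 x y - F1 x y) (fun x y => D x y * n2 x y - F2 x y) ->
  c1 0 = x0 -> c2 0 = y0 ->
  (forall s, `|s| < p -> is_derive s 1 c1 (n2 (c1 s) (c2 s)) /\
    is_derive s 1 c2 (- n1 (c1 s) (c2 s))) ->
  is_derive (0 : R) 1 (fun s => a * (D (c1 s) (c2 s) * n1 (c1 s) (c2 s) - F1 (c1 s) (c2 s))
    + b * (D (c1 s) (c2 s) * n2 (c1 s) (c2 s) - F2 (c1 s) (c2 s)))
    (D x0 y0 * ((a * n1x x0 y0 + b * n1y x0 y0) * n2 x0 y0 - (a * n2x x0 y0 + b * n2y x0 y0) * n1 x0 y0)
     - ((a * F1x x0 y0 + b * F1y x0 y0) * n2 x0 y0 - (a * F2x x0 y0 + b * F2y x0 y0) * n1 x0 y0)).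
Proof.
move=> r0 p0 Hn1 Hn2 HF1 HF2 cD Hu c10 c20 Hc.
have [dc1 dc2] : is_derive (0 : R) 1 c1 (n2 (c1 0) (c2 0)) /\ is_derive (0 : R) 1 c2 (- n1 (c1 0) (c2 0)).
  by apply: Hc; rewrite normr0.
have cc1 := is_derive_cont dc1; have cc2 := is_derive_cont dc2.
have bc := box_center x0 y0 r0.
have [a1 [ca1 a10 Ea1]] := directional_quotient a b r0 Hn1 c10 c20 cc1 cc2.
have [a2 [ca2 a20 Ea2]] := directional_quotient a b r0 Hn2 c10 c20 cc1 cc2.
have [b1 [cb1 b10 Eb1]] := directional_quotient a b r0 HF1 c10 c20 cc1 cc2.
have [b2 [cb2 b20 Eb2]] := directional_quotient a b r0 HF2 c10 c20 cc1 cc2.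
pose q1 s e := c1 s + e * a; pose q2 s e := c2 s + e * b.
have k1 : cont2 (fun s _ => c1 s) (0 : R) (0 : R) by apply: (@cont2_fun1 _ c1 (fun x _ => x)); [exact: cc1|exact: cont2_fst].
have k2 : cont2 (fun s _ => c2 s) (0 : R) (0 : R) by apply: (@cont2_fun1 _ c2 (fun x _ => x)); [exact: cc2|exact: cont2_fst].
have cq1 : cont2 q1 0 0.
  by apply: (@cont2D _ (fun s _ => c1 s)) => //; apply: cont2M; [exact: cont2_snd|exact: cont2_cst].
have cq2 : cont2 q2 0 0.
  by apply: (@cont2D _ (fun s _ => c2 s)) => //; apply: cont2M; [exact: cont2_snd|exact: cont2_cst].
have q10 : q1 0 0 = x0 by rewrite /q1 mul0r addr0.
have q20 : q2 0 0 = y0 by rewrite /q2 mul0r addr0.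
(* On the curve, [D] drops out of the derivative of [u] along N^perp. On the translate its
   coefficient pairs the normal there with N^perp on the curve and is of order [e]; after division
   by [e], [D] is evaluated but never differentiated. *)
pose K s e := D (q1 s e) (q2 s e) * (a1 s e * n2 (c1 s) (c2 s) - a2 s e * n1 (c1 s) (c2 s))
  - (b1 s e * n2 (c1 s) (c2 s) - b2 s e * n1 (c1 s) (c2 s)).
set Q := (X in is_derive _ _ _ X).
have K00 : K 0 0 = Q by rewrite /K q10 q20 a10 a20 b10 b20 c10 c20.
have cn1 : cont2 (fun s _ => n1 (c1 s) (c2 s)) (0 : R) (0 : R).
  by apply: (@cont2_comp _ n1 (fun s _ => c1 s) (fun s _ => c2 s)); rewrite ?c10 ?c20//; exact: C1box_cont2 Hn1 bc.
have cn2 : cont2 (fun s _ => n2 (c1 s) (c2 s)) (0 : R) (0 : R).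
  by apply: (@cont2_comp _ n2 (fun s _ => c1 s) (fun s _ => c2 s)); rewrite ?c10 ?c20//; exact: C1box_cont2 Hn2 bc.
have cK : cont2 K 0 0.
  apply: cont2B; last first.
    by apply: cont2B; [exact: (cont2M cb1 cn2)|exact: (cont2M cb2 cn1)].
  apply: cont2M; last by apply: cont2B; [exact: (cont2M ca1 cn2)|exact: (cont2M ca2 cn1)].
  by apply: (@cont2_comp _ D q1 q2) => //; rewrite q10 q20.
apply/is_deriveP => e e0.
have [d d0 Hd] := (cont2P _ _ _).1 cK _ e0.
have [d1 d10 H1] := (cont2P _ _ _).1 cq1 _ r0; have [d2 d20 H2] := (cont2P _ _ _).1 cq2 _ r0.
rewrite q10 in H1; rewrite q20 in H2; rewrite K00 in Hd.
pose m := Num.min (Num.min d p) (Num.min d1 d2).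
have m0 : 0 < m by rewrite !lt_min d0 p0 d10 d20.
have [md mp m1 m2] : [/\ m <= d, m <= p, m <= d1 & m <= d2].
  by rewrite /m !ge_min !lexx !orbT.
have bq s t : `|s| < m -> `|t| < m -> box x0 y0 r (q1 s t) (q2 s t).
  move=> sm tm; split; [apply: H1|apply: H2]; rewrite subr0.
  - exact: lt_le_trans m1.
  - exact: lt_le_trans m1.
  - exact: lt_le_trans m2.
  - exact: lt_le_trans m2.
have bqc s : `|s| < m -> box x0 y0 r (c1 s) (c2 s).
  by move=> sm; have := bq s 0 sm; rewrite /q1 /q2 !mul0r !addr0 normr0; exact.
exists m => // s; rewrite subr0 => sm.
pose g t s := u (q1 s t) (q2 s t) - u (c1 s) (c2 s).
have dg t s' : `|t| < m -> `|s'| < m -> is_derive s' 1 (g t) (t * K s' t).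
  move=> tm s'm; have [e1 e2] := Hc _ (lt_le_trans s'm mp).
  have D1 := tdiff_curve (C1box_tdiff Hu (bqc _ s'm)) e1 e2.
  have f1 : is_derive s' 1 (fun s => q1 s t) (n2 (c1 s') (c2 s')).
    by rewrite -[X in is_derive _ _ _ X]addr0; apply: is_deriveD.
  have f2 : is_derive s' 1 (fun s => q2 s t) (- n1 (c1 s') (c2 s')).
    by rewrite -[X in is_derive _ _ _ X]addr0; apply: is_deriveD.
  have D2 := @tdiff_curve _ u (q1^~ t) (q2^~ t) s' _ _ _ _ (C1box_tdiff Hu (bq _ _ s'm tm)) f1 f2.
  have DB := is_deriveB D2 D1; apply: (is_derive_val DB).
  rewrite /K; have := Ea1 s' t; have := Ea2 s' t; have := Eb1 s' t; have := Eb2 s' t.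
  rewrite -!/(q1 _ _) -!/(q2 _ _) => h1 h2 h3 h4.
  transitivity (D (q1 s' t) (q2 s' t) * (t * a1 s' t * n2 (c1 s') (c2 s') - t * a2 s' t * n1 (c1 s') (c2 s'))
    - (t * b1 s' t * n2 (c1 s') (c2 s') - t * b2 s' t * n1 (c1 s') (c2 s'))); last by ring.
  by rewrite -h1 -h2 -h3 -h4; ring.
(* The bound is linear in |t|, so it survives differentiation in [t] at 0, which turns the
   increments of [u] into values of its gradient. *)
have gb t : `|t| < m -> `|g t s - g t 0 - Q * s * t| <= e * `|s| * `|t|.
  move=> tm; have -> : g t s - g t 0 - Q * s * t = (g t s - t * Q * s) - (g t 0 - t * Q * 0) by ring.
  have -> : e * `|s| * `|t| = (`|t| * e) * `|s - 0| by rewrite subr0; ring.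
  apply: (@mean_value_le _ (fun s => g t s - t * Q * s) (fun s => t * K s t - t * Q)) => s' /btw_dist; rewrite !subr0 => s'I.
    have D1 := dg _ _ tm (le_lt_trans s'I sm).
    have D2 : is_derive s' 1 (fun s => t * Q * s) (t * Q).
      by exact: is_derive_lin.
    exact: is_deriveB.
  rewrite -mulrBr normrM ler_wpM2l//; apply/ltW/Hd; rewrite subr0.
    exact: lt_le_trans (le_lt_trans s'I sm) md.
  exact: lt_le_trans tm md.
have dq s' : `|s'| < m -> is_derive (0 : R) 1 (fun t => g t s')
   ((D (c1 s') (c2 s') * n1 (c1 s') (c2 s') - F1 (c1 s') (c2 s')) * a
    + (D (c1 s') (c2 s') * n2 (c1 s') (c2 s') - F2 (c1 s') (c2 s')) * b).
  move=> s'm.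
  have lin (z v : R) : is_derive (0 : R) 1 (fun t => z + t * v) v.
    by rewrite -[X in is_derive _ _ _ X]add0r; apply: is_deriveD; rewrite -[X in is_derive _ _ _ X]mul1r; exact: is_deriveMc.
  have T : tdiff u (c1 s' + 0 * a) (c2 s' + 0 * b)
      (D (c1 s') (c2 s') * n1 (c1 s') (c2 s') - F1 (c1 s') (c2 s'))
      (D (c1 s') (c2 s') * n2 (c1 s') (c2 s') - F2 (c1 s') (c2 s')).
    by rewrite !mul0r !addr0; exact: (C1box_tdiff Hu (bqc _ s'm)).
  have D1 := @tdiff_curve _ u (fun t => c1 s' + t * a) (fun t => c2 s' + t * b) 0 _ _ _ _ T (lin _ _) (lin _ _).
  by rewrite -[X in is_derive _ _ _ X]subr0; exact: is_deriveB.
have zm : `|0 : R| < m by rewrite normr0.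
pose G t := g t s - g t 0 - Q * s * t.
have dG : is_derive (0 : R) 1 G
   ((D (c1 s) (c2 s) * n1 (c1 s) (c2 s) - F1 (c1 s) (c2 s)) * a
    + (D (c1 s) (c2 s) * n2 (c1 s) (c2 s) - F2 (c1 s) (c2 s)) * b
    - ((D (c1 0) (c2 0) * n1 (c1 0) (c2 0) - F1 (c1 0) (c2 0)) * a
    + (D (c1 0) (c2 0) * n2 (c1 0) (c2 0) - F2 (c1 0) (c2 0)) * b) - Q * s).
  have D1 := dq _ sm; have D2 := dq _ zm.
  have D3 : is_derive (0 : R) 1 (fun t => Q * s * t) (Q * s).
    by exact: is_derive_lin.
  have D12 := is_deriveB D1 D2.
  exact: (is_deriveB D12 D3).
have G0 : G 0 = 0 by rewrite /G /g /q1 /q2 !mul0r !addr0 !subrr mulr0 subr0.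
have := derive_bound m0 dG G0 gb.
set X := (X in `|X| <= _); set Y := (X in _ -> `|X| <= _).
by have -> : X = Y by rewrite /X /Y; ring.
Qed.

End Along.

(** * Continuous angles of a C^1 unit field *)

Section AngleFunction.
Context {R : realType}.
Implicit Types (a b x y r s t e d m : R) (f : R -> R -> R).

(** Near the center [th = asin (sin (th - t0)) + t0], where [sin (th - t0)] is a linear combination
    of [n1] and [n2]. Continuity of [th] keeps its oscillation below 1, hence below pi / 2. *)
Lemma angle_C1box x0 y0 r (n1 n1x n1y n2 n2x n2y th : R -> R -> R) : 0 < r ->
  C1box x0 y0 r n1 n1x n1y -> C1box x0 y0 r n2 n2x n2y -> cont2 th x0 y0 ->
  (forall x y, box x0 y0 r x y -> n1 x y = cos (th x y) /\ n2 x y = sin (th x y)) ->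
  exists2 r', 0 < r' <= r & C1box x0 y0 r' th (fun x y => n1 x y * n2x x y - n2 x y * n1x x y)
    (fun x y => n1 x y * n2y x y - n2 x y * n1y x y).
Proof.
move=> r0 H1 H2 cth Hth; have [d d0 Hd] := (cont2P _ _ _).1 cth _ ltr01.
pose r' := Num.min d r; have r'0 : 0 < r' by rewrite lt_min d0.
have [r'd r'r] : r' <= d /\ r' <= r by rewrite /r' !ge_min !lexx orbT.
pose A := n1 x0 y0; pose B := n2 x0 y0; pose t0 := th x0 y0.
pose w x y := n2 x y * A - n1 x y * B.
have [At Bt] := Hth _ _ (box_center x0 y0 r0).
have D1 x y : box x0 y0 r' x y -> `|th x y - t0| < 1.
  by move=> [h1 h2]; apply: Hd; exact: lt_le_trans r'd.
have wE x y : box x0 y0 r' x y -> w x y = sin (th x y - t0).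
  by move=> /(box_le r'r)/Hth[h1 h2]; rewrite /w /A /B sinB h1 h2 At Bt; ring.
have pi1 := pihalf_ge1 R.
have cp x y : box x0 y0 r' x y -> 0 < cos (th x y - t0).
  move=> /D1; rewrite ltr_norml => /andP[h1 h2]; apply: cos_gt0_pihalf.
  by apply/andP; split; clear -h1 h2 pi1; lra.
have ww x y : box x0 y0 r' x y -> w x y ^+ 2 < 1.
  move=> bxy; rewrite wE// -(cos2Dsin2 (th x y - t0)) ltrDr exprn_gt0//; exact: cp.
have wI x y : box x0 y0 r' x y -> -1 < w x y < 1.
  by move=> /ww h; rewrite -ltr_norml -(ltr_pXn2r (n := 2)) ?nnegrE// expr1n real_normK ?num_real.
have HM f fx fy c : C1box x0 y0 r f fx fy ->
    C1box x0 y0 r' (fun x y => f x y * c) (fun x y => fx x y * c) (fun x y => fy x y * c).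
  move=> Hf x y /(box_le r'r)/Hf[? ? ? ?].
  by split; [exact: is_deriveMc|exact: is_deriveMc|apply: cont2M => //; exact: cont2_cst..].
have Hw := C1boxB (HM _ _ _ A H2) (HM _ _ _ B H1).
have cas x y : box x0 y0 r' x y -> {for w x y, continuous (fun z : R => (Num.sqrt (1 - z ^+ 2))^-1)}.
  move=> bxy; have /andP[wm wp] := wI _ _ bxy; have s0 : 0 < 1 - (w x y) ^+ 2 by rewrite subr_gt0 ww.
  apply: continuousV; first by rewrite sqrtr_eq0 -ltNge.
  apply: (@continuous_comp _ _ _ (fun z : R => 1 - z ^+ 2) Num.sqrt).
    by apply: continuousB; [exact: cvg_cst|exact: exprn_continuous].
  exact: sqrt_continuous.
have Ha := C1box_comp1 Hw (fun x y bxy => is_derive1_asin (wI x y bxy)) cas.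
have Hc : C1box x0 y0 r' (fun _ _ => t0) (fun _ _ => 0) (fun _ _ => 0).
  by move=> x y _; split; [exact: is_derive_cst|exact: is_derive_cst|exact: cont2_cst..].
have thE x y : box x0 y0 r' x y -> asin (w x y) + t0 = th x y.
  move=> bxy; rewrite wE// sinK ?subrK// in_itv/=; have := D1 _ _ bxy; rewrite ltr_norml => /andP[h1 h2].
  by apply/andP; split; clear -h1 h2 pi1; lra.
have Hth' := C1box_eq thE (C1boxD Ha Hc).
exists r'; first by rewrite r'0.
apply: (eq_C1box _ Hth') => x y bxy.
(* The derivative of an angle is the cross product of the unit vector with its derivative. *)
have E (c : R) (g m1 m2 : R -> R) (l l1 l2 : R) : is_derive c 1 g l -> is_derive c 1 m1 l1 -> is_derive c 1 m2 l2 ->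
    (exists2 d, 0 < d & forall s, `|s - c| < d -> m1 s = cos (g s) /\ m2 s = sin (g s)) ->
    l = m1 c * l2 - m2 c * l1.
  move=> dg dm1 dm2 [e e0 He].
  have ds : is_derive c 1 m2 (cos (g c) * l).
    by apply: (@is_derive_locally _ (fun s => sin (g s)) _ _ _ e) => // [s /He[_ ->]//]; exact: is_derive_compR.
  have dc : is_derive c 1 m1 (- sin (g c) * l).
    by apply: (@is_derive_locally _ (fun s => cos (g s)) _ _ _ e) => // [s /He[->]//]; exact: is_derive_compR.
  rewrite (is_derive1_uniq dm1 dc) (is_derive1_uniq dm2 ds).
  have [-> ->] : m1 c = cos (g c) /\ m2 c = sin (g c) by apply: He; rewrite subrr normr0.
  rewrite -[LHS]mul1r -(cos2Dsin2 (g c)); ring.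
have [e e0 He] := box_open bxy; have bxy' := box_le r'r bxy.
have [dx dy _ _] := Hth' _ _ bxy; have [d1x d1y _ _] := H1 _ _ bxy'; have [d2x d2y _ _] := H2 _ _ bxy'.
have z : `|x - x| < e /\ `|y - y| < e by rewrite !subrr normr0.
split; [apply: (E _ _ _ _ _ _ _ dx d1x d2x)|apply: (E _ _ _ _ _ _ _ dy d1y d2y)];
  by exists e => // s se; apply/Hth/(box_le r'r)/He; split => //; case: z.
Qed.

End AngleFunction.

(** * The Euclidean norm, and integral curves of C^1 fields *)

Section Field.
Context {R : realType}.
Implicit Types (a b x y r s t e d m : R).

Lemma euclid_gt0 (v : R * R) : v <> 0 -> 0 < euclid v.
Proof.
move=> v0; rewrite /euclid /dot sqrtr_gt0 -!expr2 lt_neqAle addr_ge0 ?sqr_ge0// andbT eq_sym.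
rewrite paddr_eq0 ?sqr_ge0// !sqrf_eq0; apply/negP => /andP[/eqP h1 /eqP h2]; apply: v0.
by rewrite (surjective_pairing v) h1 h2.
Qed.

Lemma euclid_sqr (v : R * R) : euclid v ^+ 2 = v.1 ^+ 2 + v.2 ^+ 2.
Proof. by rewrite /euclid /dot -!expr2 sqr_sqrtr// addr_ge0 ?sqr_ge0. Qed.

Lemma C2_integral_curve (U : set (R * R)) (V : R * R -> R * R) (I : set R) (c : R -> R * R) :
  open U -> Ck_field 1 U V -> integral_curve V U I c -> C2_curve I c.
Proof.
move=> oU [V1 V2] [oI _ Ic].
pose A s := 'D_e_x (fun p => (V p).1) (c s) * (V (c s)).1 + 'D_e_y (fun p => (V p).1) (c s) * (V (c s)).2.
pose B s := 'D_e_x (fun p => (V p).2) (c s) * (V (c s)).1 + 'D_e_y (fun p => (V p).2) (c s) * (V (c s)).2.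
have dV s : I s -> is_derive s 1 (fun t => V (c t)) (A s, B s).
  move=> Is; have [Ucs dc] := Ic _ Is; have [dc1 dc2] := is_derive_proj dc.
  have Ucs' : U ((c s).1, (c s).2) by rewrite -surjective_pairing.
  have [r r0 br] := open_box oU Ucs'.
  have T1 := C1box_tdiff (Ck1_C1box V1 br) (box_center _ _ r0).
  have T2 := C1box_tdiff (Ck1_C1box V2 br) (box_center _ _ r0).
  have D := is_derive_pair (tdiff_curve T1 dc1 dc2) (tdiff_curve T2 dc1 dc2).
  rewrite -!surjective_pairing in D.
  rewrite (_ : (fun t => V (c t)) = (fun s => ((V ((c s).1, (c s).2)).1, (V ((c s).1, (c s).2)).2))) //.
  by apply/funext => t; rewrite -!surjective_pairing.
have nI s : I s -> \near s, I s by move=> Is; exact: open_nbhs_nbhs.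
have c1 s : I s -> derive1 c s = V (c s) by move=> /Ic[_ [_ <-]]; rewrite derive1E.
have dc1 s : I s -> is_derive s 1 (derive1 c) (A s, B s).
  move=> Is; apply: near_eq_is_derive (dV _ Is); near=> t; rewrite c1//; near: t; exact: nI.
have cc s : I s -> {for s, continuous c}.
  by move=> /Ic[_ [dc _]]; apply: differentiable_continuous; exact/derivable1_diffP.
have cA s : I s -> {for s, continuous A} /\ {for s, continuous B}.
  move=> Is; have [Ucs _] := Ic _ Is.
  have comp (h : R * R -> R) : {for c s, continuous h} -> {for s, continuous (fun t => h (c t))}.
    by move=> ch; apply: continuous_comp => //; exact: cc.
  have [v1 [_ [v1x _] [v1y _]]] := V1; have [v2 [_ [v2x _] [v2y _]]] := V2.
  have k1 := comp _ (v1 _ Ucs); have k2 := comp _ (v2 _ Ucs).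
  have k1x := comp _ (v1x _ Ucs); have k1y := comp _ (v1y _ Ucs).
  have k2x := comp _ (v2x _ Ucs); have k2y := comp _ (v2y _ Ucs).
  split.
  - exact: (continuousD (continuousM k1x k1) (continuousM k1y k2)).
  - exact: (continuousD (continuousM k2x k1) (continuousM k2y k2)).
move=> s Is; split.
- by have [_ [? _]] := Ic _ Is.
- by have [? _] := dc1 _ Is.
have [hA hB] := cA _ Is; have cAB := cont_pair hA hB.
have E t : I t -> derive1 (derive1 c) t = (A t, B t) by move=> /dc1[_ <-]; rewrite derive1E.
rewrite /prop_for /continuous_at E//.
apply: cvg_trans cAB; apply: near_eq_cvg; near=> t; rewrite E//; near: t; exact: nI.
Unshelve. all: by end_near.
Qed.

End Field.

(** * The unit field of a weak solution *)

Section Solution.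
Context {R : realType}.
Implicit Types (a b x y r s t e d m : R).
Variables (Omega : set (R * R)) (F : R * R -> R * R) (u : R * R -> R).
Hypotheses (oO : open Omega) (F_C1 : Ck_field 1 Omega F) (u_C1 : Ck 1 Omega u)
  (nonsing : forall p, Omega p -> grad u p + F p <> 0).
Local Notation N := (normal u F).
Local Notation D := (Dlen u F).

Lemma Dlen_gt0 p : Omega p -> 0 < D p.
Proof. by move=> /nonsing/euclid_gt0. Qed.

Lemma Dlen_normal p : Omega p ->
  D p * (N p).1 = 'D_e_x u p + (F p).1 /\ D p * (N p).2 = 'D_e_y u p + (F p).2.
Proof.
move=> /Dlen_gt0 D0; rewrite /normal /=; have DN : D p != 0 by rewrite gt_eqF.
by split; rewrite /GRing.scale /= mulVKf.
Qed.

Lemma normal_unit p : Omega p -> (N p).1 ^+ 2 + (N p).2 ^+ 2 = 1.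
Proof.
move=> Op; have D0 := Dlen_gt0 Op; have [h1 h2] := Dlen_normal Op.
have : D p ^+ 2 = D p ^+ 2 * ((N p).1 ^+ 2 + (N p).2 ^+ 2).
  by rewrite mulrDr -!exprMn h1 h2 {1}/Dlen euclid_sqr.
rewrite -{1}[D p ^+ 2]mulr1 => /mulfI <-//.
by rewrite expf_neq0// gt_eqF.
Qed.

Lemma Dlen_cont : continuous_in Omega D.
Proof.
move=> p Op; have [_ [_ [ux _] [uy _]]] := u_C1; have [[F1 _] [F2 _]] := F_C1.
have g1 := continuousD (ux _ Op) (F1 _ Op); have g2 := continuousD (uy _ Op) (F2 _ Op).
apply: (@continuous_comp _ _ _ (fun p => dot (grad u p + F p) (grad u p + F p)) Num.sqrt).
  exact: (continuousD (continuousM g1 g1) (continuousM g2 g2)).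
exact: sqrt_continuous.
Qed.

Lemma normal_cont : continuous_in Omega (fun p => (N p).1) /\ continuous_in Omega (fun p => (N p).2).
Proof.
have [_ [_ [ux _] [uy _]]] := u_C1; have [[F1 _] [F2 _]] := F_C1.
split=> p Op; (apply: continuousM; first by apply: continuousV; [rewrite gt_eqF// Dlen_gt0|exact: Dlen_cont]).
  exact: (continuousD (ux _ Op) (F1 _ Op)).
exact: (continuousD (uy _ Op) (F2 _ Op)).
Qed.

Lemma potential_C1box x0 y0 r : (forall x y, box x0 y0 r x y -> Omega (x, y)) ->
  C1box x0 y0 r (fun x y => u (x, y)) (fun x y => D (x, y) * (N (x, y)).1 - (F (x, y)).1)
    (fun x y => D (x, y) * (N (x, y)).2 - (F (x, y)).2).
Proof.
move=> HO; apply: eq_C1box (Ck1_C1box u_C1 HO) => x y /HO/Dlen_normal[-> ->].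
by split; rewrite addrK.
Qed.

Lemma normal_regular H k x y : continuous_in Omega H -> weak_div_eq Omega N H ->
  continuous_derivative_along N Omega H k -> Omega (x, y) ->
  exists r, [/\ 0 < r, forall x' y', box x y r x' y' -> Omega (x', y') &
    regular_at (fun x y => (N (x, y)).1) (fun x y => (N (x, y)).2) x y r].
Proof.
move=> H_C0 weak [k_C0 kH] Oxy; have [r r0 HO] := open_box oO Oxy.
have [c1 c2] := normal_cont.
have C x' y' : box x y r x' y' -> [/\ Omega (x', y'), cont2 (fun x y => (N (x, y)).1) x' y',
    cont2 (fun x y => (N (x, y)).2) x' y' & cont2 (fun x y => H (x, y)) x' y'].
  move=> /HO O'; split => //.
  - exact: (@cont2_uncurry _ (fun p => (N p).1) _ _ (c1 _ O')).
  - exact: (@cont2_uncurry _ (fun p => (N p).2) _ _ (c2 _ O')).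
  - exact: (@cont2_uncurry _ H _ _ (H_C0 _ O')).
(* [weak_potential] yields its potential on a strictly smaller square. *)
pose q := r / 2; have qr : 0 < q < r by rewrite /q; apply/andP; split; lra.
have [q0 qr'] := andP qr; have B x' y' : box x y q x' y' -> box x y r x' y' by exact: box_le (ltW qr').
have HOq x' y' : box x y q x' y' -> Omega (x', y') by move=> /B/HO.
exists q; split => //.
have [F1 F2] : Ck_field 1 Omega F by exact: F_C1.
apply: (@local_regularity _ _ _ (fun x y => D (x, y)) (fun x y => H (x, y)) (fun x y => k (x, y))
  (fun x y => u (x, y)) (fun x y => (F (x, y)).1) _ _ (fun x y => (F (x, y)).2)); split.
- exact: q0.
- move=> x' y' /B/C[Oz ? ? ?]; split => //; exact: (@cont2_uncurry _ k _ _ (k_C0 _ Oz)).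
- by move=> x' y' /HOq; exact: normal_unit.
- by move=> x' y' /HOq; exact: Dlen_gt0.
- move=> c c' lam t p p0 Hc.
  have tp : `|t - t| < p by rewrite subrr normr0.
  have [bt _ _ _ _] := Hc _ tp.
  apply: (derivative_along_reparam p0 (kH _ (HOq _ _ bt))) => s /Hc[b l0 cl d1 d2]; split => //; exact: HOq.
- exact: potential_C1box.
- exact: (Ck1_C1box F1 HOq).
- exact: (Ck1_C1box F2 HOq).
- exact: (weak_potential qr C weak).
Qed.

Lemma normal_C1 H k : continuous_in Omega H -> weak_div_eq Omega N H ->
  continuous_derivative_along N Omega H k -> Ck_field 1 Omega N.
Proof.
move=> H_C0 weak kH; split; apply: Ck1_of_local => x y Oxy;
  have [r [r0 _ [[r' [n1x [n1y [n2x [n2y [r'0 H1 H2]]]]]] _]]] := normal_regular H_C0 weak kH Oxy.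
  by exists r', n1x, n1y.
by exists r', n2x, n2y.
Qed.

Lemma char_curve H k p : continuous_in Omega H -> weak_div_eq Omega N H ->
  continuous_derivative_along N Omega H k -> Omega p ->
  exists I c, [/\ integral_curve (normal_perp u F) Omega I c, I 0 & c 0 = p].
Proof.
case: p => x y H_C0 weak kH Oxy.
have [r [r0 HO [_ [c1 [c2 [lam [t [p [p0 e1 e2 Hc]]]]]]]]] := normal_regular H_C0 weak kH Oxy.
have [|r' [c [r'0 ic c0 _]]] := @reparametrize _ (normal_perp u F) Omega c1 c2 lam t p p0.
  move=> s /Hc[b l0 cl d1 d2]; split => //; first exact: HO.
  by rewrite /normal_perp /perp /= mulrN.
exists (itv0 r'), c; split => //; first by rewrite /itv0/= normr0.
by rewrite c0 e1 e2.
Qed.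

End Solution.

(** * The speed along characteristics *)

Section Speed.
Context {R : realType}.
Implicit Types (a b x y r s t e d m : R).
Variables (Omega : set (R * R)) (F : R * R -> R * R) (u : R * R -> R).
Local Notation N := (normal u F).
Local Notation D := (Dlen u F).

(* [turning] is N(theta), written without the angle. *)
Definition turning p : R :=
  (N p).1 * ((N p).1 * 'D_e_x (fun q => (N q).2) p - (N p).2 * 'D_e_x (fun q => (N q).1) p)
  + (N p).2 * ((N p).1 * 'D_e_y (fun q => (N q).2) p - (N p).2 * 'D_e_y (fun q => (N q).1) p).

Lemma turning_cont : Ck_field 1 Omega N -> continuous_in Omega turning.
Proof.
move=> [[c1 [_ [c1x _] [c1y _]]] [c2 [_ [c2x _] [c2y _]]]] p Op.
have k1 := c1 _ Op; have k1x := c1x _ Op; have k1y := c1y _ Op.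
have k2 := c2 _ Op; have k2x := c2x _ Op; have k2y := c2y _ Op.
apply: (continuousD (continuousM k1 (continuousB (continuousM k1 k2x) (continuousM k2 k1x)))
  (continuousM k2 (continuousB (continuousM k1 k2y) (continuousM k2 k1y)))).
Qed.

Lemma curl_cont : Ck_field 1 Omega F -> continuous_in Omega (curl F).
Proof.
move=> [[_ [_ _ [c1y _]]] [_ [_ [c2x _] _]]] p Op.
exact: (continuousB (c2x _ Op) (c1y _ Op)).
Qed.

Hypotheses (oO : open Omega) (F_C1 : Ck_field 1 Omega F) (u_C1 : Ck 1 Omega u)
  (nonsing : forall p, Omega p -> grad u p + F p <> 0) (N_C1 : Ck_field 1 Omega N).

(** [D = n1 * (D * n1) + n2 * (D * n2)], and [D * n1], [D * n2] are the components of grad u + F, so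
    [gradient_along] in the two coordinate directions applies. *)
Lemma Dlen_along I c : integral_curve (normal_perp u F) Omega I c -> I 0 ->
  is_derive (0 : R) 1 (fun s => D (c s)) (curl F (c 0) - D (c 0) * turning (c 0)).
Proof.
move=> [oI iI Hc] I0; have [Oc0 dc0] := Hc _ I0.
pose c1 s := (c s).1; pose c2 s := (c s).2.
have Oc : Omega (c1 0, c2 0) by rewrite /c1 /c2 -surjective_pairing.
have [r r0 HO] := open_box oO Oc; have bc := box_center (c1 0) (c2 0) r0.
have [F1 F2] : Ck_field 1 Omega F by exact: F_C1.
have [N1 N2] : Ck_field 1 Omega N by exact: N_C1.
have /nbhs_ballP[p /= p0 Hp] : nbhs (0 : R) I by apply: open_nbhs_nbhs; split.
have dc s : `|s| < p -> is_derive s 1 c1 (N (c1 s, c2 s)).2 /\ is_derive s 1 c2 (- (N (c1 s, c2 s)).1).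
  move=> sp; have /Hc[_ /is_derive_proj] : I s by apply: Hp; rewrite /ball/= sub0r normrN.
  by rewrite /normal_perp /perp /= /c1 /c2 -surjective_pairing.
have cD : cont2 (fun x y => D (x, y)) (c1 0) (c2 0).
  exact: (@cont2_uncurry _ (Dlen u F) _ _ (Dlen_cont F_C1 u_C1 Oc)).
have HN1 := Ck1_C1box N1 HO; have HN2 := Ck1_C1box N2 HO.
have HF1 := Ck1_C1box F1 HO; have HF2 := Ck1_C1box F2 HO.
have Hu := potential_C1box u_C1 nonsing HO.
have G a b := gradient_along a b r0 p0 HN1 HN2 HF1 HF2 cD Hu erefl erefl dc.
have z : `|0 : R| < p by rewrite normr0.
have [dc1 dc2] := dc _ z.
have along h hx hy (Hh : C1box (c1 0) (c2 0) r h hx hy) := tdiff_curve (C1box_tdiff Hh bc) dc1 dc2.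
have M1 := is_deriveD (G 1 0) (along _ _ _ HF1).
have M2 := is_deriveD (G 0 1) (along _ _ _ HF2).
have DD := is_deriveD (is_derive_mul (along _ _ _ HN1) M1) (is_derive_mul (along _ _ _ HN2) M2).
have [d d0 Hd] : exists2 d, 0 < d & forall s, `|s - 0| < d -> Omega (c1 s, c2 s).
  exists p => // s; rewrite subr0 => sp; have /Hc[] : I s by apply: Hp; rewrite /ball/= sub0r normrN.
  by rewrite /c1 /c2 -surjective_pairing.
(* |N| = 1 differentiated along the curve: N is orthogonal to its derivative, which removes the
   terms in which [D] multiplies that derivative. *)
have unit0 : is_derive (0 : R) 1 (fun s => (N (c1 s, c2 s)).1 ^+ 2 + (N (c1 s, c2 s)).2 ^+ 2) 0.
  by apply: (@is_derive_locally _ (fun _ => 1) _ _ _ d d0) => s /Hd/(normal_unit nonsing) ->.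
have unit1 := is_deriveD (is_derive_mul (along _ _ _ HN1) (along _ _ _ HN1)) (is_derive_mul (along _ _ _ HN2) (along _ _ _ HN2)).
have ort := is_derive1_uniq unit0 unit1.
have nu := normal_unit nonsing Oc.
have -> : c 0 = (c1 0, c2 0) by rewrite /c1 /c2 -surjective_pairing.
apply: (is_derive_val (is_derive_locally d0 _ DD)) => [s /Hd Os|].
  rewrite !fctE (_ : c s = (c1 s, c2 s)); last by rewrite /c1 /c2 -surjective_pairing.
  transitivity (D (c1 s, c2 s) * ((N (c1 s, c2 s)).1 ^+ 2 + (N (c1 s, c2 s)).2 ^+ 2)); first by ring.
  by rewrite (normal_unit nonsing Os) mulr1.
(* rot F is multiplied by |N|^2 = 1, so that the remaining identity is polynomial modulo the
   orthogonality [ort]. *)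
rewrite !fctE -[curl F _]mulr1 -[X in _ = _ * X - _]nu /curl /turning.
move: ort {DD M1 M2 unit0 unit1}.
set X := (X in X * _ + _ * X + _); set Y := (X in _ = _ + (X * _ + _ * X)) => ort.
have E : X * (N (c1 0, c2 0)).1 + Y * (N (c1 0, c2 0)).2 = 0 by lra.
apply/eqP; rewrite -subr_eq0; apply/eqP.
transitivity (D (c1 0, c2 0) * (X * (N (c1 0, c2 0)).1 + Y * (N (c1 0, c2 0)).2)); last by rewrite E mulr0.
rewrite /X /Y {X Y ort E}; set q := (c1 0, c2 0).
move: ('D_e_x (fun p => (N p).1) q) ('D_e_y (fun p => (N p).1) q) ('D_e_x (fun p => (N p).2) q)
  ('D_e_y (fun p => (N p).2) q) ('D_e_x (fun p => (F p).1) q) ('D_e_y (fun p => (F p).1) q)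
  ('D_e_x (fun p => (F p).2) q) ('D_e_y (fun p => (F p).2) q) (N q).1 (N q).2 (F q).1 (F q).2 (D q)
  => a11 a12 a21 a22 b11 b12 b21 b22 m1 m2 f1 f2 dd.
by ring.
Qed.
End Speed.

(** * The angle in characteristic coordinates *)

Section Coordinates.
Context {R : realType}.
Implicit Types (a b x y r e d m : R).
Variables (Omega : set (R * R)) (F : R * R -> R * R) (H u : R * R -> R).
Local Notation N := (normal u F).
Local Notation D := (Dlen u F).

Lemma angle_near (W : set (R * R)) theta x y : open W -> W `<=` Omega -> Ck_field 1 Omega N ->
  angle_of N W theta -> W (x, y) -> exists2 r, 0 < r &
    C1box x y r (fun x y => theta (x, y))
      (fun x y => (N (x, y)).1 * 'D_e_x (fun q => (N q).2) (x, y) - (N (x, y)).2 * 'D_e_x (fun q => (N q).1) (x, y))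
      (fun x y => (N (x, y)).1 * 'D_e_y (fun q => (N q).2) (x, y) - (N (x, y)).2 * 'D_e_y (fun q => (N q).1) (x, y)).
Proof.
move=> oW WO [N1 N2] [ct tN] Wxy; have [r r0 HW] := open_box oW Wxy.
have HO x' y' : box x y r x' y' -> Omega (x', y') by move=> /HW/WO.
have [|r' /andP[r'0 _] Ht] := angle_C1box r0 (Ck1_C1box N1 HO) (Ck1_C1box N2 HO)
  (@cont2_uncurry _ theta _ _ (ct _ Wxy)).
  by move=> x' y' /HW/tN ->.
by exists r'.
Qed.

(** Differentiating [s] and [t] composed with [Phi] gives two linear equations for the
    [t]-derivative [(w1, w2)] of [Phi]: it is orthogonal to N^perp, and its product with g D N is
    1. *)
Lemma theta_t_coords (U W : set (R * R)) (s t f g theta : R * R -> R) Phi p :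
  open W -> W `<=` Omega -> Ck_field 1 Omega N -> (forall p, Omega p -> 0 < D p) ->
  (forall p, Omega p -> (N p).1 ^+ 2 + (N p).2 ^+ 2 = 1) -> open U -> U `<=` Omega ->
  char_coords u F H U s t f g Phi -> angle_of N W theta -> U p -> W p ->
  is_derive (s p, t p) (e_y : R * R) (theta \o Phi) (turning F u p / (g p * D p)).
Proof.
move=> oW WO N_C1 Dp Nu oU UO [s1 t1 _ _ fp gp _ _ gs gt _ _ oI inv [P1 P2] _] ang Up Wp.
set I := (X in open X) in oI P1 P2.
have Ip : I (s p, t p) by exists p.
have [r r0 HI] := open_box oI Ip; have bc := box_center (s p) (t p) r0.
have [d1 d2 _ _] := Ck1_C1box P1 HI bc; have [e1 e2 _ _] := Ck1_C1box P2 HI bc.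
move: d2 e2 {d1 e1}; set w1 := 'D_e_y _ _; set w2 := 'D_e_y _ _ => dw1 dw2.
have Pp := inv _ Up.
have Up' : U (p.1, p.2) by rewrite -surjective_pairing.
have Wp' : W (p.1, p.2) by rewrite -surjective_pairing.
have [q q0 HU] := open_box oU Up'; have bp := box_center p.1 p.2 q0.
have along h (hx hy : R -> R -> R) l : 0 < l -> C1box p.1 p.2 l (fun x y => h (x, y)) hx hy ->
    is_derive (t p) 1 (fun z => h (Phi (s p, z))) (hx p.1 p.2 * w1 + hy p.1 p.2 * w2).
  move=> l0 Hh; have T := C1box_tdiff Hh (box_center _ _ l0).
  have := @tdiff_curve _ (fun x y => h (x, y)) (fun z => (Phi (s p, z)).1) (fun z => (Phi (s p, z)).2) (t p).
  rewrite Pp => /(_ _ _ _ _ T dw1 dw2).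
  by congr is_derive; apply/funext => z; rewrite -surjective_pairing.
have coord z : `|z - t p| < r -> s (Phi (s p, z)) = s p /\ t (Phi (s p, z)) = z.
  move=> zr; have [|q' Uq' [<- <-]] := HI (s p) z; last by rewrite inv.
  by split => //; rewrite subrr normr0.
have Op := UO _ Up; have D0 := Dp _ Op; have g0 := gp _ Up; have f0 := fp _ Up.
have S0 : 'D_e_x s p * w1 + 'D_e_y s p * w2 = 0.
  have := along s _ _ _ q0 (Ck1_C1box s1 HU); rewrite -surjective_pairing => dS.
  have c0 : is_derive (t p) 1 (fun z => s (Phi (s p, z))) 0.
    by apply: (@is_derive_locally _ (fun _ => s p) _ _ _ r) => // z /coord[->].
  exact: is_derive1_uniq dS c0.
have T1 : 'D_e_x t p * w1 + 'D_e_y t p * w2 = 1.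
  have := along t _ _ _ q0 (Ck1_C1box t1 HU); rewrite -surjective_pairing => dT.
  have c0 : is_derive (t p) 1 (fun z => t (Phi (s p, z))) 1.
    by apply: (@is_derive_locally _ (fun z => z) _ _ _ r) => // z /coord[_ ->].
  exact: is_derive1_uniq dT c0.
have [sx sy] : 'D_e_x s p = f p * (N p).2 /\ 'D_e_y s p = f p * - (N p).1.
  by have := gs _ Up; rewrite /grad => -[-> ->].
have [tx ty] : 'D_e_x t p = g p * D p * (N p).1 /\ 'D_e_y t p = g p * D p * (N p).2.
  by have := gt _ Up; rewrite /grad => -[-> ->].
rewrite sx sy in S0; rewrite tx ty in T1.
have nu := Nu _ Op; have gD0 : g p * D p != 0 by rewrite mulf_neq0// gt_eqF.
have S1 : (N p).2 * w1 - (N p).1 * w2 = 0.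
  by apply: (mulfI (negbT (gt_eqF f0))); rewrite mulr0 -[RHS]S0; ring.
(* Cramer's rule: one side is multiplied by |N|^2 = 1, the other by [T1], and their difference is a
   multiple of [S1]. *)
have E1 : g p * D p * w1 = (N p).1.
  rewrite -[LHS]mulr1 -[X in _ * X = _]nu -[RHS]mulr1 -[X in _ = _ * X]T1.
  apply/eqP; rewrite -subr_eq0; apply/eqP.
  transitivity (g p * D p * (N p).2 * ((N p).2 * w1 - (N p).1 * w2)); first by ring.
  by rewrite S1 mulr0.
have E2 : g p * D p * w2 = (N p).2.
  rewrite -[LHS]mulr1 -[X in _ * X = _]nu -[RHS]mulr1 -[X in _ = _ * X]T1.
  apply/eqP; rewrite -subr_eq0; apply/eqP.
  transitivity (- (g p * D p * (N p).1 * ((N p).2 * w1 - (N p).1 * w2))); first by ring.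
  by rewrite S1 mulr0 oppr0.
have [l l0 Ht] := angle_near oW WO N_C1 ang Wp'.
have dth := along _ _ _ _ l0 Ht.
apply/is_derive_ey; apply: (is_derive_val dth).
rewrite -surjective_pairing /turning; apply: (mulfI gD0); rewrite [RHS]mulrC divfK//.
by rewrite mulrDr ![g p * D p * (_ * _)]mulrCA E1 E2 mulrC [X in _ + X]mulrC.
Qed.

End Coordinates.

Theorem theoremD (R : realType) (Omega : set (R * R))
  (F : R * R -> R * R) (H u : R * R -> R)
  (Omega_domain : domain Omega)
  (F_C1 : Ck_field 1 Omega F)
  (H_C0 : continuous_in Omega H)
  (u_C1 : Ck 1 Omega u)
  (nonsingular : forall p, Omega p -> grad u p + F p <> 0)
  (weak : weak_div_eq Omega (normal u F) H)
  (NH : exists NH, continuous_derivative_along (normal u F) Omega H NH) :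
  [/\ (forall (W : set (R * R)) (theta : R * R -> R),
        open W -> W `<=` Omega -> angle_of (normal u F) W theta ->
        Ck 1 W theta),
      (forall (I : set R) (c : R -> R * R),
        integral_curve (normal_perp u F) Omega I c -> C2_curve I c),
      (forall (I : set R) (c : R -> R * R),
        integral_curve (normal u F) Omega I c -> C2_curve I c) &
      exists2 NpD : R * R -> R,
        continuous_derivative_along (normal_perp u F) Omega (Dlen u F) NpD &
        forall (p0 : R * R) (U : set (R * R)) (s t f g : R * R -> R)
          (Phi : R * R -> R * R),
          Omega p0 -> open_nbhs p0 U -> U `<=` Omega ->
          char_coords u F H U s t f g Phi ->
        forall (W : set (R * R)) (theta : R * R -> R),
          open W -> W `<=` Omega -> angle_of (normal u F) W theta ->
        forall p : R * R, U p -> W p ->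
        exists NplogD : R,
          [/\ derivative_along (normal_perp u F) Omega
                (fun q => ln (Dlen u F q)) p NplogD,
              is_derive (s p, t p) e_y (theta \o Phi)
                (curl F p / (g p * Dlen u F p ^+ 2)
                 - NplogD / (g p * Dlen u F p)) &
              curl F p / (g p * Dlen u F p ^+ 2)
                - NplogD / (g p * Dlen u F p)
              = 1 / (g p * Dlen u F p ^+ 2) * (curl F p - NpD p)]].
Proof.
have [oO _ _] := Omega_domain; have [k kH] := NH.
have N_C1 := normal_C1 oO F_C1 u_C1 nonsingular H_C0 weak kH.
have Dp := Dlen_gt0 nonsingular; have nu := normal_unit nonsingular.
have P_C1 : Ck_field 1 Omega (normal_perp u F).
  have [N1 N2] := N_C1; split; first exact: N2.
  apply: Ck1_of_local => x y Oxy; have [r r0 HO] := open_box oO Oxy.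
  by exists r; do 2 eexists; split; [exact: r0|exact: (C1boxN (Ck1_C1box N1 HO))].
(* Written with [turning], this is defined on all of [Omega], where a continuous angle may fail to
   exist. *)
pose NpD p := curl F p - Dlen u F p * turning F u p.
have dD p I c : integral_curve (normal_perp u F) Omega I c -> I 0 -> c 0 = p ->
    is_derive (0 : R) 1 (Dlen u F \o c) (NpD p).
  by move=> ic I0 <-; exact: (Dlen_along oO F_C1 u_C1 nonsingular N_C1 ic I0).
have ex p : Omega p -> exists I c, [/\ integral_curve (normal_perp u F) Omega I c, I 0 & c 0 = p].
  exact: (char_curve oO F_C1 u_C1 nonsingular H_C0 weak kH).
split.
- move=> W theta oW WO ang; apply: Ck1_of_local => x y Wxy.
  have [r r0 Ht] := angle_near oW WO N_C1 ang Wxy.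
  by exists r; do 2 eexists; split; [exact: r0|exact: Ht].
- by move=> I c; exact: C2_integral_curve.
- by move=> I c; exact: C2_integral_curve.
exists NpD.
  split=> p Op; last by split; [exact: ex|move=> I c; exact: dD].
  apply: continuousB; first exact: (curl_cont F_C1 Op).
  by apply: continuousM; [exact: (Dlen_cont F_C1 u_C1 Op)|exact: (turning_cont N_C1 Op)].
move=> p0 U s t f g Phi _ [oU _] UO cc W theta oW WO ang p Up Wp.
have Op := UO _ Up; have D0 := Dp _ Op; have g0 := cc_g_pos cc Up.
have [DN gN] : Dlen u F p != 0 /\ g p != 0 by rewrite !gt_eqF.
(* The chain rule for ln. In the difference rot F then cancels, and N(theta) / (g D) remains. *)
exists (NpD p / Dlen u F p); split.
- split; first exact: ex.
  move=> I c ic I0 c0; have dDc := dD _ _ _ ic I0 c0.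
  have dl : is_derive ((Dlen u F \o c) 0) 1 (@ln R) (Dlen u F p)^-1.
    by rewrite /= c0; exact: is_derive1_ln.
  by have := is_derive_compR dDc dl; rewrite mulrC.
- have := theta_t_coords oW WO N_C1 Dp nu oU UO cc ang Up Wp.
  by congr is_derive; rewrite /NpD; field; rewrite DN gN.
by field; rewrite DN gN.
Qed.
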